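(* In the Hilbert space $L_2(\mathbb R_+)$, $\mathbb R_+=[0,\infty)$, consider the differential operators $L_cf=-\dfrac{d^2f}{dx^2}$, $c\in[0,\infty]$, with domains $$\operatorname{dom}L_c=\{f\in W_2^2(\mathbb R_+):f'(0)=cf(0)\}\ (0<c<\infty),$$ $$\operatorname{dom}L_0=\{f\in W_2^2(\mathbb R_+):f'(0)=0\},\qquad \operatorname{dom}L_\infty=\{f\in W_2^2(\mathbb R_+):f(0)=0\},$$ where $W_2^2(\mathbb R_+)$ is the Sobolev space. Then for all $c,d\in(0,\infty)$: $$\tfrac12(L_c\dot+L_d)=L_{\frac12(c+d)},\quad c_0(L_c,L_d)=L_{c_0(c,d)},\quad h(L_c,L_d)=L_{\frac{2cd}{c+d}},\quad ah(L_c,L_d)=L_{\sqrt{cd}};$$ $$\tfrac12(L_c\dot+L_\infty)=L_\infty,\quad c_0(L_c,L_\infty)=L_{2c+1},\quad h(L_c,L_\infty)=L_{2c},\quad ah(L_c,L_\infty)=L_\infty;$$ $$\tfrac12(L_c\dot+L_0)=L_{c/2},\quad c_0(L_c,L_0)=L_{\frac{c}{2+c}},\quad h(L_c,L_0)=L_0,\quad ah(L_c,L_0)=L_0;$$ and $$\tfrac12(L_0\dot+L_\infty)=L_\infty,\quad c_0(L_0,L_\infty)=L_1,\quad h(L_0,L_\infty)=L_0,\quad ah(L_\infty,L_0)=\langle L_\infty,L_0\rangle.$$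
   Context: The operators $L_c$, $c\in[0,\infty]$, are nonnegative selfadjoint. For positive numbers, $c_0(c,d)=\dfrac{c+d+2cd}{2+c+d}$. A linear relation (l.r.) in a complex Hilbert space $\mathcal H$ is a closed linear subspace $A=\{\{f,f'\}\}$ of $\mathcal H\oplus\mathcal H$ (closed operators are identified with their graphs); $\operatorname{mul}A=\{f':\{0,f'\}\in A\}$; $A^{-1}=\{\{f',f\}:\{f,f'\}\in A\}$; $\lambda A=\{\{f,\lambda f'\}\}$. A nonnegative selfadjoint l.r. decomposes as $A=\mathrm{Graph}(A_o)\oplus(\{0\}\oplus\operatorname{mul}A)$ with $A_o$ a nonnegative selfadjoint operator in $\mathcal H\ominus\operatorname{mul}A$. The closed form of $A$ is $A[\varphi]=\|A_o^{1/2}\varphi\|^2$, $\varphi\in\mathcal D[A]=\operatorname{dom}A_o^{1/2}$; this gives a bijection between nonnegative selfadjoint l.r. and closed nonnegative (not necessarily densely defined) forms. The form sum $A\dot+B$ is the nonnegative selfadjoint l.r. associated with the closed form $A[\varphi]+B[\varphi]$, $\varphi\in\mathcal D[A]\cap\mathcal D[B]$. The harmonic mean is $h(A,B):=\big(\tfrac12(A^{-1}\dot+B^{-1})\big)^{-1}$. The mean $c_0$ is $c_0(A,B):=\mathfrak C\big(\tfrac12(\mathfrak C(A)+\mathfrak C(B))\big)$, where $\mathfrak C$ is the Cayley transform: $\mathfrak C(A)=-I+2(I+A)^{-1}$ for a nonnegative selfadjoint l.r. $A$, and $\mathfrak C(T)=\{\{(I+T)f,(I-T)f\}:f\in\mathcal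 H\}$ for a selfadjoint contraction $T$. Arithmetic--harmonic means: put $A_0=A$, $B_0=B$, $A_n=\tfrac12(A_{n-1}\dot+B_{n-1})$, $B_n=h(A_{n-1},B_{n-1})$, $n\ge1$. The limits $A_\infty,B_\infty$ of $\{A_n\},\{B_n\}$ in the strong resolvent sense (strong convergence of $(A_n+I)^{-1}$ to $(A_\infty+I)^{-1}$, similarly for $B_n$) exist, and $ah(A,B):=\langle A_\infty,B_\infty\rangle$ (ordered pair); writing $ah(A,B)=L$ with a single relation $L$ means $A_\infty=B_\infty=L$. *)

(* Defs.v *)
From HB Require Import structures.
From mathcomp Require Import all_boot all_order all_algebra.
From mathcomp Require Import sesquilinear ring_quotient.
From mathcomp Require Import complex.
From mathcomp Require Import all_classical all_reals all_analysis.

Set Implicit Arguments.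
Unset Strict Implicit.
Unset Printing Implicit Defensive.

Import Order.TTheory GRing.Theory Num.Theory.
Import numFieldNormedType.Exports.

Local Open Scope classical_set_scope.
Local Open Scope ring_scope.
Local Open Scope complex_scope.

Section L2_space.
Variable R : realType.
Notation C := R[i].

Definition Rplus : set (measurableTypeR R) := `[0%R, +oo[%classic.

Lemma measurable_Rplus : measurable Rplus.
Proof. exact: measurable_itv. Qed.

(* Elements of L_2(R_+) are classes of functions on [R] modulo equality almost
   everywhere for this measure, which does not charge the negative half-line. *)
Definition leb : set (measurableTypeR R) -> \bar R :=
  mrestr (@lebesgue_measure R) measurable_Rplus.
HB.instance Definition _ := Measure.on leb.

Definition cintegral (f : R -> C) : C :=
  Rintegral leb setT (fun x => complex.Re (f x)) +i* Rintegral leb setT (fun x => complex.Im (f x)).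

Definition square_integrable : {pred R -> C} :=
  [pred f : R -> C | ((fun x => complex.Re (f x)) \in Lfun leb 2%:E) &&
                     ((fun x => complex.Im (f x)) \in Lfun leb 2%:E)].

Lemma Lfun2_submod : submod_closed (@Lfun _ _ R leb 2%:E : {pred R -> R}).
Proof. exact: (Lfun_submod_closed leb (lee1n 2)). Qed.

Lemma square_integrable_submod : submod_closed square_integrable.
Proof.
have [L0 Llin] := Lfun2_submod.
split; first by rewrite inE; apply/andP; split; exact: L0.
move=> a f g; rewrite !inE => /andP[fr fi] /andP[gr gi].
have L1 b h : h \in Lfun leb 2%:E -> b *: (h : R -> R) \in Lfun leb 2%:E.
  by move=> Lh; have := Llin b _ _ Lh L0; rewrite addr0.
case: a => a b; apply/andP; split.
- have -> : (fun x => complex.Re (((a +i* b) *: f + g) x)) =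
      (a *: (fun x => complex.Re (f x)) +
       ((- b) *: (fun x => complex.Im (f x)) + (fun x => complex.Re (g x))) : R -> R).
    apply/funext => x.
    rewrite -[LHS]/(complex.Re ((a +i* b) * f x + g x)).
    rewrite -[RHS]/(a * complex.Re (f x) + (- b * complex.Im (f x) + complex.Re (g x))).
    by case: (f x) (g x) => [u v] [w z] /=; rewrite addrA mulNr.
  by apply: (Llin) => //; exact: (Llin).
- have -> : (fun x => complex.Im (((a +i* b) *: f + g) x)) =
      (a *: (fun x => complex.Im (f x)) +
       (b *: (fun x => complex.Re (f x)) + (fun x => complex.Im (g x))) : R -> R).
    apply/funext => x.
    rewrite -[LHS]/(complex.Im ((a +i* b) * f x + g x)).
    rewrite -[RHS]/(a * complex.Im (f x) + (b * complex.Re (f x) + complex.Im (g x))).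
    by case: (f x) (g x) => [u v] [w z] /=; rewrite addrA.
  by apply: (Llin) => //; exact: (Llin).
Qed.

HB.instance Definition _ :=
  GRing.isSubmodClosed.Build _ _ square_integrable square_integrable_submod.

Record preL2 := PreL2 {
  preL2_fun :> R -> C;
  preL2P : square_integrable preL2_fun }.
HB.instance Definition _ := [isSub for preL2_fun].
HB.instance Definition _ := [Choice of preL2 by <:].
HB.instance Definition _ := [SubChoice_isSubLmodule of preL2 by <:].

Definition ae_null : {pred preL2} :=
  [pred f : preL2 | `[< (f : R -> C) = cst 0 %[ae leb] >] ].

Lemma ae_null_submod : submod_closed ae_null.
Proof.
split; first by apply/asboolP; exact: aeW.
move=> a f g /asboolP f0 /asboolP g0; apply/asboolP.
have FF : Filter (nbhs (almost_everywhere leb)) by exact: ae_filter_ringOfSetsType.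
apply: (filterS2 _ _ f0 g0) => x {}f0 {}g0 xT.
rewrite -[LHS]/(a * (f : R -> C) x + (g : R -> C) x).
by rewrite f0// g0//= mulr0 addr0.
Qed.

HB.instance Definition _ :=
  GRing.isSubmodClosed.Build _ _ ae_null ae_null_submod.

Definition L2 := @Quotient.quot preL2 ae_null.
HB.instance Definition _ := GRing.Zmodule.on L2.
HB.instance Definition _ := EqQuotient.on L2.

Local Open Scope quotient_scope.

Definition L2_scale (a : C) (f : L2) : L2 := \pi_L2 (a *: repr f).

Lemma L2_pi_eq (f g : preL2) : (\pi_L2 f == \pi_L2 g) = (f - g \in ae_null).
Proof. by rewrite Quotient.idealrBE. Qed.

Lemma L2_piD (f g : preL2) : \pi_L2 (f + g) = \pi_L2 f + \pi_L2 g.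
Proof. exact: Quotient.pi_add. Qed.

Lemma L2_piZ a (f : preL2) : L2_scale a (\pi_L2 f) = \pi_L2 (a *: f).
Proof.
apply/eqP; rewrite L2_pi_eq -scalerBr; apply: rpredZ.
by rewrite -L2_pi_eq reprK.
Qed.

Lemma L2_scaleA a b f : L2_scale a (L2_scale b f) = L2_scale (a * b) f.
Proof. by elim/quotW: f => f; rewrite (L2_piZ b) !L2_piZ scalerA. Qed.

Lemma L2_scale1 : left_id 1 L2_scale.
Proof. by elim/quotW => f; rewrite L2_piZ scale1r. Qed.

Lemma L2_scaleDr : right_distributive L2_scale +%R.
Proof.
by move=> a; elim/quotW => f; elim/quotW => g; rewrite -L2_piD !L2_piZ -L2_piD scalerDr.
Qed.

Lemma L2_scaleDl f : {morph L2_scale^~ f : a b / a + b}.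
Proof. by elim/quotW: f => f a b; rewrite !L2_piZ -L2_piD scalerDl. Qed.

HB.instance Definition _ := GRing.Zmodule_isLmodule.Build C L2
  L2_scaleA L2_scale1 L2_scaleDr L2_scaleDl.

Definition cintegrable (f : R -> C) :=
  leb.-integrable setT (EFin \o (fun x => complex.Re (f x))) /\
  leb.-integrable setT (EFin \o (fun x => complex.Im (f x))).

Let intZ (a : R) (f : R -> R) : leb.-integrable setT (EFin \o f) ->
  leb.-integrable setT (EFin \o (fun x => a * f x)).
Proof. by move=> fi; exact: (@integrableZl _ _ _ _ _ measurableT a _ fi). Qed.

Let intD (f g : R -> R) : leb.-integrable setT (EFin \o f) ->
  leb.-integrable setT (EFin \o g) ->
  leb.-integrable setT (EFin \o (fun x => f x + g x)).
Proof. by move=> fi gi; exact: (@integrableD _ _ _ _ _ measurableT _ _ fi gi). Qed.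

Lemma cintegral_linear a (f g : R -> C) : cintegrable f -> cintegrable g ->
  cintegral (fun x => a * f x + g x) = a * cintegral f + cintegral g.
Proof.
case: a => a b [fr fi] [gr gi].
rewrite /cintegral.
have Er x : complex.Re ((a +i* b) * f x + g x) =
    a * complex.Re (f x) + (- b * complex.Im (f x) + complex.Re (g x)).
  by case: (f x) (g x) => [u v] [w z] /=; rewrite addrA mulNr.
have Ei x : complex.Im ((a +i* b) * f x + g x) =
    a * complex.Im (f x) + (b * complex.Re (f x) + complex.Im (g x)).
  by case: (f x) (g x) => [u v] [w z] /=; rewrite addrA.
under eq_Rintegral do rewrite Er.
under [X in _ +i* X]eq_Rintegral do rewrite Ei.
rewrite !RintegralD ?RintegralZl//; do ?[exact: intZ | exact: intD (intZ _ _) _].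
by apply/eqP; rewrite eq_complex/= mulNr !addrA !eqxx.
Qed.

Definition preL2_dot (f g : preL2) : C := cintegral (fun x => f x * conjc (g x)).

Let L2Re (f : preL2) : (fun x => complex.Re (f x)) \in Lfun leb 2%:E.
Proof. by have := preL2P f; rewrite inE => /andP[]. Qed.

Let L2Im (f : preL2) : (fun x => complex.Im (f x)) \in Lfun leb 2%:E.
Proof. by have := preL2P f; rewrite inE => /andP[]. Qed.

Let L2int (f g : R -> R) : f \in Lfun leb 2%:E -> g \in Lfun leb 2%:E ->
  leb.-integrable setT (EFin \o (fun x => f x * g x)).
Proof. by move=> fL gL; apply/Lfun1_integrable; exact: Lfun2_mul_Lfun1. Qed.

Lemma preL2_dot_integrable (f g : preL2) : cintegrable (fun x => f x * conjc (g x)).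
Proof.
split.
- rewrite (_ : (fun x => _) = (fun x => complex.Re (f x) * complex.Re (g x) +
    complex.Im (f x) * complex.Im (g x))); first by apply: intD; exact: L2int.
  by apply/funext => x; case: (f x) (g x) => [u v] [w z] /=; rewrite mulrN opprK.
- rewrite (_ : (fun x => _) = (fun x => (-1) * (complex.Re (f x) * complex.Im (g x)) +
    complex.Im (f x) * complex.Re (g x))).
    by apply: intD; [apply: intZ|]; exact: L2int.
  by apply/funext => x; case: (f x) (g x) => [u v] [w z] /=; rewrite mulrN mulN1r.
Qed.

Lemma preL2_dot_linear a (f g h : preL2) :
  preL2_dot (a *: f + g) h = a * preL2_dot f h + preL2_dot g h.
Proof.
rewrite /preL2_dot -cintegral_linear; do ?exact: preL2_dot_integrable.
congr cintegral; apply/funext => x.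
by rewrite -[X in X * _]/(a * f x + g x) mulrDl mulrA.
Qed.

Lemma preL2_dotC (f g : preL2) : preL2_dot f g = conjc (preL2_dot g f).
Proof.
have [gr gi] := preL2_dot_integrable g f.
rewrite /preL2_dot /cintegral/=; congr (_ +i* _).
  apply: eq_Rintegral => x _.
  by case: (f x) (g x) => [u v] [w z] /=; rewrite !mulrN mulrC [v * z]mulrC.
rewrite -mulN1r -RintegralZl//; apply: eq_Rintegral => x _.
by case: (f x) (g x) => [u v] [w z] /=; rewrite mulN1r opprD !mulrN opprK mulrC addrC [v * w]mulrC.
Qed.

Lemma preL2_dot_null (f g : preL2) : f \in ae_null -> preL2_dot f g = 0.
Proof.
move=> /asboolP f0.
have FF : Filter (nbhs (almost_everywhere leb)) by exact: ae_filter_ringOfSetsType.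
have [ir ii] := preL2_dot_integrable f g.
rewrite /preL2_dot /cintegral /Rintegral.
rewrite (@ae_eq_integral _ _ _ leb setT (cst 0%E)) ?integral0//; last 2 first.
- exact: measurable_int ir.
- by apply: filterS f0 => x /[apply] -> /=; rewrite mul0r.
rewrite (@ae_eq_integral _ _ _ leb setT (cst 0%E)) ?integral0//.
- exact: measurable_int ii.
- by apply: filterS f0 => x /[apply] -> /=; rewrite mul0r.
Qed.

Lemma preL2_dot_gt0 (f : preL2) : f \notin ae_null -> 0 < preL2_dot f f.
Proof.
move=> fN0.
have [ir ii] := preL2_dot_integrable f f.
have Er x : complex.Re (f x * conjc (f x)) = complex.Re (f x) ^+ 2 + complex.Im (f x) ^+ 2.
  by case: (f x) => [u v] /=; rewrite mulrN opprK !expr2.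
have Ei x : complex.Im (f x * conjc (f x)) = 0.
  by case: (f x) => [u v] /=; rewrite mulrN mulrC addNr.
rewrite ltcE /= ; apply/andP; split.
  by apply/eqP; rewrite /Rintegral integral0_eq// => x _ /=; rewrite Ei.
rewrite lt_neqAle Rintegral_ge0 ?andbT; last first.
  by move=> x _; rewrite Er addr_ge0// sqr_ge0.
apply: contra fN0 => /eqP I0; apply/asboolP.
have FF : Filter (nbhs (almost_everywhere leb)) by exact: ae_filter_ringOfSetsType.
have /(ae_eq_integral_abs leb measurableT (measurable_int _ ir)) : 
   (\int[leb]_(x in setT) `|(complex.Re (f x * conjc (f x)))%R%:E|)%E = 0%E.
  rewrite -[RHS]/(0%R%:E) I0 /Rintegral fineK; last exact: integrable_fin_num.
  by apply: eq_integral => x _; rewrite gee0_abs//= lee_fin Er addr_ge0// sqr_ge0.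
apply: filterS => x /[apply] [] []; rewrite Er /= => /eqP.
rewrite paddr_eq0 ?sqr_ge0// !sqrf_eq0 => /andP[/eqP r0 /eqP i0] .
by apply/eqP; rewrite eq_complex /= r0 i0 !eqxx.
Qed.

Definition L2_dot (f g : L2) : C := preL2_dot (repr f) (repr g).

Lemma L2_dot_pi (f g : preL2) : L2_dot (\pi_L2 f) (\pi_L2 g) = preL2_dot f g.
Proof.
have E (u v h : preL2) : u - v \in ae_null -> preL2_dot u h = preL2_dot v h.
  move=> /(preL2_dot_null h); rewrite addrC -scaleN1r preL2_dot_linear mulN1r.
  by move/eqP; rewrite addrC subr_eq0 => /eqP.
rewrite /L2_dot (E _ f); last by rewrite -L2_pi_eq reprK.
by rewrite preL2_dotC (E _ g) -?preL2_dotC// -L2_pi_eq reprK.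
Qed.

Lemma L2_dotC (f g : L2) : L2_dot f g = (-1) ^+ false * Num.conj (L2_dot g f).
Proof.
elim/quotW: f => f; elim/quotW: g => g; rewrite !L2_dot_pi mul1r.
exact: preL2_dotC.
Qed.

Lemma L2_dot_bilinear :
  bilinear_for ( *%R : GRing.Scale.law C C) (Num.conj \; *%R : GRing.Scale.law C C) L2_dot.
Proof.
have L h : scalar (L2_dot^~ h).
  elim/quotW: h => h a; elim/quotW => f; elim/quotW => g.
  rewrite (L2_piZ a f : a *: \pi_L2 f = _) -L2_piD !L2_dot_pi.
  exact: preL2_dot_linear.
split=> [//|h a f g] /=.
rewrite L2_dotC L rmorphD rmorphM/= mul1r [L2_dot h f]L2_dotC [L2_dot h g]L2_dotC.
by rewrite !mul1r.
Qed.

HB.instance Definition _ := bilinear_isBilinear.Build C L2 L2 C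
  *%R (Num.conj \; *%R) L2_dot L2_dot_bilinear.
HB.instance Definition _ := isHermitianSesquilinear.Build C L2 false Num.conj L2_dot L2_dotC.

Lemma L2_dot_gt0 (f : L2) : f != 0 -> 0 < L2_dot f f.
Proof.
elim/quotW: f => f f0; rewrite L2_dot_pi; apply: preL2_dot_gt0.
apply: contra f0 => f0.
have <- : \pi_L2 0 = 0 by apply: (@addrI _ (\pi_L2 0)); rewrite -L2_piD !addr0.
by rewrite L2_pi_eq subr0.
Qed.

HB.instance Definition _ := isDotProduct.Build C L2 L2_dot L2_dot_gt0.

Definition L2_fun (f : L2) : R -> C := repr f.

End L2_space.

Section linear_relations.
Variables (R : realType) (H : lmodType R[i]) (dot : {dot H for Num.conj}).

Definition hnorm (u : H) : R := Num.sqrt (complex.Re (dot u u)).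

Definition hcvg (u : nat -> H) (l : H) : Prop :=
  hnorm (u n - l) @[n --> \oo] --> (0 : R).

Notation lrel := (set (H * H)).
Implicit Types (A B S T : lrel) (K : set H).

Definition linear_relation A : Prop :=
  [/\ A 0,
      forall (a : R[i]) p q, A p -> A q -> A (a *: p + q)
    & forall (u : nat -> H * H) l, (forall n, A (u n)) ->
        hcvg (fun n => (u n).1) l.1 -> hcvg (fun n => (u n).2) l.2 -> A l].

Definition lr_dom A : set H := [set f | exists f', A (f, f')].
Definition lr_mul A : set H := [set f' | A (0, f')].
Definition lr_id : lrel := [set p | p.2 = p.1].
Definition lr_inv A : lrel := [set p | A (p.2, p.1)].
Definition lr_scale (a : R[i]) A : lrel :=
  [set p | exists f', A (p.1, f') /\ p.2 = a *: f'].
Definition lr_add A B : lrel :=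
  [set p | exists f' f'', [/\ A (p.1, f'), B (p.1, f'') & p.2 = f' + f'']].
Definition lr_comp A B : lrel :=
  [set p | exists g, B (p.1, g) /\ A (g, p.2)].

(* The value at [f] of the operator with graph [S]; 0 outside the domain. *)
Definition lr_app S (f : H) : H := xget 0 [set f' | S (f, f')].

(* Selfadjointness is relative to a closed subspace [K] because the operator
   part of a relation lives in the complement of its multivalued part. *)
Definition nonneg_selfadjoint_in K A : Prop :=
  [/\ linear_relation A,
      A = [set p | [/\ K p.1, K p.2 &
                       forall q, A q -> dot p.2 q.1 = dot p.1 q.2]]
    & forall p, A p -> 0 <= dot p.2 p.1].

Definition nonneg_selfadjoint A : Prop := nonneg_selfadjoint_in setT A.

Definition orth_mul A : set H :=
  [set f | forall g, lr_mul A g -> dot f g = 0].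

Definition operator_part A : lrel := [set p | A p /\ orth_mul A p.2].

Definition is_sqrt_in K S T : Prop :=
  [/\ nonneg_selfadjoint_in K S, lr_mul S = [set 0] & lr_comp S S = T].

(* [A_o^{1/2}]. Here and below, [xget] picks the object with the stated property;
   its junk value [set0] is not a linear relation. *)
Definition sqrt_op A : lrel :=
  xget set0 [set S | is_sqrt_in (orth_mul A) S (operator_part A)].

Definition form_dom A : set H := lr_dom (sqrt_op A).
Definition form_val A (phi : H) : R := hnorm (lr_app (sqrt_op A) phi) ^+ 2.

Definition is_form_sum A B C : Prop :=
  [/\ nonneg_selfadjoint C,
      form_dom C = form_dom A `&` form_dom B
    & forall phi, form_dom C phi ->
        form_val C phi = form_val A phi + form_val B phi].

Definition form_sum A B : lrel := xget set0 [set C | is_form_sum A B C].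

Definition arith_mean A B : lrel := lr_scale 2^-1 (form_sum A B).

Definition harm_mean A B : lrel :=
  lr_inv (lr_scale 2^-1 (form_sum (lr_inv A) (lr_inv B))).

(* The two directions of the Cayley transform: [cayley] for nonnegative
   selfadjoint relations, [cayley_contr] for (graphs of) selfadjoint
   contractions. *)
Definition cayley A : lrel :=
  lr_add (lr_scale (-1) lr_id) (lr_scale 2 (lr_inv (lr_add lr_id A))).

Definition cayley_contr T : lrel :=
  [set p | exists f Tf, T (f, Tf) /\ p = (f + Tf, f - Tf)].

Definition c0_mean A B : lrel :=
  cayley_contr (lr_scale 2^-1 (lr_add (cayley A) (cayley B))).

Definition resolvent A : lrel := lr_inv (lr_add A lr_id).

Definition sr_cvg (A_ : nat -> lrel) A : Prop :=
  [/\ forall n, nonneg_selfadjoint (A_ n), nonneg_selfadjoint A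
    & forall f, hcvg (fun n => lr_app (resolvent (A_ n)) f)
                     (lr_app (resolvent A) f)].

Definition sr_lim (A_ : nat -> lrel) : lrel := xget set0 [set A | sr_cvg A_ A].

Fixpoint ah_seq A B (n : nat) : lrel * lrel :=
  if n is m.+1 then
    let: (Am, Bm) := ah_seq A B m in (arith_mean Am Bm, harm_mean Am Bm)
  else (A, B).

Definition ah_mean A B : lrel * lrel :=
  (sr_lim (fun n => (ah_seq A B n).1), sr_lim (fun n => (ah_seq A B n).2)).

End linear_relations.

Section half_line_operators.
Variable R : realType.
Implicit Types f g : L2 R.

Definition test_function (phi : R -> R) : Prop :=
  (forall n x, derivable (derive1n n phi) x 1) /\
  (exists a b : R, 0 < a /\ forall x, ~~ (a <= x <= b) -> phi x = 0).

Definition weak_derivative (n : nat) f g : Prop :=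
  forall phi, test_function phi ->
    cintegral (fun x => L2_fun f x * (derive1n n phi x)%:C) =
    (-1) ^+ n * cintegral (fun x => L2_fun g x * (phi x)%:C).

Definition W22 f : Prop :=
  exists f1 f2, weak_derivative 1 f f1 /\ weak_derivative 2 f f2.

(* [z] is the value at 0 of the representative of [f] continuous on [0, +oo[. *)
Definition boundary_value f (z : R[i]) : Prop :=
  exists u : R -> R[i],
    [/\ {within `[0, +oo[, continuous (fun x => complex.Re (u x))},
        {within `[0, +oo[, continuous (fun x => complex.Im (u x))},
        u = L2_fun f %[ae @leb R] & u 0 = z].

Definition robin (c : R) f : Prop :=
  exists f1 z z1, [/\ weak_derivative 1 f f1, boundary_value f z,
    boundary_value f1 z1 & z1 = c%:C * z].

(* Meaningful for [c] in [0, +oo]. *)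
Definition boundary_condition (c : \bar R) f : Prop :=
  if c is r%:E%E then robin r f else boundary_value f 0.

Definition L_op (c : \bar R) : set (L2 R * L2 R) :=
  [set p | [/\ W22 p.1, boundary_condition c p.1
              & weak_derivative 2 p.1 (- p.2)]].

Definition c0_num (c d : R) : R := (c + d + 2 * c * d) / (2 + c + d).

End half_line_operators.

(* Main.v *)
(* Let D be the graph of d/dx on the half-line and e(x) = exp(-x). Integration by
   parts gives f(0) = <f - f', e> for (f, f') in D, so that all the L_c can be
   described by the abstract pair (D, e). In these terms L_c is the relation of the
   closed form |f'|^2 + c |f(0)|^2 on dom D (on the kernel of f |-> f(0) when c is
   infinite), whence form sums add the parameters. Inversion sends (D, e, c) to
   (D^-1, -e, 1/c), whence harmonic means of the L_c are harmonic means of the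
   parameters. Finally (I + L_c)^-1 = T - k(c) w(.) e with T and w independent of c
   and k(c) = c/(1 + c): the Cayley transforms are affine in k(c), which yields the
   mean c_0, and convergence of k(c_n) yields strong resolvent convergence, which
   reduces the arithmetic-harmonic iteration to the numerical one. That (D, e) has
   the required properties comes from the completeness of L_2 and from
   du Bois-Reymond's lemma. *)
Require Import Defs.
From mathcomp Require Import all_boot all_order all_algebra complex.
From mathcomp Require Import sesquilinear ring lra.
From mathcomp Require Import all_classical all_reals all_analysis measurable_realfun.
Import Order.TTheory GRing.Theory Num.Theory.
Import numFieldNormedType.Exports.

Set Implicit Arguments.
Unset Strict Implicit.
Unset Printing Implicit Defensive.

Local Open Scope classical_set_scope.
Local Open Scope ring_scope.
Local Open Scope complex_scope.

(** The definitions pick square roots, form sums and strong resolvent limits by [xget], so each of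
    them must be shown to exist and to be pinned down by its description. Nonnegative selfadjoint
    relations are therefore traded for their resolvents T with 0 <= T <= I, and roots of such T are
    built by a monotone iteration. Uniqueness of the root of a relation is bypassed: a closed form
    can be recovered from its relation, so every choice of root gives the same form. In a boundary
    system the maximality clause says that D contains every pair satisfying the Green identity
    against all elements of D with boundary value 0; it turns weak equations into membership in D.
    Since (e, -e) lies in D, e solves -u'' + u = 0, which is why the resolvents differ only along e.
    Since <f - f', e> is continuous for the graph norm, the boundary term changes the form norm only
    to an equivalent one, and the forms for all finite c are closed on the same domain. The value c
    = +oo is kept on the same footing as the finite ones because inversion and harmonic means
    exchange 0 and +oo. *)

Notation Re := complex.Re.
Notation Im := complex.Im.

(** * Semi-inner products *)

Section complex_aux.
Variable R : realType.
Implicit Types (z w : R[i]) (t : R).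

Lemma complexP z w : Re z = Re w -> Im z = Im w -> z = w.
Proof. by case: z w => [a b] [c d] /= -> ->. Qed.

Lemma ReD z w : Re (z + w) = Re z + Re w.
Proof. by case: z w => [a b] [c d]. Qed.

Lemma ImD z w : Im (z + w) = Im z + Im w.
Proof. by case: z w => [a b] [c d]. Qed.

Lemma ReN z : Re (- z) = - Re z.
Proof. by case: z. Qed.

Lemma ImN z : Im (- z) = - Im z.
Proof. by case: z. Qed.

Lemma ReM z w : Re (z * w) = Re z * Re w - Im z * Im w.
Proof. by case: z w => [a b] [c d]. Qed.

Lemma ImM z w : Im (z * w) = Re z * Im w + Im z * Re w.
Proof. by case: z w => [a b] [c d]. Qed.

Lemma Re_conjc z : Re (conjc z) = Re z.
Proof. by case: z. Qed.

Lemma Im_conjc z : Im (conjc z) = - Im z.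
Proof. by case: z. Qed.

Definition ReImE := (ReD, ImD, ReN, ImN, ReM, ImM, Re_conjc, Im_conjc).

Lemma ge0_complex z : (0 <= z) = (Im z == 0) && (0 <= Re z).
Proof. by case: z => a b; rewrite lecE. Qed.

End complex_aux.

Section linear_maps.
Variables (R : realType) (U V : lmodType R[i]).
Implicit Types (X : U -> V) (u v : U).

Lemma lin0 X : linear X -> X 0 = 0.
Proof.
move=> lX; have := lX 1 0 0; rewrite !scale1r addr0 => /eqP.
by rewrite -subr_eq0 opprD addNKr oppr_eq0 => /eqP.
Qed.

Lemma linZ X a u : linear X -> X (a *: u) = a *: X u.
Proof. by move=> lX; rewrite -[a *: u]addr0 lX lin0// addr0. Qed.

Lemma linD X u v : linear X -> X (u + v) = X u + X v.
Proof. by move=> lX; rewrite -[u]scale1r lX !scale1r. Qed.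

Lemma linB X u v : linear X -> X (u - v) = X u - X v.
Proof. by move=> lX; rewrite linD// -scaleN1r linZ// scaleN1r. Qed.

End linear_maps.

Section semi_inner_products.
Variables (R : realType) (E : lmodType R[i]).
Implicit Types (b : E -> E -> R[i]) (u v w : E) (M L : set E).

(** Null vectors are allowed, because one theory has to serve the inner product of the space, the
    forms [b (X u) v] of nonnegative operators, and forms on pairs that see only one component.
    Limits are then unique only up to null vectors. *)
Definition sip b : Prop :=
  [/\ forall a u v w, b (a *: u + v) w = a * b u w + b v w,
      forall u v, b v u = conjc (b u v)
    & forall u, 0 <= b u u].

Definition sqn b u : R := Re (b u u).

Definition cvg_sip b (u : nat -> E) l : Prop :=
  sqn b (u n - l) @[n --> \oo] --> (0 : R).

Definition cauchy_sip b (u : nat -> E) : Prop :=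
  forall e : R, 0 < e -> exists N, forall m n, (N <= m)%N -> (N <= n)%N ->
    sqn b (u m - u n) < e.

Definition complete_sip b M : Prop :=
  forall u : nat -> E, (forall n, M (u n)) -> cauchy_sip b u -> exists2 l, M l & cvg_sip b u l.

Definition subspace M : Prop :=
  M 0 /\ forall (a : R[i]) u v, M u -> M v -> M (a *: u + v).

Lemma subspaceZ M a u : subspace M -> M u -> M (a *: u).
Proof. by case=> M0 Ml Mu; rewrite -[_ *: _]addr0; exact: Ml. Qed.

Lemma subspaceD M u v : subspace M -> M u -> M v -> M (u + v).
Proof. by case=> M0 Ml Mu Mv; rewrite -[u]scale1r; exact: Ml. Qed.

Lemma subspaceN M u : subspace M -> M u -> M (- u).
Proof. by move=> sM Mu; rewrite -scaleN1r; exact: subspaceZ. Qed.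

Lemma subspaceB M u v : subspace M -> M u -> M v -> M (u - v).
Proof. by move=> sM Mu Mv; apply: subspaceD => //; exact: subspaceN. Qed.

Section theory.
Variable b : E -> E -> R[i].
Hypothesis hb : sip b.

Lemma sipC u v : b v u = conjc (b u v). Proof. by case: hb. Qed.

Lemma sip_ge0 u : 0 <= b u u. Proof. by case: hb. Qed.

Lemma sip0l w : b 0 w = 0.
Proof.
case: hb => bl _ _; have := bl 1 0 0 w; rewrite scale1r addr0 mul1r => /eqP.
by rewrite -subr_eq0 opprD addNKr oppr_eq0 => /eqP.
Qed.

Lemma sipZl a u w : b (a *: u) w = a * b u w.
Proof. by case: hb => bl _ _; rewrite -[a *: u]addr0 bl sip0l addr0. Qed.

Lemma sipDl u v w : b (u + v) w = b u w + b v w.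
Proof. by case: hb => bl _ _; rewrite -{1}[u]scale1r bl mul1r. Qed.

Lemma sipNl u w : b (- u) w = - b u w.
Proof. by rewrite -scaleN1r sipZl mulN1r. Qed.

Lemma sipBl u v w : b (u - v) w = b u w - b v w.
Proof. by rewrite sipDl sipNl. Qed.

Lemma sip0r w : b w 0 = 0. Proof. by rewrite sipC sip0l rmorph0. Qed.

Lemma sipZr a u w : b w (a *: u) = conjc a * b w u.
Proof. by rewrite sipC sipZl rmorphM/= -sipC. Qed.

Lemma sipDr u v w : b w (u + v) = b w u + b w v.
Proof. by rewrite sipC sipDl rmorphD/= -!sipC. Qed.

Lemma sipNr u w : b w (- u) = - b w u.
Proof. by rewrite sipC sipNl rmorphN/= -sipC. Qed.

Lemma sipBr u v w : b w (u - v) = b w u - b w v.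
Proof. by rewrite sipDr sipNr. Qed.

Lemma Re_sipC u v : Re (b u v) = Re (b v u).
Proof. by rewrite sipC Re_conjc. Qed.

Lemma sqn_ge0 u : 0 <= sqn b u.
Proof. by have := sip_ge0 u; rewrite ge0_complex => /andP[]. Qed.

Lemma sip_sqn u : b u u = (sqn b u)%:C.
Proof.
have := sip_ge0 u; rewrite ge0_complex => /andP[/eqP i0 _].
exact: complexP.
Qed.

Lemma sqnD u v : sqn b (u + v) = sqn b u + sqn b v + 2 * Re (b u v).
Proof. rewrite /sqn sipDl !sipDr !ReImE (Re_sipC v u); ring. Qed.

Lemma sqnN u : sqn b (- u) = sqn b u.
Proof. by rewrite /sqn sipNl sipNr opprK. Qed.

Lemma sqnB u v : sqn b (u - v) = sqn b u + sqn b v - 2 * Re (b u v).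
Proof. by rewrite sqnD sqnN sipNr ReN mulrN. Qed.

Lemma sqnBC u v : sqn b (u - v) = sqn b (v - u).
Proof. by rewrite -sqnN opprB. Qed.

Lemma sqnZ a u : sqn b (a *: u) = (Re a ^+ 2 + Im a ^+ 2) * sqn b u.
Proof.
rewrite /sqn sipZl sipZr !ReImE.
have -> : Im (b u u) = 0 by rewrite sip_sqn.
ring.
Qed.

Lemma sqnZr (t : R) u : sqn b (t%:C *: u) = t ^+ 2 * sqn b u.
Proof. by rewrite sqnZ /= expr0n addr0. Qed.

Lemma Re_sipZl (t : R) u v : Re (b (t%:C *: u) v) = t * Re (b u v).
Proof. by rewrite sipZl ReM/= mul0r subr0. Qed.

Lemma sqn0 : sqn b 0 = 0. Proof. by rewrite /sqn sip0l. Qed.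

Lemma sqnD_le u v : sqn b (u + v) <= 2 * sqn b u + 2 * sqn b v.
Proof. have := sqn_ge0 (u - v); rewrite sqnB sqnD; lra. Qed.

Lemma sqnB_le u v : sqn b (u - v) <= 2 * sqn b u + 2 * sqn b v.
Proof. by rewrite -(sqnN v); exact: sqnD_le. Qed.

(** The quadratic polynomial [sqn b (u + t v)] in the real variable t is nonnegative. *)
Lemma CS u v : Re (b u v) ^+ 2 <= sqn b u * sqn b v.
Proof.
have H t : 0 <= sqn b u + 2 * t * Re (b u v) + t ^+ 2 * sqn b v.
  have := sqn_ge0 (u + t%:C *: v).
  rewrite sqnD sqnZr (Re_sipC u) Re_sipZl (Re_sipC v); lra.
have := sqn_ge0 v; rewrite le_eqVlt => /orP[/eqP v0|v0].
  have [->|r0] := eqVneq (Re (b u v)) 0; first by rewrite expr0n -v0 mulr0.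
  (* For null [v] the polynomial is affine with nonzero slope, and this t gives it the value -1. *)
  have := H (- (sqn b u + 1) / (2 * Re (b u v))); rewrite -v0.
  have -> : 2 * (- (sqn b u + 1) / (2 * Re (b u v))) * Re (b u v) = - (sqn b u + 1).
    by field.
  lra.
have := H (- Re (b u v) / sqn b v).
have -> : sqn b u + 2 * (- Re (b u v) / sqn b v) * Re (b u v) +
  (- Re (b u v) / sqn b v) ^+ 2 * sqn b v = sqn b u - Re (b u v) ^+ 2 / sqn b v.
  by field; rewrite gt_eqF.
by rewrite subr_ge0 ler_pdivrMr.
Qed.

Lemma CS_Im u v : Im (b u v) ^+ 2 <= sqn b u * sqn b v.
Proof.
have := CS u ('i%C *: v); rewrite sqnZ sipZr !ReImE/= expr0n expr1n add0r mul1r.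
by rewrite mul0r add0r mulN1r opprK.
Qed.

Lemma Re0_sip0 M x : subspace M -> (forall r, M r -> Re (b x r) = 0) ->
  forall r, M r -> b x r = 0.
Proof.
move=> sM h r Mr; apply: complexP; first exact: h.
by have := h _ (subspaceZ 'i%C sM Mr); rewrite sipZr !ReImE/= mul0r mulN1r opprK add0r.
Qed.

Lemma cvg_sqn0_sq (x y : nat -> R) (K : R) : (forall n, x n ^+ 2 <= y n * K) ->
  y @ \oo --> (0 : R) -> x @ \oo --> (0 : R).
Proof.
move=> xy y0.
have x2 : (fun n => x n ^+ 2) @ \oo --> (0 : R).
  apply: (@squeeze_cvgr _ _ _ _ (fun=> 0) (fun n => y n * K)).
  - by near=> n; rewrite sqr_ge0 xy.
  - exact: cvg_cst.
  - by rewrite -(mul0r K); apply: cvgMl.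
apply/norm_cvg0P.
have -> : (fun n => `|x n|) = (fun n => Num.sqrt (x n ^+ 2)).
  by apply/funext => n; rewrite sqrtr_sqr.
by rewrite -sqrtr0; apply: (continuous_cvg _ (@sqrt_continuous R _)).
Unshelve. all: by end_near.
Qed.

Lemma cvg_sip_Re (u : nat -> E) l v : cvg_sip b u l -> Re (b (u n) v) @[n --> \oo] --> Re (b l v).
Proof.
move=> ul; apply/subr_cvg0; apply: (@cvg_sqn0_sq _ _ (sqn b v) _ ul) => n.
by rewrite -ReN -ReD -sipBl; exact: CS.
Qed.

Lemma cvg_sip_sqn (u : nat -> E) l : cvg_sip b u l -> sqn b (u n) @[n --> \oo] --> sqn b l.
Proof.
move=> ul.
have -> : (fun n => sqn b (u n)) = (fun n => sqn b (u n - l) - sqn b l + 2 * Re (b (u n) l)).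
  by apply/funext => n; rewrite sqnB; ring.
rewrite [X in _ --> X](_ : _ = 0 - sqn b l + 2 * Re (b l l)); last by rewrite -/(sqn b l); ring.
apply: cvgD; last by apply: cvgMr; exact: cvg_sip_Re.
by apply: cvgD; [exact: ul|exact: cvg_cst].
Qed.

Lemma cvg_sip_squeeze (u : nat -> E) l (y : nat -> R) : (forall n, sqn b (u n - l) <= y n) ->
  y @ \oo --> (0 : R) -> cvg_sip b u l.
Proof.
move=> uy y0; apply: (@squeeze_cvgr _ _ _ _ (fun=> 0) y) => //; last exact: cvg_cst.
by near=> n; rewrite sqn_ge0 uy.
Unshelve. all: by end_near.
Qed.

Lemma cvg_sipP a (u v : nat -> E) l k : cvg_sip b u l -> cvg_sip b v k ->
  cvg_sip b (fun n => a *: u n + v n) (a *: l + k).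
Proof.
move=> ul vk.
apply: (@cvg_sip_squeeze _ _ (fun n => 2 * ((Re a ^+ 2 + Im a ^+ 2) * sqn b (u n - l)) +
    2 * sqn b (v n - k))).
  by move=> n; rewrite opprD addrACA -scalerBr -sqnZ; exact: sqnD_le.
rewrite -[X in _ --> X]addr0; apply: cvgD.
  rewrite -(mulr0 2); apply: cvgMr.
  by rewrite -(mulr0 (Re a ^+ 2 + Im a ^+ 2)); apply: cvgMr.
by rewrite -(mulr0 2); apply: cvgMr.
Qed.

Lemma cvg_sip_cst l : cvg_sip b (fun=> l) l.
Proof. by rewrite /cvg_sip subrr sqn0; exact: cvg_cst. Qed.

Lemma cvg_sip_uniq (u : nat -> E) l k : cvg_sip b u l -> cvg_sip b u k -> sqn b (l - k) = 0.
Proof.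
move=> ul uk; have := cvg_sipP (-1) ul uk => /cvg_sip_sqn.
under eq_fun do rewrite scaleN1r addNr sqn0.
rewrite scaleN1r addrC => /cvg_lim => /(_ (@Rhausdorff R)).
by rewrite lim_cst// sqnBC => <-.
Qed.

Lemma cvg_cauchy_sip (u : nat -> E) l : cvg_sip b u l -> cauchy_sip b u.
Proof.
move=> /cvgrPdist_lt ul e e0.
have e4 : 0 < e / 4 by rewrite divr_gt0.
have [N _ hN] := ul _ e4; exists N => m n Nm Nn.
have h k : (N <= k)%N -> sqn b (u k - l) < e / 4.
  by move=> /hN; rewrite /= sub0r normrN ger0_norm ?sqn_ge0.
rewrite -(subrK l (u m)) -addrA (le_lt_trans (sqnD_le _ _))//.
rewrite (sqnBC l); have := h _ Nm; have := h _ Nn; lra.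
Qed.

(* Parallelogram law applied to a minimising sequence of [sqn b (x - _)] on [L]. *)
Lemma projection L M x : subspace L -> L `<=` M -> complete_sip b M ->
  exists l p, [/\ forall n, L (l n), M p, cvg_sip b l p
                & forall r, L r -> b (x - p) r = 0].
Proof.
move=> sL LM cM.
pose D : set R := [set sqn b (x - r) | r in L].
have D0 : D !=set0 by exists (sqn b (x - 0)), 0 => //; case: sL.
have lD : lbound D 0 by move=> _ [r _ <-]; exact: sqn_ge0.
have hD : has_inf D by split => //; exists 0.
pose d := inf D.
have dle r : L r -> d <= sqn b (x - r).
  by move=> Lr; apply: ge_inf; [exists 0|exists r].
have ex (n : nat) : exists r, L r /\ sqn b (x - r) < d + n.+1%:R^-1.
  have [|_ [r Lr <-] h] := @inf_adherent _ D (n.+1%:R^-1) _ hD; first by rewrite invr_gt0.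
  by exists r.
have [l hl] := choice ex.
have Ll n : L (l n) by case: (hl n).
have dl n : sqn b (x - l n) < d + n.+1%:R^-1 by case: (hl n).
have [p Mp lp] : exists2 p, M p & cvg_sip b l p.
  apply: cM => [n|e e0]; first exact: LM.
  have /cvgrPdist_lt /(_ (e / 4)) := @cvg_harmonic R.
  rewrite divr_gt0// => /(_ isT)[N _ hN]; exists N => m n Nm Nn.
  have hk k : (N <= k)%N -> k.+1%:R^-1 < e / 4.
    by move=> /hN; rewrite /= sub0r normrN ger0_norm.
  have par : sqn b (l m - l n) = 2 * sqn b (x - l m) + 2 * sqn b (x - l n)
      - 4 * sqn b (x - 2^-1%:C *: (l m + l n)).
    have -> : l m - l n = (x - l n) - (x - l m) by rewrite opprB addrCA addrAC subrr add0r.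
    have -> : x - 2^-1%:C *: (l m + l n) = 2^-1%:C *: ((x - l n) + (x - l m)).
      rewrite addrACA -opprD [l n + _]addrC scalerBr; congr (_ - _).
      rewrite -[x in x + x]scale1r -scalerDl scalerA.
      have -> : 2^-1%:C * (1 + 1) = 1 :> R[i].
        apply: complexP; rewrite !ReImE/=; lra.
      by rewrite scale1r.
    move: (x - l n) (x - l m) => y z; rewrite sqnZr sqnB sqnD; lra.
  rewrite par.
  have := dle (2^-1%:C *: (l m + l n)).
  move=> /(_ _)/wrap[]; first by apply: subspaceZ => //; exact: subspaceD.
  have := dl m; have := dl n; have := hk _ Nm; have := hk _ Nn.
  move: (n.+1%:R^-1) (m.+1%:R^-1) => ? ?; lra.
exists l, p; split => //; apply: Re0_sip0 => // r Lr.
(* The vector [x - l n + t r] has square norm at least [d], while that of [x - l n] is below d +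
   1/(n + 1). The limit in n gives the first variation at [p], which need not lie in [L]. *)
have H t : 0 <= 2 * t * Re (b (x - p) r) + t ^+ 2 * sqn b r.
  suff: (fun n => 2 * t * Re (b (x - l n) r) + t ^+ 2 * sqn b r + n.+1%:R^-1) @ \oo -->
     2 * t * Re (b (x - p) r) + t ^+ 2 * sqn b r + 0.
    rewrite addr0; move=> /cvgr_to_ge; apply; near=> n.
    have := dle (l n - t%:C *: r).
    move=> /(_ _)/wrap[]; first by apply: subspaceB => //; apply: subspaceZ.
    have -> : x - (l n - t%:C *: r) = x - l n + t%:C *: r by rewrite opprB addrA addrAC.
    rewrite sqnD (Re_sipC _ (_ *: _)) Re_sipZl sqnZr (Re_sipC r).
    by have := dl n; move: (n.+1%:R^-1) => ?; lra.
  apply: cvgD; last exact: cvg_harmonic.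
  apply: cvgD; last exact: cvg_cst.
  apply: cvgMr; under eq_fun do rewrite sipBl ReD ReN.
  rewrite sipBl ReD ReN; apply: cvgB; first exact: cvg_cst.
  exact: cvg_sip_Re.
have [r0|r0] := eqVneq (sqn b r) 0.
  have := H 1; have := H (-1); rewrite r0; lra.
have rp : 0 < sqn b r by rewrite lt_neqAle eq_sym r0 sqn_ge0.
have := H (- Re (b (x - p) r) / sqn b r).
have -> : 2 * (- Re (b (x - p) r) / sqn b r) * Re (b (x - p) r) +
    (- Re (b (x - p) r) / sqn b r) ^+ 2 * sqn b r = - (Re (b (x - p) r) ^+ 2 / sqn b r).
  by field.
rewrite oppr_ge0 ler_pdivrMr// mul0r => h.
by apply/eqP; rewrite -sqrf_eq0 eq_le h sqr_ge0.
Unshelve. all: by end_near.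
Qed.

End theory.
End semi_inner_products.

(** * Square roots of bounded nonnegative operators *)

Section bounded_operators.
Variables (R : realType) (H : lmodType R[i]) (b : H -> H -> R[i]).
Hypotheses (hb : sip b) (b_def : forall u, sqn b u = 0 -> u = 0).
Implicit Types (u v : H) (G X Y Z P : H -> H).

(** The order interval 0 <= X <= I, stated through the quadratic form alone; that [X] is a
    contraction is then a consequence of Cauchy-Schwarz for [b (X u) v]. *)
Definition bounded_nonneg X : Prop :=
  [/\ linear X, forall u v, b (X u) v = b u (X v), forall u, 0 <= b (X u) u
    & forall u, Re (b (X u) u) <= sqn b u].

Lemma sip_eq u v : (forall w, b u w = b v w) -> u = v.
Proof.
move=> h; apply/eqP; rewrite -subr_eq0; apply/eqP/b_def.
by rewrite /sqn (sipBl hb) h subrr.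
Qed.

Lemma cvg_sip_unique (u : nat -> H) v w : cvg_sip b u v -> cvg_sip b u w -> v = w.
Proof.
by move=> uv uw; apply/eqP; rewrite -subr_eq0; apply/eqP/b_def/(cvg_sip_uniq hb uv uw).
Qed.

Lemma sip_bounded X : bounded_nonneg X -> sip (fun u v => b (X u) v).
Proof.
case=> lX sX pX _; split=> // [a u v w|u v].
  by rewrite lX (sipDl hb) (sipZl hb).
by rewrite sX (sipC hb).
Qed.

(** Cauchy-Schwarz for the semi-inner product [b (X u) v], applied to u and X u, gives |Xu|^4 <=
    <Xu,u> <XXu,Xu>, and X <= I bounds the last factor by |Xu|^2. *)
Lemma sqn_bounded X u : bounded_nonneg X -> sqn b (X u) <= Re (b (X u) u).
Proof.
move=> bX; have [_ _ pX cX] := bX.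
have h := CS (sip_bounded bX) u (X u).
have h1 : sqn b (X u) ^+ 2 <= Re (b (X u) u) * sqn b (X u).
  apply: (le_trans h); apply: ler_wpM2l; last exact: cX.
  by have := pX u; rewrite ge0_complex => /andP[].
have := sqn_ge0 hb (X u); rewrite le_eqVlt => /orP[/eqP <-|s0].
  by have := pX u; rewrite ge0_complex => /andP[].
by move: h1; rewrite expr2 ler_pM2r.
Qed.

Lemma sqn_bounded_le X u : bounded_nonneg X -> sqn b (X u) <= sqn b u.
Proof. by move=> bX; apply: le_trans (sqn_bounded u bX) _; case: bX. Qed.

Lemma bounded_nonnegC X : bounded_nonneg X -> bounded_nonneg (fun u => u - X u).
Proof.
move=> bX; have [lX sX pX cX] := bX; split=> [a u v|u v|u|u].
- by rewrite lX opprD addrACA scalerBr.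
- by rewrite (sipBl hb) (sipBr hb) sX.
- rewrite ge0_complex (sipBl hb) !ReImE (sip_sqn hb u)/= subr_ge0 cX andbT.
  have := pX u; rewrite ge0_complex => /andP[/eqP -> _].
  by rewrite subr0.
- rewrite (sipBl hb) !ReImE lerBlDr lerDl.
  by have := pX u; rewrite ge0_complex => /andP[].
Qed.

(* Positivity of the members of [pgen G] is proved by letting them act on all the
   forms for which [G] is symmetric and nonnegative; this makes products easy. *)
Inductive pgen G : (H -> H) -> Prop :=
| pgen0 : pgen G (fun=> 0)
| pgen1 : pgen G G
| pgenD X Y : pgen G X -> pgen G Y -> pgen G (fun u => X u + Y u)
| pgenH X : pgen G X -> pgen G (fun u => 2^-1%:C *: X u)
| pgenM X Y : pgen G X -> pgen G Y -> pgen G (fun u => X (Y u)).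

Definition form_for G (c : H -> H -> R[i]) : Prop :=
  [/\ sip c, forall u v, c (G u) v = c u (G v) & forall u, 0 <= c (G u) u].

Lemma pgen_linear G X : linear G -> pgen G X -> linear X.
Proof.
move=> lG; elim=> // [a u v|X' Y _ lX _ lY a u v|X' _ lX a u v|X' Y _ lX _ lY a u v].
- by rewrite scaler0 addr0.
- by rewrite lX lY scalerDr addrACA.
- by rewrite lX scalerDr !scalerA mulrC.
- by rewrite lY lX.
Qed.

(** Replacing [c] by [c (X u) v] stays within the admissible forms, so a product is handled by two
    successive replacements. For [G] itself, symmetry turns [c (G (G u)) u] into [c (G u) (G u)]. *)
Lemma pgen_form G X : linear G -> pgen G X ->
  forall c, form_for G c -> form_for G (fun u v => c (X u) v).
Proof.
move=> lG; elim=> [|||X' _ hX|X' Y _ hX _ hY] {X}.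
- move=> c [hc _ _]; split; first split.
  + by move=> a u v w; rewrite (sip0l hc) mulr0 addr0.
  + by move=> u v; rewrite !(sip0l hc) rmorph0.
  + by move=> u; rewrite (sip0l hc).
  + by move=> u v; rewrite !(sip0l hc).
  + by move=> u; rewrite (sip0l hc).
- move=> c [hc sG pG]; split; first split => //.
  + by move=> a u v w; rewrite lG (sipDl hc) (sipZl hc).
  + by move=> u v; rewrite sG (sipC hc).
  + by move=> u v; rewrite sG.
  + by move=> u; rewrite sG (sip_ge0 hc).
- move=> X Y _ hX _ hY c hc; have [sc _ _] := hc.
  have [[lX cX pX] sX gX] := hX _ hc; have [[lY cY pY] sY gY] := hY _ hc.
  split; first split.
  + by move=> a u v w; rewrite !(sipDl sc) lX lY mulrDr addrACA.
  + by move=> u v; rewrite !(sipDl sc) cX cY rmorphD.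
  + by move=> u; rewrite (sipDl sc) addr_ge0.
  + by move=> u v; rewrite !(sipDl sc) sX sY.
  + by move=> u; rewrite (sipDl sc) addr_ge0.
- move=> c hc; have [sc _ _] := hc.
  have [[lX cX pX] sX gX] := hX _ hc.
  have h0 : 0 <= 2^-1%:C :> R[i] by rewrite ge0_complex/= eqxx/= invr_ge0.
  split; first split.
  + by move=> a u v w; rewrite !(sipZl sc) lX mulrDr !mulrA [_ * a]mulrC.
  + by move=> u v; rewrite !(sipZl sc) cX rmorphM/= oppr0.
  + by move=> u; rewrite (sipZl sc) mulr_ge0.
  + by move=> u v; rewrite !(sipZl sc) sX.
  + by move=> u; rewrite (sipZl sc) mulr_ge0.
- by move=> c /hX/hY.
Qed.

(** * Square root by monotone iteration *)

Section square_root.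
Variable G : H -> H.
Hypothesis bG : bounded_nonneg G.

Let lG : linear G. Proof. by case: bG. Qed.

Let fG : form_for G b.
Proof. by have [_ sG pG _] := bG; split. Qed.

(** Iteration for the fixed point 2Y = G + Y^2, that is (I - Y)^2 = I - G. All iterates are
    polynomials in [G] with nonnegative coefficients. *)
Fixpoint root_approx n u : H :=
  if n is m.+1 then 2^-1%:C *: (G u + root_approx m (root_approx m u)) else 0.

Lemma pgen_root_approx n : pgen G (root_approx n).
Proof.
elim: n => [|n ih]; first exact: pgen0.
by apply: (@pgenH _ (fun u => G u + root_approx n (root_approx n u)));
  apply: pgenD; [exact: pgen1|exact: pgenM].
Qed.

Lemma root_approx_linear n : linear (root_approx n).
Proof. exact: pgen_linear (pgen_root_approx n). Qed.

(** If X is the increment Y_(n+1) - Y_n, the next increment is (X Y_n + Y_(n+1) X)/2, again a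
    polynomial in [G] with nonnegative coefficients. This makes the iteration monotone. *)
Lemma root_approx_step n : exists2 X, pgen G X &
  forall u, root_approx n.+1 u = root_approx n u + X u.
Proof.
elim: n => [|n [X pX hX]].
  exists (fun u => 2^-1%:C *: G u); first by apply: pgenH; exact: pgen1.
  by move=> u /=; rewrite addr0 add0r.
exists (fun u => 2^-1%:C *: (X (root_approx n u) + root_approx n.+1 (X u))).
  apply: (@pgenH _ (fun u => X (root_approx n u) + root_approx n.+1 (X u))).
  by apply: pgenD; apply: pgenM => //; exact: pgen_root_approx.
move=> u; rewrite -[LHS]/(2^-1%:C *: (G u + root_approx n.+1 (root_approx n.+1 u))).
have -> : root_approx n.+1 (root_approx n.+1 u) =
    root_approx n (root_approx n u) + X (root_approx n u) + root_approx n.+1 (X u).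
  by rewrite [in LHS](hX u) (linD _ _ (@root_approx_linear _)) hX.
by rewrite -[X in _ = X + _]/(2^-1%:C *: (G u + root_approx n (root_approx n u)))
  -scalerDr !addrA.
Qed.

Lemma root_approx_diff k n : exists2 X, pgen G X &
  forall u, root_approx (k + n) u = root_approx n u + X u.
Proof.
elim: k => [|k [X pX hX]].
  by exists (fun=> 0); [exact: pgen0|move=> u; rewrite addr0].
have [Y pY hY] := root_approx_step (k + n).
exists (fun u => X u + Y u); first exact: pgenD.
by move=> u; rewrite addSn hY hX addrA.
Qed.

Lemma pgen_sym X u v : pgen G X -> b (X u) v = b u (X v).
Proof.
by move=> pX; have [hX _ _] := pgen_form lG pX fG; rewrite (sipC hX) -(sipC hb).
Qed.

Lemma pgen_ge0 X u : pgen G X -> 0 <= b (X u) u.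
Proof. by move=> pX; have [[_ _]] := pgen_form lG pX fG. Qed.

Lemma bounded_root_approx n : bounded_nonneg (root_approx n).
Proof.
elim: n => [|n ih]; split; try exact: root_approx_linear;
  try by move=> *; apply: pgen_sym; exact: pgen_root_approx.
- by move=> u; apply: pgen_ge0; exact: pgen_root_approx.
- by move=> u /=; rewrite (sip0l hb) sqn_ge0.
- by move=> u; apply: pgen_ge0; exact: pgen_root_approx.
- move=> u; rewrite -[root_approx n.+1 u]/(2^-1%:C *: (G u + root_approx n (root_approx n u))).
  rewrite (Re_sipZl hb) (sipDl hb) ReD.
  have [_ sR _ _] := ih; rewrite sR.
  have := sqn_bounded_le u ih; have [_ _ _ cG] := bG; have := cG u.
  rewrite /sqn; lra.
Qed.

Hypothesis b_complete : complete_sip b setT.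

(** The increment X between two iterates satisfies 0 <= X <= I, hence |Xu|^2 <= <Xu,u>. The
    right-hand side is a difference of two terms of the bounded nondecreasing numerical sequence
    [a]. *)
Lemma root_approx_cauchy u : cauchy_sip b (root_approx ^~ u).
Proof.
pose a n := Re (b (root_approx n u) u).
have ha k n : sqn b (root_approx (k + n) u - root_approx n u) <= a (k + n)%N - a n.
  have [X pX hX] := root_approx_diff k n.
  have hE v : X v = root_approx (k + n) v - root_approx n v by rewrite hX addrC addKr.
  have bX : bounded_nonneg X.
    split; first exact: pgen_linear pX.
    - by move=> *; exact: pgen_sym.
    - by move=> v; exact: pgen_ge0.
    - move=> v; rewrite hE (sipBl hb) ReD ReN.
      have [_ _ _ c1] := bounded_root_approx (k + n)%N.
      have [_ _ /(_ v) p1 _] := bounded_root_approx n.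
      have := c1 v; move: p1; rewrite ge0_complex => /andP[_]; lra.
  by rewrite -hE /a -ReN -ReD -(sipBl hb) -hE; exact: sqn_bounded.
have a_nd : nondecreasing_seq a.
  apply/nondecreasing_seqP => n; rewrite -subr_ge0.
  by apply: le_trans (ha 1%N n); exact: sqn_ge0.
have a_ub : has_ubound (range a).
  exists (sqn b u) => _ [n _ <-].
  by have [_ _ _] := bounded_root_approx n; apply.
have /cauchy_cvgP/cauchy_ballP ca := nondecreasing_is_cvgn a_nd a_ub.
move=> e e0; have := ca _ e0; rewrite near_map2 => -[[A B] [[N1 _ hA] [N2 _ hB]] hN].
exists (maxn N1 N2) => m n.
wlog mn : m n / (n <= m)%N => [hw|] Nm Nn.
  have [/hw|/ltnW/hw] := leqP n m; first exact.
  by rewrite (sqnBC hb); apply.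
have := ha (m - n)%N n; rewrite subnK// => /le_lt_trans; apply.
have := hN (n, m); rewrite -ball_normE /= => hnm.
apply: le_lt_trans (hnm _); first by rewrite distrC; exact: ler_norm.
split; [apply: hA|apply: hB]; [exact: leq_trans (leq_maxl _ _) Nn|].
exact: leq_trans (leq_maxr _ _) Nm.
Qed.

(** The commutation clause is stated for contractions [Z], which can be applied under the limit. It
    is what later makes square roots of different operators commute. *)
Lemma root_fixpoint : exists Y, [/\ bounded_nonneg Y,
  forall u, 2%:C *: Y u = G u + Y (Y u)
  & forall Z, linear Z -> (forall u, sqn b (Z u) <= sqn b u) ->
     (forall u, Z (G u) = G (Z u)) -> forall u, Z (Y u) = Y (Z u)].
Proof.
have /choice[Y hY] u : exists l, cvg_sip b (root_approx ^~ u) l.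
  by have [l _ ul] := b_complete (fun=> I) (@root_approx_cauchy u); exists l.
have YR u v : Re (b (root_approx n u) v) @[n --> \oo] --> Re (b (Y u) v).
  exact: cvg_sip_Re.
have Ylin : linear Y.
  move=> a u v; apply: cvg_sip_unique (hY _) _.
  have := cvg_sipP hb a (hY u) (hY v).
  by congr cvg_sip; apply/funext => n; rewrite root_approx_linear.
have YRs u v : Re (b (Y u) v) = Re (b u (Y v)).
  rewrite (Re_sipC hb u); apply: (cvg_unique _ (YR u v)) => //.
  rewrite (_ : (fun n => _) = (fun n => Re (b (root_approx n v) u))); first exact: YR.
  apply/funext => n; have [_ sR _ _] := bounded_root_approx n.
  by rewrite sR (Re_sipC hb).
have Ysym u v : b (Y u) v = b u (Y v).
  apply: complexP; first exact: YRs.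
  have := YRs u ('i%C *: v); rewrite (linZ _ _ Ylin) !(sipZr hb) !ReImE/=; lra.
have Ybnd : bounded_nonneg Y.
  split => // u; last first.
    apply: cvgr_to_le (YR u u) _; near=> n.
    by have [_ _ _] := bounded_root_approx n; apply.
  rewrite ge0_complex; apply/andP; split; last first.
    apply: cvgr_to_ge (YR u u) _; near=> n.
    by have [_ _ /(_ u)] := bounded_root_approx n; rewrite ge0_complex => /andP[].
  have : Im (b (Y u) u) = Im (b u (Y u)) by rewrite Ysym.
  by rewrite (sipC hb u (Y u)) Im_conjc => h; apply/eqP; lra.
exists Y; split => // [u|Z lZ cZ ZG u].
  have h1 : cvg_sip b (fun n => 2%:C *: root_approx n.+1 u) (2%:C *: Y u).
    rewrite -[2%:C *: Y u]addr0.
    have h0 : cvg_sip b (fun n => root_approx n.+1 u) (Y u).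
      by have := hY u; rewrite /cvg_sip -cvg_shiftS.
    have := cvg_sipP hb 2%:C h0 (cvg_sip_cst hb 0).
    by congr cvg_sip; apply/funext => n; rewrite addr0.
  apply: cvg_sip_unique h1 _.
  have -> : (fun n => 2%:C *: root_approx n.+1 u) =
     (fun n => 1 *: root_approx n (root_approx n u) + G u).
    apply/funext => n.
    rewrite -[root_approx n.+1 u]/(2^-1%:C *: (G u + root_approx n (root_approx n u))).
    rewrite scalerA (_ : 2%:C * _ = 1).
      by rewrite !scale1r addrC.
    by apply: complexP; rewrite !ReImE/=; lra.
  (* The difference Y_n Y_n u - Y Y u is split as Y_n (Y_n u - Y u) + (Y_n - Y) Y u; the first term
     is controlled because every Y_n is a contraction. *)
  rewrite addrC -[Y (Y u)]scale1r; apply: (cvg_sipP hb) (cvg_sip_cst hb _).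
  apply: (@cvg_sip_squeeze _ _ _ hb _ _ (fun n => 2 * sqn b (root_approx n u - Y u) +
      2 * sqn b (root_approx n (Y u) - Y (Y u)))).
    move=> n; apply: le_trans (_ : _ <= 2 * sqn b (root_approx n (root_approx n u - Y u)) +
      2 * sqn b (root_approx n (Y u) - Y (Y u))) _; last first.
      by rewrite lerD2r ler_pM2l// sqn_bounded_le//; exact: bounded_root_approx.
    apply: le_trans (sqnD_le hb _ _).
    by rewrite (linB _ _ (@root_approx_linear n)) addrA subrK.
  rewrite -[X in _ --> X]addr0; apply: cvgD.
    by rewrite -(mulr0 2); apply: cvgMr; exact: hY.
  by rewrite -(mulr0 2); apply: cvgMr; exact: hY.
have ZR n v : Z (root_approx n v) = root_approx n (Z v).
  elim: n v => [|n ih] v; first by rewrite /= lin0.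
  rewrite -[root_approx n.+1 v]/(2^-1%:C *: (G v + root_approx n (root_approx n v))).
  by rewrite linZ// linD// ZG !ih.
apply: cvg_sip_unique (hY _); under [X in cvg_sip _ X]eq_fun do rewrite -ZR.
apply: (cvg_sip_squeeze hb _ (hY u)) => n.
by rewrite -linB.
Unshelve. all: by end_near.
Qed.

End square_root.

(** The fixed point Y for G = I - X yields the root I - Y. *)
Lemma bounded_sqrt X : complete_sip b setT -> bounded_nonneg X ->
  exists P, [/\ bounded_nonneg P, forall u, P (P u) = X u
  & forall Z, linear Z -> (forall u, sqn b (Z u) <= sqn b u) ->
     (forall u, Z (X u) = X (Z u)) -> forall u, Z (P u) = P (Z u)].
Proof.
move=> cb bX; have bG := bounded_nonnegC bX.
have [Y [bY hY cY]] := root_fixpoint bG cb.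
exists (fun u => u - Y u); split=> [|u|Z lZ cZ ZX u]; first exact: bounded_nonnegC.
  have [lY _ _ _] := bY; rewrite (linB _ _ lY).
  have -> : u - Y u - (Y u - Y (Y u)) = u - (2%:C *: Y u - Y (Y u)).
    rewrite (_ : 2%:C = 1 + 1); last by apply: complexP; rewrite !ReImE/=; lra.
    by rewrite scalerDl scale1r !opprD !opprK !addrA.
  by rewrite hY addrK opprB addrCA subrr addr0.
by rewrite linB// cY// => v; rewrite linB// ZX.
Qed.

End bounded_operators.

(** * Nonnegative selfadjoint relations *)

Section relations.
Variables (R : realType) (H : lmodType R[i]) (dot : {dot H for Num.conj}).
Implicit Types (A B S : set (H * H)) (T : H -> H).

Lemma sip_dot : sip dot.
Proof.
split=> [a u v w|u v|u]; last exact: dnorm_ge0.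
  by rewrite linearPl.
by rewrite hermC expr0 mul1r.
Qed.
Let hb := sip_dot.

Lemma sqn_dot_eq0 u : sqn dot u = 0 -> u = 0.
Proof.
move=> u0; apply/eqP; rewrite -(dnorm_eq0 dot); apply/eqP.
by rewrite (sip_sqn hb) u0.
Qed.
Let hd := sqn_dot_eq0.

Lemma hcvgE (u : nat -> H) l : hcvg dot u l <-> cvg_sip dot u l.
Proof.
have e n : hnorm dot (u n - l) ^+ 2 = sqn dot (u n - l).
  by rewrite sqr_sqrtr// (sqn_ge0 hb).
split => [h|h].
  rewrite /cvg_sip; under eq_fun do rewrite -e expr2.
  by rewrite -(mulr0 0); apply: cvgM.
by apply: (cvg_sqn0_sq (K := 1) _ h) => n; rewrite e mulr1.
Qed.

(** The condition is a family of linear equations continuous in the pair. Passage to the limit is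
    available for real parts; imaginary parts follow by multiplying the test pair by i. *)
Lemma adjoint_linear_relation B A :
  A = [set p | forall q, B q -> dot p.2 q.1 = dot p.1 q.2] ->
  linear_relation dot A.
Proof.
move=> ->; split=> [q _|a p q hp hq r Br|u l hu /hcvgE u1 /hcvgE u2 q Bq].
- by rewrite !(sip0l hb).
- by rewrite !(sipDl hb) !(sipZl hb) hp// hq.
- have h x y : (forall n, Re (dot (u n).2 x) = Re (dot (u n).1 y)) ->
      Re (dot l.2 x) = Re (dot l.1 y).
    move=> e; have c1 := @cvg_sip_Re _ _ _ hb _ _ x u2.
    have c2 := @cvg_sip_Re _ _ _ hb _ _ y u1.
    apply: (cvg_unique _ _ c2) => //.
    by rewrite -(_ : (fun n => Re (dot (u n).2 x)) = (fun n => Re (dot (u n).1 y)))//;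
      exact/funext.
  apply: complexP; first by apply: h => n; rewrite hu.
  have := h ('i%C *: q.1) ('i%C *: q.2); rewrite !(sipZr hb) !ReImE/= !mul0r !mulN1r !opprK !add0r.
  by apply => n; rewrite !(sipZr hb) hu.
Qed.

Lemma linear_relation_subspace A : linear_relation dot A -> subspace A.
Proof. by case. Qed.

Definition graph_sip (p r : H * H) : R[i] := dot p.1 r.1 + dot p.2 r.2.

Lemma sqn_graph p : sqn graph_sip p = sqn dot p.1 + sqn dot p.2.
Proof. by rewrite /sqn ReD. Qed.

Lemma cvg_graph (u : nat -> H * H) l : cvg_sip graph_sip u l <->
  cvg_sip dot (fun n => (u n).1) l.1 /\ cvg_sip dot (fun n => (u n).2) l.2.
Proof.
split=> [h|[h1 h2]].
  by split; apply: (cvg_sip_squeeze hb _ h) => n;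
    rewrite sqn_graph/= ?lerDl ?lerDr (sqn_ge0 hb).
rewrite /cvg_sip (_ : (fun n => _) =
    (fun n => sqn dot ((u n).1 - l.1) + sqn dot ((u n).2 - l.2))); last first.
  by apply/funext => n; rewrite sqn_graph.
by rewrite -[X in _ --> X]addr0; apply: cvgD.
Qed.

Hypothesis H_complete : complete_sip dot setT.

Lemma complete_linear_relation A : linear_relation dot A -> complete_sip graph_sip A.
Proof.
case=> _ _ cA u Au cu.
have [l1 _ h1] : exists2 l, setT l & cvg_sip dot (fun n => (u n).1) l.
  apply: H_complete => // e /cu[N hN]; exists N => m n Nm Nn.
  by apply: le_lt_trans (hN _ _ Nm Nn); rewrite sqn_graph lerDl (sqn_ge0 hb).
have [l2 _ h2] : exists2 l, setT l & cvg_sip dot (fun n => (u n).2) l.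
  apply: H_complete => // e /cu[N hN]; exists N => m n Nm Nn.
  by apply: le_lt_trans (hN _ _ Nm Nn); rewrite sqn_graph lerDr (sqn_ge0 hb).
exists (l1, l2); last exact/cvg_graph.
by apply: (cA u) => //; apply/hcvgE.
Qed.

(* Nonnegative selfadjoint relations correspond to the bounded operators
   [T = (I + A)^-1] with [0 <= T <= I]. *)
Definition rel_of T : set (H * H) := [set p | T (p.1 + p.2) = p.1].

Lemma rel_ofP T u : rel_of T (T u, u - T u).
Proof. by rewrite /rel_of/= addrCA subrr addr0. Qed.

Lemma rel_of_eq T p : rel_of T p -> exists u, p = (T u, u - T u).
Proof.
rewrite /rel_of/= => e; exists (p.1 + p.2).
by rewrite e addrAC subrr add0r -surjective_pairing.
Qed.

Lemma rel_of_inj T T' : rel_of T = rel_of T' -> T = T'.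
Proof.
move=> e; apply/funext => u; have := rel_ofP T u; rewrite e /rel_of/=.
by rewrite addrCA subrr addr0.
Qed.

Lemma nsa_rel_of T : bounded_nonneg dot T -> nonneg_selfadjoint dot (rel_of T).
Proof.
move=> bT; have [lT sT pT cT] := bT.
have E : rel_of T = [set p | forall q, rel_of T q -> dot p.2 q.1 = dot p.1 q.2].
  apply/seteqP; split => p.
    move=> /rel_of_eq[u ->] q /rel_of_eq[v ->] /=.
    by rewrite (sipBl hb) (sipBr hb) (sT u v).
  move=> hp; rewrite /rel_of/=; apply: (sip_eq hb hd) => u.
  have := hp _ (rel_ofP T u); rewrite /= (sipBr hb) => /eqP.
  by rewrite eq_sym subr_eq addrC -(sipDl hb) sT => /eqP ->.
split; [exact: adjoint_linear_relation E| |].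
- rewrite [LHS]E; apply/seteqP; split => p.
    by move=> hp; split.
  by case.
- move=> _ /rel_of_eq[u ->] /=.
  rewrite (sipBl hb) -(sT u u) ge0_complex !ReImE (sip_sqn hb (T u))/= subr_ge0.
  rewrite (sqn_bounded hb u bT) andbT subr0.
  by have := pT u; rewrite ge0_complex => /andP[].
Qed.

(** For (f, f') in [A] nonnegativity gives |f|^2 + |f'|^2 <= |f + f'|^2, so f + f' determines the
    pair and the range of I + A is complete. A vector w orthogonal to this range gives (w, -w) in
    [A] by selfadjointness, and nonnegativity forces w = 0; hence the range is everything and T is
    defined everywhere. *)
Lemma nsa_bounded A : nonneg_selfadjoint dot A ->
  exists2 T, bounded_nonneg dot T & A = rel_of T.
Proof.
case=> lA eA pA.
have sA p q : A p -> A q -> dot p.2 q.1 = dot p.1 q.2.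
  by rewrite {1}eA => -[_ _]; apply.
have A_sub := linear_relation_subspace lA.
have le p : A p -> sqn dot p.1 + sqn dot p.2 <= sqn dot (p.1 + p.2).
  move=> /pA; rewrite (sqnD hb) (Re_sipC hb) ge0_complex => /andP[_]; lra.
have inj p q : A p -> A q -> p.1 + p.2 = q.1 + q.2 -> p = q.
  move=> Ap Aq e; have := le _ (subspaceB A_sub Ap Aq).
  rewrite /= addrACA -opprD e subrr (sqn0 hb) => h.
  have h1 : sqn dot (p.1 - q.1) = 0.
    by have := sqn_ge0 hb (p.1 - q.1); have := sqn_ge0 hb (p.2 - q.2); lra.
  have h2 : sqn dot (p.2 - q.2) = 0.
    by have := sqn_ge0 hb (p.1 - q.1); have := sqn_ge0 hb (p.2 - q.2); lra.
  move: (hd h1) (hd h2) => /eqP; rewrite subr_eq0 => /eqP e1 /eqP.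
  by rewrite subr_eq0 => /eqP e2; case: p q e1 e2 {Ap Aq e h h1 h2} => ? ? [? ?] /= -> ->.
pose M : set H := [set p.1 + p.2 | p in A].
have M_sub : subspace M.
  split; first by exists 0; [case: A_sub|rewrite /= addr0].
  move=> a _ _ [p Ap <-] [q Aq <-]; exists (a *: p + q); first by case: A_sub => _; apply.
  by rewrite /= scalerDr addrACA.
have cM : complete_sip dot M.
  move=> u Mu cu.
  have /choice[p hp] n : exists p, A p /\ p.1 + p.2 = u n.
    by have [p Ap <-] := Mu n; exists p.
  have [l Al pl] : exists2 l, A l & cvg_sip graph_sip p l.
    apply: complete_linear_relation => // [n|e /cu[N hN]]; first by case: (hp n).
    exists N => m n Nm Nn; apply: le_lt_trans (hN _ _ Nm Nn).
    have [Am <-] := hp m; have [An <-] := hp n.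
    have := le _ (subspaceB A_sub Am An).
    by rewrite sqn_graph /= [in X in _ -> X]opprD addrACA.
  exists (l.1 + l.2); first by exists l.
  have /cvg_graph[p1 p2] := pl.
  have := cvg_sipP hb 1 p1 p2; rewrite scale1r.
  by congr cvg_sip; apply/funext => n; rewrite scale1r; case: (hp n).
have ex u : exists f, A (f, u - f).
  have [l [m [_ [p Ap pm] _ mo]]] := projection hb u M_sub (@subset_refl _ M) cM.
  suff um : u - m = 0.
    exists p.1; move/eqP: um; rewrite subr_eq0 -pm => /eqP ->.
    by rewrite addrAC subrr add0r -surjective_pairing.
  have Aw : A (u - m, - (u - m)).
    rewrite eA; split => // q Aq /=.
    rewrite (sipNl hb); apply/eqP; rewrite -subr_eq0 -opprD oppr_eq0 -(sipDr hb).
    by rewrite mo//; exists q.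
  have := pA _ Aw; rewrite /= (sipNl hb) (sip_sqn hb) ge0_complex ReN/= oppr_ge0 => /andP[_ h].
  by apply: hd; apply/eqP; rewrite eq_le h (sqn_ge0 hb).
have [T hT] := choice ex.
have eT p : A p -> T (p.1 + p.2) = p.1.
  move=> Ap; have /(congr1 fst) : (T (p.1 + p.2), p.1 + p.2 - T (p.1 + p.2)) = p.
    by apply: inj => //=; rewrite addrCA subrr addr0.
  by [].
have AT : A = rel_of T.
  apply/seteqP; split => p; first exact: eT.
  rewrite /rel_of/= => e; have := hT (p.1 + p.2); rewrite e.
  by rewrite addrAC subrr add0r -surjective_pairing.
have E u v : dot (T u) (v - T v) = dot (u - T u) (T v) by rewrite -(sA _ _ (hT u) (hT v)).
have P u : 0 <= dot (u - T u) (T u) by exact: pA (hT u).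
exists T => //; split.
- move=> a u v.
  have Ap : A (a *: (T u, u - T u) + (T v, v - T v)).
    by case: A_sub => _; apply; exact: hT.
  have := eT _ Ap; rewrite /= => <-; congr (T _).
  by rewrite addrACA -scalerDr !(addrC (T _)) !subrK.
- move=> u v; have := E u v; rewrite (sipBl hb) (sipBr hb) => /eqP.
  by rewrite (inj_eq (addIr _)) => /eqP.
- move=> u; rewrite -{2}(subrK (T u) u) (sipDr hb) addr_ge0// ?(sip_ge0 hb)//.
  by rewrite E.
- move=> u; rewrite -subr_ge0 /sqn -ReN -ReD -(sipBl hb).
  rewrite -{3}(subrK (T u) u) (sipDr hb) ReD addr_ge0//; first exact: (sqn_ge0 hb).
  by have := P u; rewrite ge0_complex => /andP[].
Qed.

Lemma lr_app_resolvent T u : lr_app (resolvent (rel_of T)) u = T u.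
Proof.
rewrite /lr_app; case: xgetP => [f _ [f' [f'' []]]|/(_ (T u))[]].
  by rewrite /rel_of /lr_id /= => h1 h2 h3; rewrite h3 h2 addrC h1.
exists (u - T u), (T u); split => //=; first exact: rel_ofP.
by rewrite subrK.
Qed.

Lemma sr_lim_unique (A_ : nat -> set (H * H)) A : sr_cvg dot A_ A -> sr_lim dot A_ = A.
Proof.
move=> hA; rewrite /sr_lim; case: xgetP => [B _ hB|/(_ A)//].
have [_ nA cA] := hA; have [_ nB cB] := hB.
have [T bT eT] := nsa_bounded nA; have [T' bT' eT'] := nsa_bounded nB.
rewrite eT eT'; congr rel_of; apply/funext => u.
move: (cA u) (cB u) => /hcvgE; rewrite eT lr_app_resolvent => h1 /hcvgE.
by rewrite eT' lr_app_resolvent => h2; exact: cvg_sip_unique h2 h1.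
Qed.

(* With [P = (I + A)^(-1/2)] and [Q = (I - (I + A)^-1)^(1/2)], the root is
   the relation [{(P u, Q u)}]. *)
Lemma sqrt_exists A : nonneg_selfadjoint dot A -> lr_mul A `<=` [set 0] ->
  exists S, is_sqrt_in dot setT S A.
Proof.
move=> nA mA; have [T bT eT] := nsa_bounded nA.
have [lT sT pT cT] := bT.
have [P [bP PP cP]] := bounded_sqrt hb hd H_complete bT.
have bG := bounded_nonnegC hb bT.
have [Q [bQ QQ cQ]] := bounded_sqrt hb hd H_complete bG.
have [lP sP pP _] := bP; have [lQ sQ pQ _] := bQ.
have PQ u : P (Q u) = Q (P u).
  apply: cQ => // v; first exact: sqn_bounded_le.
  by rewrite linB// -!PP.
(* A root [V] of [P] gives the nonnegativity of the relation: <Q u, P u> = <Q V u, V u>, because [V]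
   commutes with [Q]. *)
have [V [bV VV cV]] := bounded_sqrt hb hd H_complete bP.
have [lV sV _ _] := bV.
have QV u : Q (V u) = V (Q u).
  by apply: cV => // v; exact: sqn_bounded_le.
(* [P] and [Q] commute and behave like a cosine and a sine. The identity P^2 + Q^2 = I recovers from
   an element p of [S] the parameter u = P p.1 + Q p.2. *)
have PPQQ u : P (P u) + Q (Q u) = u by rewrite PP QQ addrCA subrr addr0.
pose S : set (H * H) := [set p | P p.2 = Q p.1].
have SP p : S p -> p = (P (P p.1 + Q p.2), Q (P p.1 + Q p.2)).
  rewrite /S/= => Sp; have h1 : P (Q p.2) = Q (Q p.1) by rewrite PQ Sp.
  have h2 : Q (P p.1) = P (P p.2) by rewrite -PQ -Sp.
  by rewrite (linD _ _ lP) (linD _ _ lQ) h1 h2 !PPQQ -surjective_pairing.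
have SI u : S (P u, Q u) by rewrite /S/= PQ.
have ES : S = [set p | forall q, S q -> dot p.2 q.1 = dot p.1 q.2].
  apply/seteqP; split => [p Sp q Sq|p hp].
    by rewrite (SP _ Sp) (SP _ Sq)/= sQ sP PQ.
  rewrite /S/=; apply: (sip_eq hb hd) => u.
  by rewrite sP sQ; exact: hp (SI u).
exists S; split.
- split; first exact: adjoint_linear_relation ES.
    by rewrite [LHS]ES; apply/seteqP; split => p; [move=> hp; split|case].
  move=> p Sp; rewrite (SP _ Sp)/=; move: (_ + _) => u.
  by rewrite -(VV u) -sV -QV; exact: pQ.
- apply/seteqP; split => [g|_ ->]; last by rewrite /lr_mul /S/= (lin0 lP) (lin0 lQ).
  rewrite /lr_mul /S/= (lin0 lQ) => Pg; apply: mA.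
  by rewrite eT /lr_mul /rel_of/= add0r -PP Pg (lin0 lP).
- rewrite eT; apply/seteqP; split => p.
    case=> g [S1 S2]; rewrite /rel_of/=.
    have := SP _ S1; move: (_ + _) => u [-> eg].
    have := SP _ S2; move: (_ + _) => v [eg' ->].
    rewrite -PP; congr (P _).
    by rewrite (linD _ _ lP) (PQ v) -eg' eg PPQQ.
  rewrite /rel_of/= => e.
  have e1 : p.1 = P (P (p.1 + p.2)) by rewrite PP.
  have e2 : p.2 = Q (Q (p.1 + p.2)) by rewrite QQ e addrAC subrr add0r.
  exists (P (Q (p.1 + p.2))); split => /=.
    by rewrite {1}e1 PQ; exact: SI.
  by rewrite {2}e2; exact: SI.
Qed.

End relations.

(** * Closed forms *)

Section forms.
Variables (R : realType) (H : lmodType R[i]) (dot : {dot H for Num.conj}).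
Hypothesis H_complete : complete_sip dot setT.
Implicit Types (A B S M : set (H * H)) (q : H * H -> H * H -> R[i]).

Let hb := sip_dot dot.
Let hd := @sqn_dot_eq0 _ _ dot.

Definition form_sip q (p r : H * H) : R[i] := dot p.1 r.1 + q p r.

(* A closed form on the space of first components of [M]; the second component
   of an element of [M] plays the role of the derivative. *)
Definition closed_form M q : Prop :=
  [/\ subspace M, sip q, complete_sip (form_sip q) M,
      forall g, M (0, g) -> g = 0
    & forall u, (forall r, M r -> dot u r.1 = 0) -> u = 0].

(** The weak formulation used in the first representation theorem: f' represents the functional q(f,
    .) on the form domain. *)
Definition form_rel M q : set (H * H) :=
  [set p | exists2 g, M (p.1, g) & forall r, M r -> q (p.1, g) r = dot p.2 r.1].

Lemma sip_form_sip q : sip q -> sip (form_sip q).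
Proof.
move=> hq; split=> [a u v w|u v|u]; rewrite /form_sip.
- by rewrite /= !(sipDl hb) !(sipZl hb) (sipDl hq) (sipZl hq) mulrDr addrACA.
- by rewrite rmorphD/= -(sipC hb) -(sipC hq).
- by rewrite addr_ge0// ?(sip_ge0 hb)// (sip_ge0 hq).
Qed.

Lemma sqn_form_sip q p : sqn (form_sip q) p = sqn dot p.1 + sqn q p.
Proof. by rewrite /sqn ReD. Qed.

Lemma form_sip_null M q : closed_form M q -> forall m, M m ->
  sqn (form_sip q) m = 0 -> m = 0.
Proof.
move=> [_ hq _ sM _] [f g] Mm; rewrite sqn_form_sip /= => e.
have f0 : f = 0.
  by apply: hd; have := sqn_ge0 hb f; have := sqn_ge0 hq (f, g); lra.
by rewrite f0 in Mm *; rewrite (sM _ Mm).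
Qed.

(* The lift [rho] of the resolvent to [M], obtained by projecting [(u, 0)] on the
   subspace [{(m.1, m)}] of [H * (H * H)]. *)
Lemma form_resolvent M q : closed_form M q -> exists rho : H -> H * H,
  [/\ forall u, M (rho u),
      forall u r, M r -> form_sip q (rho u) r = dot u r.1,
      linear rho, bounded_nonneg dot (fun u => (rho u).1)
    & form_rel M q = rel_of (fun u => (rho u).1)].
Proof.
move=> hM; have [sM hq cM uM dM] := hM.
have hs := sip_form_sip hq.
pose c (x y : H * (H * H)) := dot x.1 y.1 + q x.2 y.2.
have hc : sip c.
  split=> [a u v w|u v|u]; rewrite /c.
  - by rewrite /= (sipDl hb) (sipZl hb) (sipDl hq) (sipZl hq) mulrDr addrACA.
  - by rewrite rmorphD/= -(sipC hb) -(sipC hq).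
  - by rewrite addr_ge0// ?(sip_ge0 hb)// (sip_ge0 hq).
pose N : set (H * (H * H)) := [set x | M x.2 /\ x.1 = x.2.1].
have sN : subspace N.
  split; first by split => //; case: sM.
  move=> a u v [Mu u1] [Mv v1]; split; first by case: sM => _; apply.
  by rewrite /= u1 v1.
have cN : complete_sip c N.
  move=> u Nu cu.
  have e m n : sqn c (u m - u n) = sqn (form_sip q) ((u m).2 - (u n).2).
    by rewrite /sqn /c /form_sip /=; case: (Nu m) => _ ->; case: (Nu n) => _ ->.
  have [l Ml ul] : exists2 l, M l & cvg_sip (form_sip q) (fun n => (u n).2) l.
    apply: cM => [n|d /cu[K hK]]; first by case: (Nu n).
    by exists K => m n Km Kn; rewrite -e hK.
  exists (l.1, l) => //; rewrite /cvg_sip.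
  rewrite (_ : (fun n => _) = (fun n => sqn (form_sip q) ((u n).2 - l)))//.
  by apply/funext => n; rewrite /sqn /c /form_sip /=; case: (Nu n) => _ ->.
have ex u : exists m, M m /\ forall r, M r -> form_sip q m r = dot u r.1.
  have [_ [[f m] [_ [/= Mm fm] _ mo]]] :=
    projection hc (u, 0) sN (@subset_refl _ N) cN.
  exists m; split => // r Mr.
  have := mo (r.1, r); rewrite /c /= fm => /(_ _)/wrap[]; first by split.
  rewrite (sipBl hb) (sipBl hq) (sip0l hq) add0r -addrA -opprD => /eqP.
  by rewrite subr_eq0 => /eqP.
have [rho hrho] := choice ex.
have Mrho u : M (rho u) by case: (hrho u).
have Erho u r : M r -> form_sip q (rho u) r = dot u r.1 by case: (hrho u) => _; apply.
have uniq u m : M m -> (forall r, M r -> form_sip q m r = dot u r.1) -> m = rho u.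
  move=> Mm hm; apply/eqP; rewrite -subr_eq0; apply/eqP.
  have Md := subspaceB sM Mm (Mrho u).
  apply: (form_sip_null hM Md).
  by rewrite /sqn (sipBl hs) hm// Erho// subrr.
have lrho : linear rho.
  move=> a u v; apply/esym/uniq; first by case: sM => _; apply.
  move=> r Mr; rewrite (sipDl hs) (sipZl hs) !Erho//.
  by rewrite (sipDl hb) (sipZl hb).
have Esq u : sqn (form_sip q) (rho u) = Re (dot u (rho u).1) by rewrite /sqn Erho.
exists rho; split => //.
  split=> [a u v|u v|u|u].
  - by rewrite lrho.
  - by rewrite (sipC hb) -Erho// -(sipC hs) Erho.
  - by rewrite (sipC hb) -Erho// (sip_sqn hs) ge0_complex/= oppr0 eqxx (sqn_ge0 hs).
  - rewrite (Re_sipC hb) -Esq.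
    have h : sqn (form_sip q) (rho u) ^+ 2 <= sqn dot u * sqn (form_sip q) (rho u).
      rewrite {1}Esq; apply: (le_trans (CS hb u (rho u).1)).
      apply: ler_wpM2l; first exact: sqn_ge0.
      by rewrite sqn_form_sip lerDl sqn_ge0.
    have := sqn_ge0 hs (rho u); rewrite le_eqVlt => /orP[/eqP <-|s0].
      exact: sqn_ge0.
    by move: h; rewrite expr2 ler_pM2r.
apply/seteqP; split => [p [g Mg hg]|p]; rewrite /rel_of/=.
  have := uniq (p.1 + p.2) _ Mg => <-// r Mr.
  by rewrite /form_sip hg// (sipDl hb).
move=> e; exists (rho (p.1 + p.2)).2; first by rewrite -{1}e -surjective_pairing.
move=> r Mr; rewrite -{1}e -surjective_pairing.
have := Erho (p.1 + p.2) _ Mr; rewrite /form_sip e (sipDl hb) => /eqP.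
by rewrite (inj_eq (addrI _)) => /eqP.
Qed.

Lemma form_rel_nsa M q : closed_form M q -> nonneg_selfadjoint dot (form_rel M q).
Proof.
by move=> /form_resolvent[rho [_ _ _ bR ->]]; exact: nsa_rel_of.
Qed.

Lemma form_rel_mul M q : closed_form M q -> lr_mul (form_rel M q) `<=` [set 0].
Proof.
move=> [_ hq _ uM dM] f [g /= /[dup] /uM -> M0 h]; apply: dM => r /h <-.
by rewrite (_ : (0, 0) = 0)// (sip0l hq).
Qed.

(* The domain of the relation is a core for each of the two forms. *)
Lemma form_rel_inj M q M' q' : closed_form M q -> closed_form M' q' ->
  form_rel M q = form_rel M' q' ->
  forall m, M m -> exists m', [/\ M' m', m'.1 = m.1 & sqn q' m' = sqn q m].
Proof.
move=> hM hM' e m Mm.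
have [rho [Mr Er lr bR eR]] := form_resolvent hM.
have [rho' [Mr' Er' lr' bR' eR']] := form_resolvent hM'.
have E1 u : (rho u).1 = (rho' u).1.
  by have /rel_of_inj/(congr1 (@^~ u)) := etrans (esym eR) (etrans e eR').
have [sM hq cM uM dM] := hM; have [sM' hq' cM' uM' dM'] := hM'.
have hs := sip_form_sip hq; have hs' := sip_form_sip hq'.
have Esq u : sqn (form_sip q) (rho u) = sqn (form_sip q') (rho' u).
  by rewrite /sqn Er// Er'// E1.
pose L := range rho.
have sL : subspace L.
  split; first by exists 0 => //; exact: lin0 lr.
  by move=> a _ _ [u _ <-] [v _ <-]; exists (a *: u + v) => //; rewrite lr.
have LM : L `<=` M by move=> _ [u _ <-].
have [l [p [Ll Mp lp po]]] := projection hs m sL LM cM.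
(* With f the first component of m - p, the defining property of [rho] turns orthogonality of m - p
   to [rho f] into |f|^2 = 0. *)
have mp : m = p.
  apply/eqP; rewrite -subr_eq0; apply/eqP.
  have Md := subspaceB sM Mm Mp.
  case: (m - p) po Md => f g po Md.
  have f0 : f = 0.
    apply: hd; rewrite /sqn -(Er f _ Md) (sipC hs) po ?rmorph0//.
    by exists f.
  by rewrite f0 in Md *; rewrite (uM _ Md).
have /choice[u hu] n : exists u, rho u = l n by have [u _ <-] := Ll n; exists u.
have lE : l = rho \o u by apply/funext => n; rewrite /= hu.
subst l p.
(* The two lifts of the common resolvent have equal form norms, so the sequence approximating [m]
   becomes a Cauchy sequence for the second form. *)
have [m' Mm' lm'] : exists2 l, M' l & cvg_sip (form_sip q') (rho' \o u) l.
  apply: cM' => [n|d /(cvg_cauchy_sip hs lp)[N hN]]; first exact: Mr'.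
  by exists N => i j Ni Nj; have := hN _ _ Ni Nj; rewrite /= -!linB// Esq.
have fst_cvg q0 : sip q0 -> forall v l, cvg_sip (form_sip q0) v l ->
    cvg_sip dot (fst \o v) l.1.
  move=> h0 v l vl; apply: (cvg_sip_squeeze hb _ vl) => n.
  by rewrite sqn_form_sip lerDl sqn_ge0.
have m1 : m'.1 = m.1.
  apply: (cvg_sip_unique hb hd (fst_cvg _ hq' _ _ lm')).
  have := fst_cvg _ hq _ _ lp; congr cvg_sip.
  by apply/funext => n /=.
exists m'; split => //.
have c1 := cvg_sip_sqn hs lp; have c2 := cvg_sip_sqn hs' lm'.
have : sqn (form_sip q') m' = sqn (form_sip q) m.
  apply: (cvg_unique _ c2) => //.
  by rewrite (_ : (fun n => _) = (fun n => sqn (form_sip q) ((rho \o u) n)))//;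
    apply/funext => n /=.
by rewrite !sqn_form_sip m1 => /addrI.
Qed.

(** Polarisation: real parts come from the square norm of m + r, imaginary parts from replacing r by
    i r. *)
Lemma form_polar M q M' q' : closed_form M q -> closed_form M' q' ->
  (forall m m', M m -> M' m' -> m.1 = m'.1 -> sqn q m = sqn q' m') ->
  forall m r m' r', M m -> M r -> M' m' -> M' r' -> m.1 = m'.1 -> r.1 = r'.1 ->
    q m r = q' m' r'.
Proof.
move=> [sM hq _ _ _] [sM' hq' _ _ _] e.
have Rq m r m' r' : M m -> M r -> M' m' -> M' r' -> m.1 = m'.1 -> r.1 = r'.1 ->
    Re (q m r) = Re (q' m' r').
  move=> Mm Mr Mm' Mr' em er.
  have := e _ _ (subspaceD sM Mm Mr) (subspaceD sM' Mm' Mr').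
  rewrite /= em er => /(_ erefl); rewrite (sqnD hq) (sqnD hq') (e m m')// (e r r')//.
  lra.
move=> m r m' r' Mm Mr Mm' Mr' em er; apply: complexP; first exact: Rq.
have := Rq m ('i%C *: r) m' ('i%C *: r') Mm (subspaceZ _ sM Mr) Mm' (subspaceZ _ sM' Mr') em.
rewrite /= er => /(_ erefl).
by rewrite (sipZr hq) (sipZr hq') !ReImE/= !mul0r !mulN1r !opprK !add0r.
Qed.

Lemma form_rel_sub M q M' q' : closed_form M q -> closed_form M' q' ->
  lr_dom M = lr_dom M' ->
  (forall m m', M m -> M' m' -> m.1 = m'.1 -> sqn q m = sqn q' m') ->
  form_rel M q `<=` form_rel M' q'.
Proof.
move=> hM hM' ed es p [g Mg hg].
have [g' Mg'] : lr_dom M' p.1 by rewrite -ed; exists g.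
exists g' => // r' Mr'.
have [h Mr] : lr_dom M r'.1 by rewrite ed; exists r'.2; rewrite -surjective_pairing.
by rewrite -(form_polar hM hM' es Mg Mr Mg' Mr')// hg.
Qed.

Lemma form_rel_eq M q M' q' : closed_form M q -> closed_form M' q' ->
  lr_dom M = lr_dom M' ->
  (forall m m', M m -> M' m' -> m.1 = m'.1 -> sqn q m = sqn q' m') ->
  form_rel M q = form_rel M' q'.
Proof.
move=> hM hM' ed es; apply/seteqP; split; first exact: form_rel_sub.
by apply: form_rel_sub => // m m' Mm Mm' e; apply/esym/es.
Qed.

Definition sqrt_form (p r : H * H) : R[i] := dot p.2 r.2.

Lemma closed_sqrt_form S A : is_sqrt_in dot setT S A -> closed_form S sqrt_form.
Proof.
case=> [[lS eS pS] mS cS]; have sS := linear_relation_subspace lS.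
split => //.
- split=> [a u v w|u v|u]; rewrite /sqrt_form.
  + by rewrite /= (sipDl hb) (sipZl hb).
  + by rewrite -(sipC hb).
  + exact: sip_ge0.
- exact: complete_linear_relation lS.
- by move=> g Sg; have : lr_mul S g by []; rewrite mS.
- move=> u hu; have : lr_mul S u; last by rewrite mS.
  rewrite /lr_mul /mkset eS; split => // r Sr.
  by rewrite /= hu// (sip0l hb).
Qed.

(** The weak condition places (S f, f') in the adjoint of [S], which is [S] itself; so the relation
    of the form is the composite of [S] with itself. *)
Lemma form_rel_sqrt S A : is_sqrt_in dot setT S A -> form_rel S sqrt_form = A.
Proof.
case=> [[lS eS pS] mS <-].
have sS p r : S p -> S r -> dot p.2 r.1 = dot p.1 r.2.
  by rewrite {1}eS => -[_ _]; apply.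
apply/seteqP; split => p.
  case=> g Sg hg; exists g; split => //=.
  by rewrite eS; split => // r Sr; rewrite -hg.
case=> g [/= S1 S2]; exists g => // r Sr.
by rewrite /sqrt_form/= -(sS _ _ S2 Sr).
Qed.

Lemma orth_mul0 A : lr_mul A `<=` [set 0] -> orth_mul dot A = setT.
Proof.
move=> mA; apply/seteqP; split => // f _ g /mA ->.
by rewrite (sip0r hb).
Qed.

Lemma operator_part_mul0 A : lr_mul A `<=` [set 0] -> operator_part dot A = A.
Proof.
move=> mA; rewrite /operator_part orth_mul0//.
by apply/seteqP; split => [p []|].
Qed.

Lemma lr_app_val S f g : lr_mul S `<=` [set 0] -> subspace S -> S (f, g) ->
  lr_app S f = g.
Proof.
move=> mS sS Sg; rewrite /lr_app; case: xgetP => [h _ Sh|/(_ g)//].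
have /mS/eqP : lr_mul S (h - g).
  by have := subspaceB sS Sh Sg; rewrite /lr_mul/mkset -(subrr f).
by rewrite subr_eq0 => /eqP.
Qed.

(** The second representation theorem. The object chosen by [xget] is some root of the relation, and
    any root has a form with this same relation, hence with the same domain and values by
    [form_rel_inj]. *)
Lemma form_data M q : closed_form M q ->
  form_dom dot (form_rel M q) = lr_dom M /\
  forall m, M m -> form_val dot (form_rel M q) m.1 = sqn q m.
Proof.
move=> hM; pose A := form_rel M q.
have nA := form_rel_nsa hM; have mA := form_rel_mul hM.
have [S0 hS0] := sqrt_exists H_complete nA mA.
have hS : is_sqrt_in dot setT (sqrt_op dot A) A.
  rewrite /sqrt_op orth_mul0// operator_part_mul0//.
  by case: xgetP => [S _ //|/(_ S0)].
rewrite /form_dom /form_val -/A; move: (sqrt_op dot A) hS => S hS.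
have cS := closed_sqrt_form hS; have eS := form_rel_sqrt hS.
have [[lS _ _] mS _] := hS; have sS := linear_relation_subspace lS.
have mS0 : lr_mul S `<=` [set 0] by rewrite mS.
have e : form_rel M q = form_rel S sqrt_form by rewrite eS.
split.
  apply/seteqP; split => f [g hg].
    have [[f' g'] [Mm /= <- _]] := form_rel_inj cS hM (esym e) hg.
    by exists g'.
  have [[f' g'] [Mm /= <- _]] := form_rel_inj hM cS e hg.
  by exists g'.
move=> m Mm; have [[f g] [Sm /= <- <-]] := form_rel_inj hM cS e Mm.
rewrite (lr_app_val mS0 sS Sm) /hnorm sqr_sqrtr//; exact: sqn_ge0.
Qed.

(** Identifies whatever relation [xget] may return as a form sum, from its form domain and form
    values alone. *)
Lemma form_rel_unique M q C : closed_form M q -> nonneg_selfadjoint dot C ->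
  form_dom dot C = lr_dom M ->
  (forall m, M m -> form_val dot C m.1 = sqn q m) -> C = form_rel M q.
Proof.
move=> hM nC; rewrite /form_dom /form_val.
have [sM hq cM uM dM] := hM.
have : sqrt_op dot C = set0 \/
    is_sqrt_in dot (orth_mul dot C) (sqrt_op dot C) (operator_part dot C).
  by rewrite /sqrt_op; case: xgetP => [S _ hS|_]; [right|left].
move: (sqrt_op dot C) => S [-> ed _|hS ed ev].
  (* The junk value [set0] of [sqrt_op] has an empty domain, whereas a form domain contains 0. *)
  have : lr_dom M 0 by exists 0; case: sM.
  by rewrite -ed => -[].
have [[lS eS _] _ _] := hS.
(* The domain of the root lies in the orthogonal complement of [lr_mul C] and is dense, being the
   form domain; so [C] is an operator. *)
have mC : lr_mul C `<=` [set 0].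
  move=> g Cg; apply: dM => r Mr.
  have [h Sh] : lr_dom S r.1 by rewrite ed; exists r.2; rewrite -surjective_pairing.
  move: Sh; rewrite eS => -[/= /(_ _ Cg) h0 _ _].
  by rewrite (sipC hb) h0 rmorph0.
move: hS; rewrite orth_mul0// operator_part_mul0// => hS.
have cS := closed_sqrt_form hS; rewrite -(form_rel_sqrt hS).
have [_ mS _] := hS; have sS := linear_relation_subspace lS.
have mS0 : lr_mul S `<=` [set 0] by rewrite mS.
apply: form_rel_eq => // -[f g] m Sm Mm /= fm.
rewrite -ev// -fm (lr_app_val mS0 sS Sm) /hnorm sqr_sqrtr//; exact: sqn_ge0.
Qed.

Lemma form_sum_rel M1 q1 M2 q2 M q :
  closed_form M1 q1 -> closed_form M2 q2 -> closed_form M q ->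
  lr_dom M = lr_dom M1 `&` lr_dom M2 -> M `<=` M1 `&` M2 ->
  (forall m, M m -> sqn q m = sqn q1 m + sqn q2 m) ->
  form_sum dot (form_rel M1 q1) (form_rel M2 q2) = form_rel M q.
Proof.
move=> h1 h2 h ed eM eq.
have [d1 v1] := form_data h1; have [d2 v2] := form_data h2.
have [d v] := form_data h.
rewrite /form_sum; case: xgetP => [C _ [nC dC vC]|/(_ (form_rel M q))[]].
  apply: form_rel_unique => //; first by rewrite dC d1 d2 ed.
  move=> m Mm; have [Mm1 Mm2] := eM _ Mm.
  rewrite vC ?v1 ?v2 ?eq// dC d1 d2 -ed; exists m.2.
  by rewrite -surjective_pairing.
split; [exact: form_rel_nsa|by rewrite d d1 d2|move=> f].
rewrite d => -[g Mg]; have [Mm1 Mm2] := eM _ Mg.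
by rewrite (v _ Mg) (v1 _ Mm1) (v2 _ Mm2) eq.
Qed.

End forms.

(** * Boundary systems *)

Section boundary_systems.
Variables (R : realType) (H : lmodType R[i]) (dot : {dot H for Num.conj}).
Hypothesis H_complete : complete_sip dot setT.
Implicit Types (D : set (H * H)) (e : H) (c d : \bar R).

Let hb := sip_dot dot.
Let hd := @sqn_dot_eq0 _ _ dot.

Definition boundary e (p : H * H) : R[i] := dot (p.1 - p.2) e.

(* Abstract version of the graph [D] of [d/dx] on the half-line, [e] being the
   function [exp (- x)], for which [boundary e (f, f')] is [f 0]. *)
Definition boundary_system D e : Prop :=
  [/\ linear_relation dot D, D (e, - e),
      forall p r, D p -> D r ->
        dot p.2 r.1 + dot p.1 r.2 = - (boundary e p * conjc (boundary e r)),
      forall p, (forall r, D r -> boundary e r = 0 ->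
        dot r.2 p.1 + dot r.1 p.2 = 0) -> D p
    & [/\ e != 0, forall g, D (0, g) -> g = 0 & forall f, D (f, 0) -> f = 0]].

Definition boundary_cond c (x y : R[i]) : Prop :=
  if c is r%:E%E then y = r%:C * x else x = 0.

Definition laplacian D e c : set (H * H) :=
  [set p | exists f1, [/\ D (p.1, f1), D (f1, - p.2)
    & boundary_cond c (boundary e (p.1, f1)) (boundary e (f1, - p.2))]].

Definition cinv c : \bar R :=
  if c is r%:E%E then (if r == 0 then +oo%E else (r^-1)%:E) else 0%:E.

Definition amean c d : \bar R :=
  if c is r%:E%E then (if d is s%:E%E then ((r + s) / 2)%:E else +oo%E) else +oo%E.

Definition hmean c d : \bar R := cinv (amean (cinv c) (cinv d)).

(** Compactifies [0, +oo] to [0, 1]: convergence of parameters to +oo and to a finite value become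
    one and the same kind of statement. *)
Definition kappa c : R := if c is r%:E%E then r / (1 + r) else 1.

Lemma boundary_linear e a p r :
  boundary e (a *: p + r) = a * boundary e p + boundary e r.
Proof.
by have [bl _ _] := hb; rewrite /boundary /= opprD addrACA -scalerBr bl.
Qed.

(** Exchanging components leaves the Green identity and the maximality clause unchanged. As <f' - f,
    -e> = <f - f', e>, the boundary value is preserved as well. *)
Lemma boundary_inv D e : boundary_system D e -> boundary_system (lr_inv D) (- e).
Proof.
have bE p : boundary (- e) p = boundary e (p.2, p.1).
  by rewrite /boundary /= (sipNr hb) -(sipNl hb) opprB.
case=> [[D0 Dl Dc] De Dg Dm [e0 mD kD]]; split.
- split=> [|a p q Dp Dq|u l hu u1 u2]; first exact: D0.
    exact: (Dl a (p.2, p.1) (q.2, q.1)).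
  exact: (Dc (fun n => ((u n).2, (u n).1)) (l.2, l.1)).
- by rewrite /lr_inv /mkset /= opprK.
- move=> p r Dp Dr; rewrite !bE addrC.
  exact: (Dg (p.2, p.1) (r.2, r.1)).
- move=> p hp; apply: Dm => r Dr r0 /=.
  rewrite addrC; apply: (hp (r.2, r.1)); last by rewrite bE -surjective_pairing.
  by rewrite /lr_inv /mkset /= -surjective_pairing.
- by split; rewrite ?oppr_eq0.
Qed.

(** If f -> g -> -f' is the chain of derivatives in [D], then f' -> -g -> -f is a chain in
    [lr_inv D]. The two boundary values exchange places and change sign, so y = c x becomes -x =
    cinv(c) (-y). *)
Lemma laplacian_inv D e c : boundary_system D e -> (0 <= c)%E ->
  lr_inv (laplacian D e c) = laplacian (lr_inv D) (- e) (cinv c).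
Proof.
move=> [[D0 Dl _] De Dg Dm [e0 mD kD]] c0.
have DN f g : D (f, g) -> D (- f, - g).
  by move=> /(Dl (-1) _ 0)/(_ D0); rewrite addr0 scaleN1r.
have bE p : boundary (- e) p = boundary e (p.2, p.1).
  by rewrite /boundary /= (sipNr hb) -(sipNl hb) opprB.
have bN f g : boundary e (- f, - g) = - boundary e (f, g).
  by rewrite /boundary /= -opprD (sipNl hb).
have bcE x y : boundary_cond c x y <-> boundary_cond (cinv c) (- y) (- x).
  case: c c0 => [r|_|//]; rewrite /cinv /boundary_cond; last first.
    by rewrite mul0r; split=> [->|/eqP]; rewrite ?oppr0// oppr_eq0 => /eqP.
  case: eqVneq => [->|r0] _.
    by rewrite mul0r; split=> [->|/eqP]; rewrite ?oppr0// oppr_eq0 => /eqP.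
  have rr : r^-1%:C * r%:C = 1 :> R[i].
    by apply: complexP; rewrite !ReImE/= ?mulVf//; ring.
  split=> [->|/eqP]; first by rewrite mulrN mulrA rr mul1r.
  rewrite mulrN eqr_opp => /eqP ->.
  by rewrite mulrA [r%:C * _]mulrC rr mul1r.
apply/seteqP; split => -[f f'] [g [/= h1 h2 h3]].
  exists (- g); split => /=.
  - by rewrite /lr_inv/mkset/=; have := DN _ _ h2; rewrite opprK.
  - by rewrite /lr_inv/mkset/=; exact: DN.
  - by rewrite !bE/= bN -[f in (- g, f)]opprK bN; apply/bcE.
exists (- g); split => /=.
- by have := DN _ _ h2; rewrite opprK.
- exact: DN.
- apply/bcE; rewrite bN opprK; move: h3; rewrite !bE/=.
  by rewrite -(bN f') opprK.
Qed.

(** * Forms, resolvents and means for a fixed boundary system *)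

Section fixed.
Variables (D : set (H * H)) (e : H).
Hypothesis De : boundary_system D e.

Let lD : linear_relation dot D. Proof. by case: De. Qed.
Let sD : subspace D. Proof. exact: linear_relation_subspace lD. Qed.

(** The Dirichlet condition restricts the form domain; the conditions with finite parameter are
    natural ones, produced by the boundary term of the form. *)
Definition bdom c : set (H * H) :=
  if c is r%:E%E then D else [set p | D p /\ boundary e p = 0].

Definition bcoef c : R := if c is r%:E%E then r else 0.

Definition bform (a b : R) (p r : H * H) : R[i] :=
  a%:C * dot p.2 r.2 + b%:C * (boundary e p * conjc (boundary e r)).

Lemma bdomD c : bdom c `<=` D.
Proof. by case: c => [r p|p|p] // []. Qed.

Lemma bdom_ker c p : D p -> boundary e p = 0 -> bdom c p.
Proof. by case: c. Qed.

Lemma bdom_sub c : subspace (bdom c).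
Proof.
case: c => [r||]; first exact: sD.
all: split=> [|a u v [Du u0] [Dv v0]]; split; first by case: sD.
all: rewrite ?boundary_linear ?u0 ?v0 ?mulr0 ?addr0//.
all: try by case: sD => _; apply.
all: by rewrite /boundary subrr (sip0l hb).
Qed.

(** This boundary value is 2|e|^2, and the Green identity for (e, -e) against itself reads 2|e|^2 =
    (2|e|^2)^2; hence |e|^2 = 1/2, as [e] is nonzero. *)
Lemma boundary_e : boundary e (e, - e) = 1.
Proof.
have [_ Dee Dg _ [e0 _ _]] := De.
have := Dg _ _ Dee Dee; rewrite /boundary /= opprK (sipNl hb) (sipNr hb) -opprD => /oppr_inj.
rewrite (sipDl hb) (sip_sqn hb) => h.
have e1 : sqn dot e != 0 by apply: contra e0 => /eqP/hd ->.
apply: complexP; last by rewrite ImD/= addr0.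
move: h => /(congr1 (fun z => Re z)); rewrite !ReImE/= => h.
apply: (mulIf e1); rewrite mul1r; apply: (mulfI (_ : (2 : R) != 0)) => //.
move: h; lra.
Qed.

(** A trace inequality. Real and imaginary part each contribute |f - f'|^2 |e|^2, which is at most
    twice the square of the graph norm times |e|^2. *)
Lemma sqn_boundary p : Re (boundary e p) ^+ 2 + Im (boundary e p) ^+ 2 <=
  4 * sqn dot e * sqn (graph_sip dot) p.
Proof.
have h1 := CS hb (p.1 - p.2) e; have h2 := CS_Im hb (p.1 - p.2) e.
have h3 : sqn dot (p.1 - p.2) * sqn dot e <= 2 * sqn (graph_sip dot) p * sqn dot e.
  apply: ler_wpM2r; first exact: sqn_ge0.
  by rewrite sqn_graph mulrDr; exact: sqnB_le.
rewrite /boundary; lra.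
Qed.

Lemma sip_bform a b : 0 <= a -> 0 <= b -> sip (bform a b).
Proof.
move=> a0 b0; split=> [x u v w|u v|u]; rewrite /bform.
- by rewrite /= (sipDl hb) (sipZl hb) boundary_linear; ring.
- by rewrite (sipC hb u.2); apply: complexP; rewrite !ReImE/=; ring.
- rewrite (sip_sqn hb) addr_ge0//.
    by apply: mulr_ge0; rewrite ge0_complex/= eqxx// (sqn_ge0 hb).
  apply: mulr_ge0; first by rewrite ge0_complex/= eqxx.
  rewrite ge0_complex; apply/andP; split; rewrite !ReImE.
    by apply/eqP; ring.
  by rewrite mulrN opprK -!expr2 addr_ge0// sqr_ge0.
Qed.

Lemma sqn_bform a b p : sqn (bform a b) p = a * sqn dot p.2 +
  b * (Re (boundary e p) ^+ 2 + Im (boundary e p) ^+ 2).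
Proof. rewrite /sqn /bform !ReImE/=; ring. Qed.

(** By the trace inequality the form norm is equivalent to the graph norm, for which [D] is complete
    and the boundary value continuous. *)
Lemma closed_bform c a b : 0 < a -> 0 <= b -> closed_form dot (bdom c) (bform a b).
Proof.
move=> a0 b0; have [_ Dee Dg Dm [e0 mD kD]] := De.
have hq := sip_bform (ltW a0) b0.
split => //; first exact: bdom_sub.
- move=> u Mu cu.
  pose k := Num.min 1 a; have k0 : 0 < k by rewrite lt_min ltr01.
  have lek p : k * sqn (graph_sip dot) p <= sqn (form_sip dot (bform a b)) p.
    rewrite sqn_graph sqn_form_sip sqn_bform mulrDr addrA.
    have h1 : k * sqn dot p.1 <= sqn dot p.1.
      rewrite -[leRHS]mul1r; apply: ler_wpM2r; first exact: (sqn_ge0 hb).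
      by rewrite ge_min lexx.
    have h2 : k * sqn dot p.2 <= a * sqn dot p.2.
      by apply: ler_wpM2r; [exact: sqn_ge0|rewrite ge_min lexx orbT].
    have h3 : 0 <= b * (Re (boundary e p) ^+ 2 + Im (boundary e p) ^+ 2).
      by rewrite mulr_ge0// addr_ge0// sqr_ge0.
    lra.
  have [l Dl ul] : exists2 l, D l & cvg_sip (graph_sip dot) u l.
    apply: (complete_linear_relation H_complete lD) => [n|x x0].
      exact: bdomD (Mu n).
    have /cu[N hN] : 0 < k * x by rewrite mulr_gt0.
    exists N => m n Nm Nn; have := le_lt_trans (lek _) (hN _ _ Nm Nn).
    by rewrite ltr_pM2l.
  have bl : (forall n, boundary e (u n) = 0) -> boundary e l = 0.
    move=> u0; have h : Re (boundary e l) ^+ 2 + Im (boundary e l) ^+ 2 <= 0.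
      have c4 : 4 * sqn dot e * sqn (graph_sip dot) (u n - l) @[n --> \oo] --> (0 : R).
        by rewrite -(mulr0 (4 * sqn dot e)); apply: cvgMr.
      apply: cvgr_to_ge c4 _; near=> n; apply: le_trans (sqn_boundary _).
      have -> : boundary e (u n - l) = - boundary e l.
        by rewrite -scaleN1r addrC boundary_linear u0 addr0 mulN1r.
      by rewrite !ReImE !sqrrN.
    have h1 := sqr_ge0 (Re (boundary e l)); have h2 := sqr_ge0 (Im (boundary e l)).
    by apply: complexP => /=; apply/eqP; rewrite -sqrf_eq0; apply/eqP; lra.
  exists l.
    by case: c Mu => [//||] Mu; split => //; apply: bl => n; case: (Mu n).
  have hs := sip_form_sip dot hq.
  apply: (cvg_sip_squeeze hs (y := fun n =>
      (1 + a + b * (4 * sqn dot e)) * sqn (graph_sip dot) (u n - l))) => [n|]; last first.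
    by rewrite -(mulr0 (1 + a + b * (4 * sqn dot e))); apply: cvgMr.
  rewrite sqn_form_sip sqn_bform.
  move: (u n - l) => p; have := ler_wpM2l b0 (sqn_boundary p).
  have : a * sqn dot p.2 <= a * sqn (graph_sip dot) p.
    by rewrite ler_pM2l// sqn_graph lerDr (sqn_ge0 hb).
  have : sqn dot p.1 <= sqn (graph_sip dot) p by rewrite sqn_graph lerDl (sqn_ge0 hb).
  lra.
- by move=> g /bdomD/mD.
(* Density: if [u] is orthogonal to the form domain, the maximality clause applies to the pair (0,
   u), and (0, u) in [D] forces u = 0. *)
- move=> u hu; apply: mD; apply: Dm => r Dr r0.
  rewrite /= (sip0r hb) add0r (sipC hb) hu ?rmorph0//.
  exact: bdom_ker.
Unshelve. all: by end_near.
Qed.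

(** One inclusion is the Green identity. Conversely, test elements with boundary value 0 put (g,
    -f') in [D] by maximality, and the test element (e, -e), of boundary value 1, then yields the
    condition for finite c. *)
Lemma laplacian_form c : laplacian D e c = form_rel dot (bdom c) (bform 1 (bcoef c)).
Proof.
have [_ Dee Dg Dm [e0 mD kD]] := De.
apply/seteqP; split => -[f f'].
  case=> g [/= h1 h2 h3]; exists g => /=; first by case: c h3.
  move=> r Mr; have := Dg _ _ h2 (bdomD Mr); rewrite /= (sipNl hb) => h.
  rewrite /bform /= mul1r.
  have -> : (bcoef c)%:C * (boundary e (f, g) * conjc (boundary e r)) =
      boundary e (g, - f') * conjc (boundary e r).
    case: c h3 Mr => [s|s [_ ->]|s [_ ->]]; last 2 first.
    - by rewrite conjc0 !mulr0.
    - by rewrite conjc0 !mulr0.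
    by move=> -> _; rewrite mulrA.
  move: h => /eqP; rewrite -[_ == _]eqr_opp opprK opprD opprK => /eqP <-.
  by rewrite addrC subrK.
case=> g /= Mg hg; have Dfg := bdomD Mg.
have Dgf : D (g, - f').
  apply: Dm => r Dr r0 /=; rewrite (sipNr hb).
  have := hg _ (bdom_ker c Dr r0); rewrite /bform /= r0 rmorph0 !mulr0 addr0 mul1r.
  by rewrite (sipC hb g) (sipC hb f') => ->; rewrite subrr.
exists g; split => //=; case: c Mg hg => [s|[]|[]] //= _ hg.
have := hg _ Dee; have := Dg _ _ Dgf Dee.
rewrite /bform boundary_e conjc1 !mulr1 !mul1r /= (sipNl hb) => h1 h2.
rewrite -[LHS]opprK -h1 opprD opprK -h2.
by rewrite addrC addKr.
Qed.

Lemma bcoef_ge0 c : (0 <= c)%E -> 0 <= bcoef c.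
Proof. by case: c. Qed.

Lemma laplacian_nsa c : (0 <= c)%E -> nonneg_selfadjoint dot (laplacian D e c).
Proof.
move=> c0; rewrite laplacian_form; apply: form_rel_nsa => //.
by apply: closed_bform => //; exact: bcoef_ge0.
Qed.

Lemma laplacian_arith c d : (0 <= c)%E -> (0 <= d)%E ->
  arith_mean dot (laplacian D e c) (laplacian D e d) = laplacian D e (amean c d).
Proof.
move=> c0 d0; have cf := bcoef_ge0 c0; have df := bcoef_ge0 d0.
have [_ Dee Dg Dm [e0 mD kD]] := De.
pose m := amean c d.
have mf : 0 <= bcoef m.
  case: c d c0 d0 @m cf df => [r||] [s||] //= _ _ r0 s0.
  by rewrite divr_ge0// addr_ge0.
rewrite /arith_mean !laplacian_form.
(* The sum of the two forms has weight 2 on the derivative term; the factor 1/2 of the mean restores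
   weight 1 and turns the sum of boundary coefficients into their average. *)
rewrite (@form_sum_rel _ _ _ H_complete _ _ _ _ (bdom m) (bform 2 (2 * bcoef m))).
- rewrite /lr_scale; apply/seteqP; split => -[f f'].
    case=> g [/= [h Mh hh] ->]; exists h => //= r Mr.
    rewrite (sipZl hb) -hh// /bform mulrDr !mulrA.
    by congr (_ * _ + _ * _ * _); apply: complexP; rewrite !ReImE/=; field.
  case=> g /= Mg hg; exists (2 *: f'); split; last first.
    by rewrite scalerA mulVf ?scale1r//; rewrite pnatr_eq0.
  exists g => //= r Mr; rewrite (sipZl hb) -hg// /bform mulrDr !mulrA.
  by congr (_ * _ + _ * _ * _); apply: complexP; rewrite !ReImE/=; ring.
- exact: closed_bform.
- exact: closed_bform.
- by apply: closed_bform => //; rewrite mulr_ge0.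
- have sv g f h : D (f, g) -> D (f, h) -> g = h.
    move=> D1 D2; apply/eqP; rewrite -subr_eq0; apply/eqP/mD.
    by have := subspaceB sD D1 D2; rewrite -{1}(subrr f).
  apply/seteqP; split => [f [g Mg]|f [[g Mg] [h Mh]]].
    case: c d @m Mg {c0 d0 cf df mf} => [r||] [s||] //= Mg.
    all: try by split; exists g => //; case: Mg.
  exists g; have gh := sv _ _ _ (bdomD Mg) (bdomD Mh); subst h.
  by case: c d @m Mg Mh {c0 d0 cf df mf} => [r||] [s||].
- move=> p; case: c d @m {c0 d0 cf df mf} => [r||] [s||] //= Mp;
    do ?[case: Mp => ? ?]; by do ![split].
- move=> p; rewrite !sqn_bform.
  case: c d @m {c0 d0 cf df mf} => [r||] [s||] /=.
  all: try by move=> [_ ->]; rewrite /= expr0n /=; ring.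
  by move=> _; field.
Qed.

(* Krein's formula: the resolvents differ by a rank one term. *)
Lemma laplacian_krein : exists (T : H -> H) (w : H -> R[i]), linear T /\
  forall c, (0 <= c)%E ->
    let Tc u := T u - ((kappa c)%:C * w u) *: e in
    bounded_nonneg dot Tc /\ laplacian D e c = rel_of Tc.
Proof.
have [_ Dee Dg Dm [e0 mD kD]] := De.
(* The reference operator is the one with c = 0, for which the derivative [v u] of [T u] has
   boundary value 0. *)
have [T bT eT] := nsa_bounded H_complete (laplacian_nsa (lexx 0%:E)).
have /choice[v hv] u : exists v, [/\ D (T u, v), D (v, T u - u)
    & boundary e (v, T u - u) = 0].
  have : laplacian D e 0%:E (T u, u - T u) by rewrite eT; exact: rel_ofP.
  by case=> v [/=]; rewrite opprB mul0r => *; exists v.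
exists T, (fun u => boundary e (T u, v u)); split; first by case: bT.
move=> c c0 /=; set Tc := (X in bounded_nonneg _ X).
have [T' bT' eT'] := nsa_bounded H_complete (laplacian_nsa c0).
suff e' : Tc = T' by split; [rewrite e'|rewrite eT' -e'].
apply/funext => u; have [h1 h2 h3] := hv u.
set b := boundary e (T u, v u) in h3 *.
(* The function T u - k e has derivative v u + k e, and their boundary values are b - k and k. The
   condition k = r (b - k) gives k = b r/(1 + r); for c = +oo the condition b - k = 0 gives k =
   b. *)
pose k := (kappa c)%:C * b.
suff : rel_of T' (T u - k *: e, u - T u + k *: e).
  by rewrite /rel_of /= addrACA addNr addr0 addrCA subrr addr0 => ->.
have Dk : D ((- k) *: (e, - e)) by exact: subspaceZ.
have Dk' : D (k *: (e, - e)) by exact: subspaceZ.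
rewrite -eT'; exists (v u + k *: e); split => /=.
- have := subspaceD sD h1 Dk; congr D.
  by congr (_, _); rewrite /= ?scaleNr// scalerN opprK.
- have := subspaceD sD h2 Dk'; congr D.
  by congr (_, _); rewrite /= ?scalerN// opprD opprB.
- have -> : (T u - k *: e, v u + k *: e) = (- k) *: (e, - e) + (T u, v u).
    by congr (_, _); rewrite /= addrC ?scaleNr// scalerN opprK.
  have -> : (v u + k *: e, - (u - T u + k *: e)) = k *: (e, - e) + (v u, T u - u).
    by congr (_, _); rewrite /= addrC// opprD opprB scalerN.
  rewrite !boundary_linear boundary_e h3 -/b !mulr1 addr0 /k.
  case: c c0 {k T' bT' eT' Tc Dk Dk'} => [r|_|//]; last by rewrite mul1r addNr.
  rewrite lee_fin => r0; have r1 : 1 + r != 0 by rewrite gt_eqF// ltr_wpDr.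
  rewrite /boundary_cond /kappa.
  by apply: complexP; rewrite !ReImE/=; field.
Qed.

Lemma scale_half (x : H) : 2^-1 *: (x + x) = x.
Proof.
have <- : 2 *: x = x + x by rewrite scaler_nat mulr2n.
by rewrite scalerA mulVf ?scale1r ?pnatr_eq0. Qed.

(** The Cayley transform of [rel_of T] is the graph of 2T - I, which is affine in T; averaging
    Cayley transforms is therefore averaging resolvents. *)
Lemma c0_mean_rel_of (T T' : H -> H) : linear T -> linear T' ->
  c0_mean (rel_of T) (rel_of T') = rel_of (fun u => 2^-1 *: (T u + T' u)).
Proof.
move=> lT lT'.
have C2 : 2^-1 * 2 = 1 :> R[i] by rewrite mulVf ?pnatr_eq0.
have dbl (x : H) : 2 *: x = x + x by rewrite scaler_nat mulr2n.
have half := scale_half.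
have mid f : 2^-1 *: (2 *: T f - f + (2 *: T' f - f)) = T f + T' f - f.
  by rewrite !dbl addrACA [X in X + _]addrACA addrACA half.
have cay (X : H -> H) : cayley (rel_of X) = [set p | p.2 = 2 *: X p.1 - p.1].
  rewrite /cayley /lr_add /lr_scale /lr_inv /lr_id /=.
  apply/seteqP; split => -[f f'] /=.
    case=> _ [_ [[_ [-> ->]] [g [[_ [x [-> hx ->]]] ->]] ->]].
    by rewrite scaleN1r addrC; move: hx; rewrite /rel_of /= => ->.
  move=> ->; exists (- f), (2 *: X f); split; last by rewrite addrC.
    by exists f; rewrite scaleN1r.
  exists (X f); split => //; exists (X f), (f - X f); split => //.
    exact: rel_ofP.
  by rewrite addrCA subrr addr0.
rewrite /c0_mean !cay /cayley_contr /lr_scale /lr_add /=.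
apply/seteqP; split => p.
  case=> f [_ [[g [[_ [_ [-> -> ->]]] ->]] ->]].
  rewrite mid /rel_of /= addrACA subrr addr0 !(linD _ _ lT, linD _ _ lT') addrACA half.
  by rewrite addrCA subrr addr0.
move=> /rel_of_eq[u ->].
(* In [cayley_contr] the two components of the pair given by f add up to 2f, whereas in [rel_of]
   they add up to u; hence f is half of u. *)
have -> : u = 2^-1 *: u + 2^-1 *: u by rewrite -dbl scalerA mulfV ?scale1r// pnatr_eq0.
move: (2^-1 *: u) => f; rewrite !(linD _ _ lT, linD _ _ lT') addrACA half.
exists f, (T f + T' f - f); split; last first.
  by congr (_, _); [rewrite addrCA subrr addr0|rewrite opprB addrA].
exists (2 *: T f - f + (2 *: T' f - f)); split; last by rewrite mid.
by exists (2 *: T f - f), (2 *: T' f - f).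
Qed.

Lemma laplacian_c0 c d x : (0 <= c)%E -> (0 <= d)%E -> (0 <= x)%E ->
  2 * kappa x = kappa c + kappa d ->
  c0_mean (laplacian D e c) (laplacian D e d) = laplacian D e x.
Proof.
move=> c0 d0 x0 hx; have [T [w [lT hT]]] := laplacian_krein.
have [[lc _ _ _] ->] := hT _ c0; have [[ld _ _ _] ->] := hT _ d0.
have [_ ->] := hT _ x0.
rewrite c0_mean_rel_of//; congr rel_of; apply/funext => u.
rewrite addrACA -opprD -scalerDl -mulrDl -(rmorphD (real_complex R)) -hx.
have C2 : 2^-1 * 2 = 1 :> R[i] by rewrite mulVf ?pnatr_eq0.
rewrite scalerBr scale_half scalerA; congr (_ - _ *: _); rewrite mulrA; congr (_ * _).
by rewrite (rmorphM (real_complex R)) (rmorph_nat (real_complex R)) mulrA C2 mul1r.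
Qed.

Lemma laplacian_sr (c : nat -> \bar R) x : (forall n, (0 <= c n)%E) -> (0 <= x)%E ->
  kappa (c n) @[n --> \oo] --> kappa x ->
  sr_lim dot (fun n => laplacian D e (c n)) = laplacian D e x.
Proof.
move=> c0 x0 cx; apply: sr_lim_unique => //; split.
- by move=> n; exact: laplacian_nsa.
- exact: laplacian_nsa.
- have [T [w [lT hT]]] := laplacian_krein.
  have [_ ->] := hT _ x0.
  move=> u; apply/hcvgE; rewrite lr_app_resolvent /cvg_sip.
  rewrite (_ : (fun n => _) = (fun n => (kappa (c n) - kappa x) ^+ 2 *
     ((Re (w u) ^+ 2 + Im (w u) ^+ 2) * sqn dot e))); last first.
    apply/funext => n; have [_ ->] := hT _ (c0 n).
    rewrite lr_app_resolvent opprB addrC addrA subrK.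
    rewrite -scalerBl -mulrBl -(rmorphB (real_complex R)) (sqnZ hb) !ReImE/=.
    by ring.
  rewrite -(mul0r ((Re (w u) ^+ 2 + Im (w u) ^+ 2) * sqn dot e)); apply: cvgMl.
  have -> : 0 = 0 * 0 :> R by rewrite mulr0.
  under eq_fun do rewrite expr2.
  by apply: cvgM; apply/subr_cvg0.
Qed.

End fixed.

Lemma laplacian_harm D e c d : boundary_system D e -> (0 <= c)%E -> (0 <= d)%E ->
  harm_mean dot (laplacian D e c) (laplacian D e d) = laplacian D e (hmean c d).
Proof.
move=> De c0 d0; have De' := boundary_inv De.
have cinv_ge0 x : (0 <= x)%E -> (0 <= cinv x)%E.
  case: x => [r|_|//]; rewrite /cinv// lee_fin => r0.
  by case: eqP => // _; rewrite lee_fin invr_ge0.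
have amean_ge0 x y : (0 <= x)%E -> (0 <= y)%E -> (0 <= amean x y)%E.
  by case: x y => [r||] [s||] //=; rewrite !lee_fin => r0 s0; rewrite divr_ge0// addr_ge0.
rewrite /harm_mean !laplacian_inv//.
rewrite -/(arith_mean dot (laplacian (lr_inv D) (- e) (cinv c))
  (laplacian (lr_inv D) (- e) (cinv d))).
rewrite laplacian_arith// ?laplacian_inv ?opprK//; do ?[exact: cinv_ge0|exact: amean_ge0].
by apply: amean_ge0; exact: cinv_ge0.
Qed.

End boundary_systems.

(** * Integration on the half-line *)

Section real_integrable.
Context d (T : measurableType d) (R : realType).
Variables (m : {measure set T -> \bar R}) (D : set T).
Hypothesis mD : measurable D.

Lemma integrable_RZ (a : R) (f : T -> R) : m.-integrable D (EFin \o f) ->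
  m.-integrable D (EFin \o (fun x => a * f x)).
Proof. by move=> fi; exact: (@integrableZl _ _ _ m _ mD a _ fi). Qed.

Lemma integrable_RD (f g : T -> R) : m.-integrable D (EFin \o f) ->
  m.-integrable D (EFin \o g) -> m.-integrable D (EFin \o (fun x => f x + g x)).
Proof. by move=> fi gi; exact: (@integrableD _ _ _ m _ mD _ _ fi gi). Qed.

Lemma integrable_RB (f g : T -> R) : m.-integrable D (EFin \o f) ->
  m.-integrable D (EFin \o g) -> m.-integrable D (EFin \o (fun x => f x - g x)).
Proof. by move=> fi gi; exact: (@integrableB _ _ _ m _ mD _ _ fi gi). Qed.

Lemma integrable_norm (f : T -> R) : m.-integrable D (EFin \o f) ->
  m.-integrable D (EFin \o (fun x => `|f x|)).
Proof. by move=> fi; exact: (integrable_abse fi). Qed.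

End real_integrable.

Section half_line_integral.
Variable R : realType.
Notation mu := (@lebesgue_measure R).
Notation leb := (@leb R).
Notation Rplus := (@Rplus R).
Implicit Types (f g h k : R -> R) (N x z : R).

Lemma integral_leb (f : R -> \bar R) : measurable_fun setT f ->
  (\int[leb]_x f x = \int[mu]_(x in Rplus) f x)%E.
Proof.
move=> mf; have mR := @measurable_Rplus R.
have -> : (\int[mu]_(x in Rplus) f x = \int[leb]_(x in Rplus) f x)%E.
  by apply: eq_measure_integral => A mA AR; rewrite -[RHS]/(mu (A `&` Rplus)) setIidl.
rewrite [RHS]integral_mkcond; apply: ae_eq_integral => //.
  by apply/(measurable_restrictT _ mR); exact: measurable_funTS.
exists (~` Rplus); split; first exact: measurableC.
  by rewrite -[LHS]/(mu (~` Rplus `&` Rplus)) setICl measure0.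
move=> x /= hx Rx; apply: hx => _; rewrite patchE.
by rewrite mem_set.
Qed.

Lemma integrable_leb (f : R -> \bar R) : leb.-integrable setT f -> mu.-integrable Rplus f.
Proof.
move=> /integrableP[mf ioo]; apply/integrableP; split; first exact: measurable_funTS.
by rewrite -integral_leb//; exact: measurableT_comp.
Qed.

Lemma Rintegral_leb f : leb.-integrable setT (EFin \o f) ->
  \int[leb]_x f x = \int[mu]_(x in Rplus) f x.
Proof.
by move=> fi; rewrite /Rintegral integral_leb//; exact: measurable_int fi.
Qed.

(** For negative x the interval is empty and the value is 0. *)
Definition prim g x : R := \int[mu]_(t in `[0, x]) g t.

Definition loc_integrable g : Prop :=
  measurable_fun setT g /\ forall N, mu.-integrable `[0, N] (EFin \o g).

Lemma integral_prim g N x : mu.-integrable `[0, N] (EFin \o g) -> x <= N ->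
  (\int[mu]_(t in `[0%R, x]) (g t)%:E)%E = (prim g x)%:E.
Proof.
move=> gi xN; rewrite /prim /Rintegral fineK//; apply: integrable_fin_num => //.
by apply: integrableS gi => //; apply: subset_itvl; rewrite bnd_simp.
Qed.

Lemma prim_split g N x : mu.-integrable `[0, N] (EFin \o g) -> 0 <= x <= N ->
  (\int[mu]_(t in `[x, N]) (g t)%:E)%E = (prim g N - prim g x)%:E.
Proof.
move=> gi /andP[x0 xN].
have gx : mu.-integrable `[x, N] (EFin \o g).
  by apply: integrableS gi => //; apply: subset_itvr; rewrite bnd_simp.
have e : `[0, N]%classic = `[0, x] `|` `]x, N] :> set R.
  by rewrite -itv_bndbnd_setU ?bnd_simp.
rewrite -integral_itv_obnd_cbnd; last first.
  apply: measurable_int (_ : mu.-integrable _ _).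
  by apply: integrableS gx => //; apply: subset_itvr; rewrite bnd_simp.
rewrite EFinB -(integral_prim gi (lexx N)) -(integral_prim gi xN) e.
rewrite integral_setU_EFin//=.
- rewrite [X in (X - _)%E]addeC addeK//; apply: integrable_fin_num => //.
  by apply: integrableS gi => //; rewrite e; exact: subsetUl.
- by apply/measurable_EFinP; rewrite -e; exact: measurable_int gi.
- rewrite disj_set2E; apply/eqP/seteqP; split => // y /=.
  by rewrite !in_itv/= => -[/andP[_ h1] /andP[h2 _]]; move: (lt_le_trans h2 h1); rewrite ltxx.
Qed.

Lemma prim_continuous g N : 0 <= N -> mu.-integrable `[0, N] (EFin \o g) ->
  {within `[0, N], continuous (prim g)}.
Proof. by move=> N0 gi; exact: parameterized_integral_continuous. Qed.

Lemma integrable_prim_mul g k N : 0 <= N -> mu.-integrable `[0, N] (EFin \o g) ->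
  mu.-integrable `[0, N] (EFin \o k) ->
  mu.-integrable `[0, N] (EFin \o (fun x => g x * prim k x)).
Proof.
move=> N0 gi ki; have c := prim_continuous N0 ki.
have [M hM] : exists M, forall x, `[0, N]%classic x -> `|prim k x| <= M.
  have /compact_bounded[M [_ hM]] := continuous_compact c (@segment_compact R 0 N).
  exists (M + 1) => x xN; apply: (hM (M + 1)); first by rewrite ltrDl.
  by exists x.
have mp : measurable_fun `[0, N] (prim k).
  by apply: subspace_continuous_measurable_fun => //; exact: measurable_itv.
have mg : measurable_fun `[0, N] g by apply/measurable_EFinP; exact: measurable_int gi.
apply: (@le_integrable _ _ _ mu _ _ _ (fun x => (`|M|%:E * `|(g x)%:E|)%E)) => //.
- by apply/measurable_EFinP; apply: measurable_funM.
- move=> x xN /=; rewrite lee_fin !normrM !normr_id mulrC ler_wpM2r//.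
  by apply: le_trans (hM _ xN) _; exact: ler_norm.
- by apply: integrableZl => //; exact: integrable_abse.
Qed.

(** Fubini for g(x) k(y) on the triangle 0 <= y <= x <= N: integrating first in y gives g times
    [prim k], and first in x gives k times [prim g N - prim g]. *)
Lemma integration_by_parts_prim g k N : 0 <= N ->
  mu.-integrable `[0, N] (EFin \o g) -> mu.-integrable `[0, N] (EFin \o k) ->
  \int[mu]_(x in `[0, N]) (g x * prim k x) + \int[mu]_(x in `[0, N]) (k x * prim g x)
    = prim g N * prim k N.
Proof.
move=> N0 gi ki; pose gN := g \_ `[0, N]; pose kN := k \_ `[0, N].
have rE f : EFin \o (f \_ `[0, N]) = (EFin \o f) \_ `[0, N].
  by rewrite restrict_EFin.
have giT : mu.-integrable setT (EFin \o gN).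
  by rewrite /gN /kN rE; apply/(integrable_mkcond (EFin \o _)).
have kiT : mu.-integrable setT (EFin \o kN).
  by rewrite /gN /kN rE; apply/(integrable_mkcond (EFin \o _)).
have mg : measurable_fun setT gN by apply/measurable_EFinP; exact: measurable_int giT.
have mk : measurable_fun setT kN by apply/measurable_EFinP; exact: measurable_int kiT.
pose F (z : R * R) : \bar R := (gN z.1 * (if z.2 <= z.1 then kN z.2 else 0))%:E.
have mF : measurable_fun setT F.
  apply/measurable_EFinP; apply: measurable_funM.
    by apply: measurableT_comp => //; exact: measurable_fst.
  apply: measurable_fun_ifT.
  - by apply: measurable_fun_ler; [exact: measurable_snd|exact: measurable_fst].
  - by apply: measurableT_comp => //; exact: measurable_snd.
  - exact: measurable_cst.
have iF : (mu \x mu)%E.-integrable setT F.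
  apply: (@le_integrable _ _ _ (mu \x mu)%E _ _ _
    (fun z : R * R => (gN z.1 * kN z.2)%:E)) => //.
    move=> z _; rewrite /F/= lee_fin !normrM ler_wpM2l//.
    by case: ifP => //; rewrite normr0.
  apply/integrable12ltyP.
    by apply/measurable_EFinP; apply: measurable_funM; exact: measurableT_comp.
  have ki' : (\int[mu]_y `|(kN y)%:E| < +oo)%E by case/integrableP: kiT.
  have ki0 : (0 <= \int[mu]_y `|(kN y)%:E|)%E by exact: integral_ge0.
  have E1 x : (\int[mu]_y `|(gN x * kN y)%:E| = `|(gN x)%:E| * \int[mu]_y `|(kN y)%:E|)%E.
    rewrite -ge0_integralZl//; last first.
      by apply: measurableT_comp => //; exact/measurable_EFinP.
    by apply: eq_integral => y _; rewrite EFinM abseM.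
  under eq_integral do rewrite E1.
  rewrite ge0_integralZr//; last first.
    by apply: measurableT_comp => //; exact/measurable_EFinP.
  have gi' : (\int[mu]_x `|(gN x)%:E| < +oo)%E by case/integrableP: giT.
  rewrite lte_mul_pinfty//; first exact: integral_ge0.
  by rewrite ge0_fin_numE//; exact: integral_ge0.
have := Fubini iF.
have -> : (\int[mu]_x \int[mu]_y F (x, y) = (\int[mu]_(x in `[0, N]) (g x * prim k x))%:E)%E.
  rewrite /Rintegral fineK; last first.
    by apply: integrable_fin_num => //; exact: integrable_prim_mul.
  rewrite [RHS]integral_mkcond; apply: eq_integral => x _.
  rewrite patchE; case: ifPn => [|xN]; last first.
    rewrite integral0_eq// => y _; rewrite /F /= /gN patchE.
    by rewrite (negbTE xN) mul0r.
  move=> xN; have := xN; rewrite inE /= in_itv/= => /andP[x0 xN'].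
  rewrite EFinM -(integral_prim ki xN') -integralZl//; last first.
    by apply: integrableS ki => //; apply: subset_itvl; rewrite bnd_simp.
  rewrite [in RHS]integral_mkcond.
  apply: eq_integral => y _; rewrite /F /gN /kN !patchE xN !mem_setE !in_itv/=.
  have [yx|xy] := leP y x; last by rewrite andbF mulr0.
  by rewrite andbT (le_trans yx xN') andbT; case: ifP => // _; rewrite mulr0.
have -> : (\int[mu]_y \int[mu]_x F (x, y) =
    (\int[mu]_(y in `[0, N]) (k y * (prim g N - prim g y)))%:E)%E.
  have ig : mu.-integrable `[0, N] (EFin \o (fun y => k y * (prim g N - prim g y))).
    rewrite (_ : EFin \o _ = (fun y => (prim g N)%:E * (k y)%:E - (k y * prim g y)%:E)%E); last first.
      by apply/funext => y /=; rewrite -EFinM -EFinB mulrBr [k y * prim g N]mulrC.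
    by apply: integrableB => //; [exact: integrableZl|exact: integrable_prim_mul].
  rewrite /Rintegral fineK; last exact: integrable_fin_num.
  rewrite [RHS]integral_mkcond; apply: eq_integral => y _.
  rewrite patchE; case: ifPn => [|yN]; last first.
    rewrite integral0_eq// => x _; rewrite /F /= /kN patchE.
    by rewrite (negbTE yN) if_same mulr0.
  move=> yN; have := yN; rewrite inE /= in_itv/= => yN'; have /andP[y0 yN''] := yN'.
  rewrite /= EFinM -(prim_split gi yN') -integralZl//; last first.
    by apply: integrableS gi => //; apply: subset_itvr; rewrite bnd_simp.
  rewrite [in RHS]integral_mkcond.
  apply: eq_integral => x _; rewrite /F /kN /gN !patchE yN !mem_setE !in_itv/= mulrC.
  have [yx|xy] := leP y x; last by rewrite mul0r.
  by rewrite (le_trans y0 yx)/=; case: ifP => // _; rewrite mulr0.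
move=> [->]; rewrite -RintegralD//.
- rewrite mulrC /(prim k N) -RintegralZr//; apply: eq_Rintegral => x _ /=; ring.
- rewrite (_ : EFin \o _ = (fun y => (prim g N)%:E * (k y)%:E - (k y * prim g y)%:E)%E); last first.
    by apply/funext => y /=; rewrite -EFinM -EFinB mulrBr [k y * prim g N]mulrC.
  by apply: integrableB => //; [exact: integrableZl|exact: integrable_prim_mul].
- exact: integrable_prim_mul.
Qed.

Lemma dominated_factor (D : set R) (Q : R -> R) (c_ : nat -> R -> R) (c : R -> R) :
  measurable (D : set (measurableTypeR R)) -> mu.-integrable D (EFin \o Q) ->
  (forall n, measurable_fun D (c_ n)) -> measurable_fun D c ->
  (forall n x, D x -> `|c_ n x| <= 1) ->
  (forall x, D x -> c_ n x @[n --> \oo] --> c x) ->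
  \int[mu]_(x in D) (c_ n x * Q x) @[n --> \oo] --> \int[mu]_(x in D) (c x * Q x).
Proof.
move=> mD Qi mc_ mc c1 cc.
have mQ : measurable_fun D Q by apply/measurable_EFinP; exact: measurable_int Qi.
have [||||| _ _] := @dominated_convergence _ _ _ mu D mD
  (fun n x => (c_ n x * Q x)%:E) (fun x => (c x * Q x)%:E) (fun x => `|(Q x)%:E|%E).
- by move=> n; apply/measurable_EFinP; apply: measurable_funM => //; exact: mc_.
- by apply/measurable_EFinP; exact: measurable_funM.
- by apply: aeW => x Dx; apply: cvg_EFin; [near=> n|apply: cvgMl; exact: cc].
- exact: integrable_abse.
- apply: aeW => x n Dx; rewrite EFinM abseM /= lee_fin -[leRHS]mul1r.
  by rewrite ler_wpM2r// c1.
have ci : mu.-integrable D (fun x => (c x * Q x)%:E).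
  apply: (@le_integrable _ _ _ mu _ _ _ (EFin \o Q)) => //.
    by apply/measurable_EFinP; exact: measurable_funM.
  move=> x Dx; rewrite /= lee_fin normrM -[leRHS]mul1r ler_wpM2r//.
  by apply: cvgr_to_le (cvg_norm (cc x Dx)) _; near=> n; exact: c1.
rewrite -(fineK (integrable_fin_num mD ci)) => /fine_cvg.
exact.
Unshelve. all: by end_near.
Qed.

(** On bounded intervals the bound |g| <= 1 + g^2 suffices. *)
Lemma Lfun2_loc_integrable g : g \in Lfun leb 2%:E -> loc_integrable g.
Proof.
move=> gL; have /integrable_leb g2 := Lfun2_integrable_sqr gL.
have mg : measurable_fun setT g by move: gL; rewrite inE => /andP[/[!inE]/= mg _].
split => // N; have N_sub : `[0, N]%classic `<=` Rplus.
  by apply: subset_itvl; rewrite bnd_simp.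
apply: (@le_integrable _ _ _ mu _ _ _ (fun x => ((cst 1 x)%:E + (g x ^+ 2)%:E)%E)) => //.
- by apply/measurable_EFinP; exact: measurable_funTS.
- move=> x _ /=; rewrite lee_fin [leRHS]ger0_norm ?addr_ge0 ?sqr_ge0//.
  rewrite -(real_normK (num_real (g x))); move: `|g x| => y.
  have := sqr_ge0 (y - 1); have := sqr_ge0 y; rewrite !expr2; lra.
- apply: integrableD => //; last first.
    by apply: integrableS g2 => //; exact: measurable_Rplus.
  apply: (continuous_compact_integrable (f := cst 1)); first exact: segment_compact.
  by apply: continuous_subspaceT => x; exact: cvg_cst.
Qed.

Lemma ae_leb (P : R -> Prop) : {ae leb, forall x, P x} ->
  {ae mu, forall x, Rplus x -> P x}.
Proof.
case=> A [mA A0 PA]; exists (A `&` Rplus); split.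
- by apply: measurableI => //; exact: measurable_Rplus.
- exact: A0.
- by move=> x /= /not_implyP[Rx nP]; split => //; exact: PA.
Qed.

Lemma ae_eq_Rintegral (D : set R) (Q Q' : R -> R) :
  measurable (D : set (measurableTypeR R)) -> D `<=` Rplus ->
  measurable_fun D Q -> measurable_fun D Q' ->
  {ae leb, forall x, Q x = Q' x} ->
  \int[mu]_(x in D) Q x = \int[mu]_(x in D) Q' x.
Proof.
move=> mD DR mQ mQ' /ae_leb QQ; rewrite /Rintegral; congr fine.
apply: ae_eq_integral => //; try exact/measurable_EFinP.
have FF : Filter (nbhs (almost_everywhere mu)) by exact: ae_filter_ringOfSetsType.
by apply: filterS QQ => x h /DR/h ->.
Qed.

Lemma Rintegral_indic (A D : set R) (Q : R -> R) : A `<=` D ->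
  \int[mu]_(x in D) (\1_A x * Q x) = \int[mu]_(x in A) Q x.
Proof.
move=> AD; rewrite /Rintegral; congr fine.
rewrite -(setIidr AD) integral_mkcondr; apply: eq_integral => x _.
by rewrite patchE indicE setIidr//; case: ifP; rewrite ?mul1r ?mul0r.
Qed.

Lemma cvg_Rintegral_itv0n (Q : R -> R) : mu.-integrable Rplus (EFin \o Q) ->
  \int[mu]_(x in `[0, n%:R]) Q x @[n --> \oo] --> \int[mu]_(x in Rplus) Q x.
Proof.
move=> Qi.
have := @dominated_factor Rplus Q (fun n => \1_(`[0, n%:R]%classic)) (cst 1) _ Qi.
rewrite (_ : (fun n => _) = (fun n : nat => \int[mu]_(x in `[0, n%:R]) Q x)); last first.
  apply/funext => n; apply: Rintegral_indic.
  by apply: subset_itvl; rewrite bnd_simp.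
rewrite (_ : \int[mu]_(x in Rplus) (cst 1 x * Q x) = \int[mu]_(x in Rplus) Q x); last first.
  by apply: eq_Rintegral => x _; rewrite mul1r.
apply => //.
- exact: measurable_Rplus.
- by move=> n x _; rewrite indicE; case: (_ \in _); rewrite ?normr1 ?normr0.
- move=> x; rewrite /Rplus/= in_itv/= andbT => x0; apply: cvg_near_cst.
  near=> n; rewrite indicE mem_set//= in_itv/= x0/=.
  by near: n; exact: nbhs_infty_ger.
Unshelve. all: by end_near.
Qed.

Lemma cvg_Rintegral_itvnS (Q : R -> R) : mu.-integrable Rplus (EFin \o Q) ->
  \int[mu]_(x in `[n%:R, n.+1%:R]) Q x @[n --> \oo] --> (0 : R).
Proof.
move=> Qi.
have := @dominated_factor Rplus Q (fun n => \1_(`[n%:R, n.+1%:R]%classic)) (cst 0) _ Qi.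
rewrite (_ : (fun n => _) = (fun n : nat => \int[mu]_(x in `[n%:R, n.+1%:R]) Q x)); last first.
  apply/funext => n; apply: Rintegral_indic.
  move=> x /=; rewrite in_itv/= => /andP[h _]; rewrite /Defs.Rplus/= in_itv/= andbT.
  exact: le_trans (ler0n _ _) h.
rewrite (_ : \int[mu]_(x in Rplus) (cst 0 x * Q x) = 0); last first.
  by rewrite /Rintegral integral0_eq// => x _; rewrite mul0r.
apply => //.
- exact: measurable_Rplus.
- by move=> n x _; rewrite indicE; case: (_ \in _); rewrite ?normr1 ?normr0.
- move=> x; rewrite /Rplus/= in_itv/= andbT => x0; apply: cvg_near_cst.
  near=> n; rewrite indicE memNset//= in_itv/= => /andP[nx _].
  move: nx; apply/negP; rewrite -ltNge.
  by near: n; exact: nbhs_infty_gtr.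
Unshelve. all: by end_near.
Qed.

Lemma Lfun2_mul_integrable f g : f \in Lfun leb 2%:E -> g \in Lfun leb 2%:E ->
  leb.-integrable setT (EFin \o (fun x => f x * g x)).
Proof. by move=> fL gL; apply/Lfun1_integrable; exact: Lfun2_mul_Lfun1. Qed.

Lemma Lfun2_measurable f : f \in Lfun leb 2%:E -> measurable_fun setT f.
Proof. by rewrite inE => /andP[/[!inE]]. Qed.

Lemma integral_prim_form f g h k z w N : 0 <= N ->
  f \in Lfun leb 2%:E -> g \in Lfun leb 2%:E ->
  h \in Lfun leb 2%:E -> k \in Lfun leb 2%:E ->
  {ae leb, forall x, f x = z + prim g x} ->
  {ae leb, forall x, h x = w + prim k x} ->
  \int[mu]_(x in `[0, N]) (g x * h x + k x * f x) =
    (z + prim g N) * (w + prim k N) - z * w.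
Proof.
move=> N0 fL gL hL kL fz hw.
have [_ gi] := Lfun2_loc_integrable gL; have [_ ki] := Lfun2_loc_integrable kL.
have FF : Filter (nbhs (almost_everywhere leb)) by exact: ae_filter_ringOfSetsType.
have mp l : mu.-integrable `[0, N] (EFin \o l) -> measurable_fun `[0, N] (prim l).
  move=> li; apply: subspace_continuous_measurable_fun; first exact: measurable_itv.
  exact: prim_continuous.
have mf := measurable_funTS (D := `[0, N]) (Lfun2_measurable fL).
have mg := measurable_funTS (D := `[0, N]) (Lfun2_measurable gL).
have mh := measurable_funTS (D := `[0, N]) (Lfun2_measurable hL).
have mk := measurable_funTS (D := `[0, N]) (Lfun2_measurable kL).
rewrite (@ae_eq_Rintegral _ _ (fun x => (w * g x + z * k x) +
    (g x * prim k x + k x * prim g x))) //; first last.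
- apply: filterS2 fz hw => x -> ->; ring.
- by apply: measurable_funD; apply: measurable_funD; apply: measurable_funM => //; exact: mp.
- by apply: measurable_funD; apply: measurable_funM.
- by apply: subset_itvl; rewrite bnd_simp.
have i1 := integrable_prim_mul N0 (gi N) (ki N).
have i2 := integrable_prim_mul N0 (ki N) (gi N).
have i3 : mu.-integrable `[0, N] (EFin \o (fun x => w * g x)) by exact: integrable_RZ.
have i4 : mu.-integrable `[0, N] (EFin \o (fun x => z * k x)) by exact: integrable_RZ.
have i5 : mu.-integrable `[0, N] (EFin \o (fun x => w * g x + z * k x)) by exact: integrable_RD.
have i6 : mu.-integrable `[0, N] (EFin \o (fun x => g x * prim k x + k x * prim g x)).
  exact: integrable_RD.
rewrite RintegralD// RintegralD// RintegralD// integration_by_parts_prim//.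
rewrite !RintegralZl// -!/(prim _ N); ring.
Qed.

(** The obstacle is the boundary term at infinity, [Phi] being the product of the two continuous
    representatives. For x in [n, n+1], |Phi n| is at most |Phi x| plus the integral of |P| over
    that interval. Averaging in x bounds |Phi n| by the integrals of |f h| and |P| over [n, n+1],
    which tend to 0 because both functions are integrable. *)
Lemma green_half_line f g h k z w :
  f \in Lfun leb 2%:E -> g \in Lfun leb 2%:E ->
  h \in Lfun leb 2%:E -> k \in Lfun leb 2%:E ->
  {ae leb, forall x, f x = z + prim g x} ->
  {ae leb, forall x, h x = w + prim k x} ->
  \int[leb]_x (g x * h x) + \int[leb]_x (f x * k x) = - (z * w).
Proof.
move=> fL gL hL kL fz hw.
have FF : Filter (nbhs (almost_everywhere leb)) by exact: ae_filter_ringOfSetsType.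
pose P x := g x * h x + k x * f x.
pose Phi N := (z + prim g N) * (w + prim k N).
have Pl : leb.-integrable setT (EFin \o P).
  by apply: integrable_RD => //; exact: Lfun2_mul_integrable.
have Pi := integrable_leb Pl.
have fhi := integrable_leb (Lfun2_mul_integrable fL hL).
have PhiE N : 0 <= N -> \int[mu]_(x in `[0, N]) P x = Phi N - z * w.
  by move=> N0; exact: integral_prim_form.
have c1 := cvg_Rintegral_itv0n Pi.
have aP := integrable_abse Pi; have afh := integrable_abse fhi.
have c2 := cvg_Rintegral_itvnS (Q := fun x => `|P x|) aP.
have c3 := cvg_Rintegral_itvnS (Q := fun x => `|f x * h x|) afh.
have Phi0 : Phi n%:R @[n --> \oo] --> (0 : R).
  apply/norm_cvg0P; apply: (@squeeze_cvgr _ _ _ _ (fun=> 0) (fun n =>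
    \int[mu]_(x in `[n%:R, n.+1%:R]) `|f x * h x| + \int[mu]_(x in `[n%:R, n.+1%:R]) `|P x|)).
  - near=> n; rewrite normr_ge0/=.
    pose A : set R := `[n%:R, n.+1%:R]%classic.
    have mA : measurable (A : set (measurableTypeR R)) by exact: measurable_itv.
    have AR : A `<=` Rplus.
      move=> x /=; rewrite /A/= in_itv/= => /andP[nx _].
      by rewrite /Defs.Rplus/= in_itv/= andbT (le_trans (ler0n _ _) nx).
    have mR := @measurable_Rplus R.
    have iA (Q : R -> R) : mu.-integrable Rplus (EFin \o Q) -> mu.-integrable A (EFin \o Q).
      exact: integrableS.
    have A1 (r : R) : \int[mu]_(x in A) r = r.
      have muA : mu A = 1%E.
        rewrite /A lebesgue_measure_itv/= lte_fin ltr_nat ltnSn.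
        by rewrite -EFinB -natrB// subSnn.
      by rewrite Rintegral_cst// [X in fine X]muA mulr1.
    have icst (r : R) : mu.-integrable A (EFin \o cst r).
      apply: (continuous_compact_integrable (f := cst r)); first exact: segment_compact.
      by apply: continuous_subspaceT => x; exact: cvg_cst.
    have A0 : A `<=` `[0, n.+1%:R]%classic by apply: subset_itvr; rewrite bnd_simp.
    have mp (l : R -> R) : (forall N, mu.-integrable `[0, N] (EFin \o l)) -> measurable_fun A (prim l).
      move=> li; have hl : measurable_fun (`[0, n.+1%:R]%classic : set R) (prim l).
        apply: subspace_continuous_measurable_fun; first exact: measurable_itv.
        exact: prim_continuous.
      by apply: measurable_funS hl => //; exact: measurable_itv.
    have [_ gi] := Lfun2_loc_integrable gL; have [_ ki] := Lfun2_loc_integrable kL.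
    have h1 x : A x -> `|Phi n%:R| <= `|Phi x| + \int[mu]_(x in A) `|P x|.
      move=> Ax; have := Ax; rewrite /A/= in_itv/= => /andP[nx xn].
      have x0 : 0 <= x := le_trans (ler0n _ n) nx.
      have Px : mu.-integrable `[0, x] (EFin \o P).
        by apply: integrableS Pi => //; apply: subset_itvl; rewrite bnd_simp.
      have := @prim_split P x n%:R Px; rewrite ler0n nx => /(_ isT).
      rewrite /prim !PhiE// opprB addrA subrK => e.
      have -> : Phi n%:R = Phi x - \int[mu]_(t in `[n%:R, x]) P t.
        rewrite [X in _ - X](_ : _ = Phi x - Phi n%:R); last by rewrite /Rintegral e.
        by rewrite opprB addrCA subrr addr0.
      apply: le_trans (ler_normB _ _) _; rewrite lerD2l.
      have nxA : `[n%:R, x]%classic `<=` A by apply: subset_itvl; rewrite bnd_simp.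
      have iP : mu.-integrable `[n%:R, x] (EFin \o P).
        by apply: integrableS Pi => //; exact: subset_trans AR.
      apply: le_trans (le_normr_Rintegral _ iP) _ => //.
      rewrite -(Rintegral_indic (A := `[n%:R, x]%classic) _ nxA).
      have iP' : mu.-integrable A (EFin \o (fun x => `|P x|)) by exact: iA.
      apply: le_Rintegral => //.
        apply: (@le_integrable _ _ _ mu _ _ _ (EFin \o (fun x => `|P x|))) => //.
          apply/measurable_EFinP; apply: measurable_funM.
            by apply: measurable_funTS; exact: measurable_indic.
          by apply/measurable_EFinP; exact: measurable_int iP'.
        move=> y _ /=; rewrite lee_fin normrM indicE normr_id.
        by case: (_ \in _); rewrite ?normr1 ?normr0 ?mul1r ?mul0r.
      by move=> y _; rewrite indicE; case: (_ \in _); rewrite ?mul1r ?mul0r.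
    have FHE : \int[mu]_(x in A) `|f x * h x| = \int[mu]_(x in A) `|Phi x|.
      apply: ae_eq_Rintegral => //.
      - apply: measurableT_comp => //.
        by apply: measurable_funM; apply: measurable_funTS; exact: Lfun2_measurable.
      - apply: measurableT_comp => //.
        by apply: measurable_funM; apply: measurable_funD => //; exact: mp.
      - by apply: filterS2 fz hw => x -> ->.
    have iPhi : mu.-integrable A (EFin \o (fun x => `|Phi x|)).
      have ip : mu.-integrable A (EFin \o (fun x => z * w + prim P x)).
        apply: integrable_RD => //; first exact: (icst (z * w)).
        apply: (continuous_compact_integrable (f := prim P)); first exact: segment_compact.
        apply: continuous_subspaceW (prim_continuous (ler0n _ n.+1) _) => //.
        by apply: integrableS Pi => //; apply: subset_itvl; rewrite bnd_simp.
      have := integrable_norm ip; apply: eq_integrable => //.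
      move=> x; rewrite inE /A/= in_itv/= => /andP[nx _].
      have x0 : 0 <= x := le_trans (ler0n _ n) nx.
      by rewrite /= /prim PhiE// addrC subrK.
    rewrite -(A1 `|Phi n%:R|) FHE -(A1 (\int[mu]_(x in A) `|P x|)) -RintegralD//.
      apply: le_Rintegral => //; first exact: (icst `|Phi n%:R|).
      by apply: integrable_RD => //; exact: icst.
    exact: icst.
  - exact: cvg_cst.
  - by rewrite -[X in _ --> X]addr0; exact: cvgD.
have -> : \int[leb]_x (g x * h x) + \int[leb]_x (f x * k x) = \int[mu]_(x in Rplus) P x.
  rewrite -RintegralD//; try exact: Lfun2_mul_integrable.
  rewrite -Rintegral_leb//; apply: eq_Rintegral => x _; rewrite /P; ring.
apply: (cvg_unique _ c1) => //.
rewrite (_ : (fun n => _) = (fun n => Phi n%:R - z * w)); last first.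
  by apply/funext => n; rewrite -PhiE.
by rewrite -[X in _ X]sub0r; exact: (cvgB Phi0 (cvg_cst _)).
Unshelve. all: by end_near.
Qed.

End half_line_integral.

(** * Test functions *)

Section bump_functions.
Variable R : realType.
Notation mu := (@lebesgue_measure R).
Notation leb := (@leb R).
Notation Rplus := (@Rplus R).
Implicit Types (x y a b s : R) (f g : R -> R) (k n : nat).

(** The flat function exp(-1/y) divided by y^k. The powers close the family under differentiation:
    theta_k' = theta_(k+2) - k theta_(k+1). *)
Definition theta k y : R := if 0 < y then y^-1 ^+ k * expR (- y^-1) else 0.

Lemma theta_ge0 k y : 0 <= theta k y.
Proof.
by rewrite /theta; case: ltP => // y0; rewrite mulr_ge0 ?expR_ge0// exprn_ge0// invr_ge0 ltW.
Qed.

(** From the term of order k + 2 of the exponential series at 1/y. A quadratic bound is what gives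
    derivative 0 at the origin. *)
Lemma theta_le_sqr k y : theta k y <= (k.+2)`!%:R * y ^+ 2.
Proof.
rewrite /theta; case: ltP => y0; last by rewrite mulr_ge0// sqr_ge0.
have yi : 0 <= y^-1 by rewrite invr_ge0 ltW.
have h : y^-1 ^+ k.+2 / (k.+2)`!%:R <= expR y^-1.
  by have := expR_ge1Dxn k.+1 yi; apply: le_trans; rewrite lerDr.
rewrite ler_pdivrMr ?ltr0n ?fact_gt0// in h.
rewrite expRN ler_pdivrMr ?expR_gt0//.
have -> : y^-1 ^+ k = y ^+ 2 * y^-1 ^+ k.+2.
  by rewrite -[k.+2]addn2 exprD mulrCA -exprMn mulfV ?gt_eqF// expr1n mulr1.
apply: le_trans (ler_wpM2l (sqr_ge0 y) h) _.
by rewrite le_eqVlt; apply/orP; left; apply/eqP; ring.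
Qed.

Lemma is_derive_flat f (C : R) : (forall h, `|f h| <= C * h ^+ 2) -> is_derive (0 : R) 1 f 0.
Proof.
move=> hf.
have f0 : f 0 = 0.
  by apply/eqP; rewrite -normr_le0; have := hf 0; rewrite expr0n mulr0.
have c : h^-1 *: ((f \o shift 0) (h *: (1 : R)) - f 0) @[h --> 0^'] --> (0 : R).
  apply/norm_cvg0P.
  apply: (@squeeze_cvgr _ _ _ _ (fun=> 0) (fun h => C * `|h|)).
  - near=> h; rewrite normr_ge0/= f0 subr0 addr0 normrM normfV.
    have h0 : 0 < `|h| by rewrite normr_gt0; near: h; exact: nbhs_dnbhs_neq.
    rewrite ler_pdivrMl// mulrCA -expr2 real_normK ?num_real//.
    by have := hf (h *: (1 : R)); rewrite [h *: _]mulr1.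
  - exact: cvg_cst.
  - have c0 : C * `|h| @[h --> (0 : R)^'] --> C * `|0 : R|.
      by apply: cvgMr; apply: cvg_within_filter; apply: cvg_norm; exact: cvg_id.
    by rewrite normr0 mulr0 in c0.
by split; [apply/cvg_ex; exists 0|exact/cvg_lim].
Unshelve. all: by end_near.
Qed.

Lemma is_derive_theta k y :
  is_derive y 1 (theta k) (theta k.+2 y - k%:R * theta k.+1 y).
Proof.
have [y0|y0|y0] := ltgtP y 0.
- rewrite /theta !ltNge (ltW y0)/= mulr0 subr0.
  have d0 : is_derive y 1 (cst (0 : R)) 0 by exact: is_derive_cst.
  apply: near_eq_is_derive d0; near=> x; rewrite ltNge (_ : x <= 0)//.
  by apply: ltW; near: x; exact: lt_nbhsl.
- apply: (@near_eq_is_derive _ _ _ (fun x => x^-1 ^+ k * expR (- x^-1))).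
    near=> x; rewrite /theta ifT//.
    by near: x; exact: lt_nbhsr.
  have yN : y != 0 by rewrite gt_eqF.
  have dV : is_derive y 1 (fun x => x^-1) (- y ^- 2 *: 1).
    exact: (@is_deriveV _ id y 1 1 yN).
  have dN : is_derive y 1 (fun x => - x^-1) (- (- y ^- 2 *: 1)) by exact: is_deriveN.
  have dE := @is_derive1_comp _ expR (fun x => - x^-1) y _ _ (is_derive_expR _) dN.
  have dX : is_derive y 1 (fun x => x^-1 ^+ k) (- k%:R * y^-1 ^+ k.+1).
    case: k => [|k].
      by rewrite expr1 oppr0 mul0r (_ : (fun x => _) = cst 1)//; exact: is_derive_cst.
    have := @is_deriveX _ _ (fun x : R => x^-1) k.+1 y 1 _ dV.
    rewrite (_ : (fun x => x^-1) ^+ k.+1 = (fun x => x^-1 ^+ k.+1)); last first.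
      by apply/funext => x; rewrite exprfctE.
    move=> dX; apply: (is_derive_eq dX).
    rewrite -!exprVn /GRing.scale/= !exprS; ring.
  apply: (is_derive_eq (is_deriveM dX dE)).
  rewrite /theta y0 /= -!exprVn /GRing.scale/= !exprS; ring.
- rewrite y0; rewrite {2 3}/theta ltxx mulr0 subr0.
  apply: (@is_derive_flat _ (k.+2)`!%:R) => h.
  by rewrite ger0_norm ?theta_ge0// theta_le_sqr.
Unshelve. all: by end_near.
Qed.

(* Contains the bump functions below and is stable by differentiation. *)
Inductive theta_alg : (R -> R) -> Prop :=
| theta_alg1 k s a : theta_alg (fun x => theta k (s * (x - a)))
| theta_algD f g : theta_alg f -> theta_alg g -> theta_alg (fun x => f x + g x)
| theta_algZ s f : theta_alg f -> theta_alg (fun x => s * f x)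
| theta_algM f g : theta_alg f -> theta_alg g -> theta_alg (fun x => f x * g x).

Lemma theta_alg_derive f : theta_alg f ->
  exists2 g, theta_alg g & forall x, is_derive x 1 f (g x).
Proof.
elim=> [k s a|{}f g _ [f' Af' df] _ [g' Ag' dg]|s {}f _ [f' Af' df]|
    {}f g Af [f' Af' df] Ag [g' Ag' dg]].
- exists (fun x => s * (theta k.+2 (s * (x - a)) + (- k%:R) * theta k.+1 (s * (x - a)))).
    apply: (@theta_algZ s (fun x => theta k.+2 (s * (x - a)) + (- k%:R) * theta k.+1 (s * (x - a)))).
    apply: (@theta_algD (fun x => theta k.+2 (s * (x - a)))
      (fun x => (- k%:R) * theta k.+1 (s * (x - a)))).
      exact: theta_alg1.
    by apply: (@theta_algZ _ (fun x => theta k.+1 (s * (x - a)))); exact: theta_alg1.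
  move=> x.
  have d1 : is_derive x 1 (fun x => s * (x - a)) s.
    have dB : is_derive x 1 (fun x => x - a) (1 - 0).
      by apply: (@is_deriveB _ _ _ id (cst a)).
    by apply: (is_derive_eq (@is_deriveZ _ _ _ _ s _ _ _ dB)); rewrite subr0 [LHS]mulr1.
  apply: (is_derive_eq (@is_derive1_comp _ _ (fun x => s * (x - a)) x _ _ (is_derive_theta k _) d1)).
  rewrite /=; ring.
- exists (fun x => f' x + g' x); first exact: theta_algD.
  by move=> x; exact: is_deriveD.
- exists (fun x => s * f' x); first exact: theta_algZ.
  by move=> x; exact: is_deriveZ.
- exists (fun x => f x * g' x + g x * f' x).
    by apply: (@theta_algD (fun x => f x * g' x) (fun x => g x * f' x)); exact: theta_algM.
  by move=> x; exact: is_deriveM.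
Qed.

Lemma theta_alg_smooth f n : theta_alg f ->
  theta_alg (derive1n n f) /\ forall x, derivable (derive1n n f) x 1.
Proof.
move=> Af; have {Af}An : theta_alg (derive1n n f).
  elim: n => // n ih; rewrite derive1nS.
  have [g Ag dg] := theta_alg_derive ih.
  rewrite (_ : derive1 (derive1n n f) = g)//; apply/funext => x.
  by rewrite derive1E; apply: derive_val.
split => // x; have [g _ dg] := theta_alg_derive An.
by have := dg x => -[].
Qed.

Lemma theta_alg_continuous f : theta_alg f -> continuous f.
Proof.
move=> Af x; have [_ /(_ x)] := theta_alg_smooth 0 Af.
by move=> /derivable1_diffP/differentiable_continuous.
Qed.

(** Each factor cuts off one side, and the growing steepness n + 1 makes the bumps converge to the
    indicator of ]a, b[. *)
Definition bump a b n x : R := theta 0 (n.+1%:R * (x - a)) * theta 0 (- n.+1%:R * (x - b)).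

Lemma bump_alg a b n : theta_alg (bump a b n).
Proof.
by apply: (@theta_algM (fun x => theta 0 (n.+1%:R * (x - a)))
  (fun x => theta 0 (- n.+1%:R * (x - b)))); exact: theta_alg1.
Qed.

Lemma bump_out a b n x : ~~ (a < x < b) -> bump a b n x = 0.
Proof.
rewrite /bump /theta mulNr -mulrN opprB !pmulr_rgt0// !subr_gt0.
by rewrite negb_and => /orP[/negbTE ->|/negbTE ->]; rewrite ?mul0r ?mulr0.
Qed.

Lemma bump_ge0 a b n x : 0 <= bump a b n x.
Proof. by rewrite mulr_ge0 ?theta_ge0. Qed.

Lemma theta0_le1 y : theta 0 y <= 1.
Proof.
rewrite /theta; case: ltP => // y0; rewrite expr0 mul1r expRN invf_le1 ?expR_gt0//.
by apply: le_trans (expR_ge1Dx _); rewrite lerDl invr_ge0 ltW.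
Qed.

Lemma bump_le1 a b n x : bump a b n x <= 1.
Proof. by rewrite /bump mulr_ile1 ?theta_ge0 ?theta0_le1. Qed.

Lemma cvg_theta0 y : 0 < y -> theta 0 (n.+1%:R * y) @[n --> \oo] --> (1 : R).
Proof.
move=> y0; rewrite (_ : (fun n => _) = (fun n => expR (- (n.+1%:R^-1 * y^-1)))); last first.
  by apply/funext => n; rewrite /theta pmulr_rgt0// y0 expr0 mul1r invfM.
have c0 : n.+1%:R^-1 * y^-1 @[n --> \oo] --> 0 * y^-1 .
  by apply: cvgMl; exact: cvg_harmonic.
rewrite mul0r in c0.
have c1 : - (n.+1%:R^-1 * y^-1) @[n --> \oo] --> (0 : R) by rewrite -oppr0; apply: cvgN.
by have := cvg_comp _ _ c1 (@continuous_expR R 0); rewrite expR0.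
Qed.

Lemma cvg_bump a b x : bump a b n x @[n --> \oo] --> (\1_(`]a, b[%classic) x : R).
Proof.
rewrite indicE mem_setE in_itv/=.
have [/andP[ax xb]|xab] := boolP (a < x < b); last first.
  by under eq_fun do rewrite bump_out//; exact: cvg_cst.
rewrite -(mulr1 (1 : R)); apply: cvgM.
  by apply: cvg_theta0; rewrite subr_gt0.
rewrite (_ : (fun n => _) = (fun n => theta 0 (n.+1%:R * (b - x)))).
  by apply: cvg_theta0; rewrite subr_gt0.
by apply/funext => n; rewrite mulNr -mulrN opprB.
Qed.

Lemma test_bump a b n : 0 < a -> test_function (bump a b n).
Proof.
move=> a0; split=> [k x|]; first by have [_] := theta_alg_smooth k (bump_alg a b n).
exists a, b; split => // x /negP h; apply: bump_out.
by apply/negP => /andP[ax xb]; apply: h; rewrite !ltW.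
Qed.

End bump_functions.

(** * Primitives of test functions and du Bois-Reymond's lemma *)

Section test_functions.
Variable R : realType.
Notation mu := (@lebesgue_measure R).
Notation leb := (@leb R).
Notation Rplus := (@Rplus R).
Implicit Types (x y a b : R) (f g phi psi : R -> R) (k n : nat).

Lemma leb_ae (P : R -> Prop) : {ae mu, forall x, 0 < x -> P x} -> {ae leb, forall x, P x}.
Proof.
case=> A [mA A0 PA]; exists (A `|` [set x | x <= 0]).
have mN : measurable ([set x | x <= 0] : set (measurableTypeR R)).
  by rewrite -set_itvNyc; exact: measurable_itv.
split; first exact: measurableU.
- apply/eqP; rewrite -measure_le0 -[X in (X <= _)%E]/(mu ((A `|` [set x | x <= 0]) `&` Rplus)).
  have <- : (mu A + mu [set 0%R] = 0)%E by rewrite A0 lebesgue_measure_set1 adde0.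
  apply: le_trans (measureU2 _ _ _) => //.
  apply: le_measure; rewrite ?inE.
  + by apply: measurableI; [exact: measurableU|exact: measurable_Rplus].
  + exact: measurableU.
  + move=> x [[Ax|/= x0]]; [by left|rewrite /Defs.Rplus/= in_itv/= andbT => x0'].
    by right; apply/eqP; rewrite eq_le x0 x0'.
- move=> x /= nP; have [x0|x0] := ltP 0 x; last by right.
  by left; apply: PA => /= /(_ x0).
Qed.

Lemma leb_ae_ge0 (P : R -> Prop) : (forall x, 0 <= x -> P x) -> {ae leb, forall x, P x}.
Proof. by move=> h; apply: leb_ae; apply: aeW => x x0; apply: h; exact: ltW. Qed.

Lemma integrable_leb_restrict (f : R -> \bar R) : measurable_fun setT f ->
  mu.-integrable Rplus f -> leb.-integrable setT f.
Proof.
move=> mf /integrableP[_ ioo]; apply/integrableP; split => //.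
by rewrite integral_leb//; exact: measurableT_comp.
Qed.

Lemma Lfun2P f : measurable_fun setT f ->
  leb.-integrable setT (EFin \o (fun x => f x ^+ 2)) -> f \in Lfun leb 2%:E.
Proof.
move=> mf /integrableP[_ fi]; rewrite inE; apply/andP; split; rewrite inE//=.
rewrite /finite_norm unlock/=; apply: poweR_lty.
apply: le_lt_trans fi; apply: ge0_le_integral => //.
- apply/measurable_EFinP; apply: (measurableT_comp (measurable_powR 2)).
  exact: measurableT_comp.
- apply: measurableT_comp => //; apply/measurable_EFinP; exact: measurable_funX.
- by move=> x _; rewrite /= lee_fin powR_mulrn// normrX.
Qed.

Lemma ftc_prim f g x : (forall y, is_derive y 1 f (g y)) -> continuous g ->
  0 <= x -> f x = f 0 + prim g x.
Proof.
move=> df cg; rewrite le_eqVlt => /predU1P[<-|x0].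
  by rewrite /prim set_itv1 Rintegral_set1 addr0.
have cf : continuous f.
  move=> y; have [/derivable1_diffP/differentiable_continuous//] := df y.
rewrite /prim /Rintegral (@continuous_FTC2 _ g f)//.
- by rewrite -EFinB/= addrC subrK.
- exact: continuous_subspaceT.
- split=> [y _||].
  + by have [] := df y.
  + by apply: cvg_at_right_filter; exact: cf.
  + by apply: cvg_at_left_filter; exact: cf.
- by move=> y _; rewrite derive1E; apply: derive_val.
Qed.

Lemma test_derive phi : test_function phi -> test_function (derive1 phi).
Proof.
move=> [sm [a [b [a0 ab]]]]; split=> [k x|]; first by rewrite -derive1Sn; exact: sm.
exists a, b; split => // x xab; rewrite derive1E.
suff h : is_derive x 1 phi 0 by apply: derive_val.
have d0 : is_derive x 1 (cst (0 : R)) 0 by exact: is_derive_cst.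
apply: near_eq_is_derive d0; have [xa|ax] := ltP x a.
  near=> y; rewrite ab// negb_and -!ltNge; apply/orP; left.
  by near: y; exact: lt_nbhsl.
have bx : b < x by move: xab; rewrite ax/= -ltNge.
near=> y; rewrite ab// negb_and -!ltNge; apply/orP; right.
by near: y; exact: lt_nbhsr.
Unshelve. all: by end_near.
Qed.

Lemma test_is_derive phi x : test_function phi -> is_derive x 1 phi (derive1 phi x).
Proof. by move=> [sm _]; split; [exact: (sm 0%N)|rewrite derive1E]. Qed.

Lemma test_continuous phi : test_function phi -> continuous phi.
Proof.
move=> [sm _] x; have := sm 0%N x.
by move=> /derivable1_diffP/differentiable_continuous.
Qed.

Lemma continuous_integrable f a b : continuous f -> mu.-integrable `[a, b] (EFin \o f).
Proof.
move=> cf; apply: continuous_compact_integrable; first exact: segment_compact.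
exact: continuous_subspaceT.
Qed.

Lemma compact_Lfun2 f a b : continuous f -> (forall x, ~~ (a <= x <= b) -> f x = 0) ->
  f \in Lfun leb 2%:E.
Proof.
move=> cf fab; have mf : measurable_fun setT f by exact: continuous_measurable_fun.
have mf2 : measurable_fun setT (EFin \o (fun x => f x ^+ 2)).
  by apply/measurable_EFinP; exact: measurable_funX.
apply: Lfun2P => //; apply: integrable_leb_restrict => //.
apply: (@integrableS _ _ _ mu setT) => //; first exact: measurable_Rplus.
rewrite (_ : EFin \o _ = (EFin \o (fun x => f x ^+ 2)) \_ `[a, b]); last first.
  apply/funext => x; rewrite patchE mem_setE in_itv/=; case: ifPn => // /fab/= ->.
  by rewrite expr0n.
apply/(integrable_mkcond (EFin \o _)) => //.
apply: continuous_integrable => x.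
by apply: (@continuous_comp _ _ _ f (fun y => y ^+ 2)); [exact: cf|exact: exprn_continuous].
Qed.

Lemma test_Lfun2 phi : test_function phi -> phi \in Lfun leb 2%:E.
Proof.
move=> tp; have [_ [a [b [_ ab]]]] := tp.
by apply: (@compact_Lfun2 _ a b) => //; exact: test_continuous.
Qed.

Lemma test_prim phi x : test_function phi -> 0 <= x -> phi x = 0 + prim (derive1 phi) x.
Proof.
move=> tp x0; have [_ [a [b [a0 ab]]]] := tp.
have d y : is_derive y 1 phi (derive1 phi y) by exact: test_is_derive.
rewrite (ftc_prim d)//; last by apply: test_continuous; exact: test_derive.
by rewrite ab// negb_and -ltNge a0.
Qed.

(** The vanishing total integral makes the primitive vanish to the right of [b], so that its support
    stays compact. *)
Lemma test_prim_theta psi a b : theta_alg psi -> 0 < a ->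
  (forall x, ~~ (a < x < b) -> psi x = 0) -> prim psi b = 0 ->
  [/\ test_function (prim psi), derive1 (prim psi) = psi & forall x, b < x -> prim psi x = 0].
Proof.
move=> Apsi a0 ab pb; have cpsi := theta_alg_continuous Apsi.
have pa x : x <= a -> prim psi x = 0.
  move=> xa; rewrite /prim /Rintegral integral0_eq// => y /=; rewrite in_itv/= => /andP[_ yx].
  by rewrite ab// negb_and -!leNgt (le_trans yx xa).
have pgb x : b < x -> prim psi x = 0.
  move=> bx; have [b0|b0] := ltP b 0.
    rewrite /prim /Rintegral integral0_eq// => y /=; rewrite in_itv/= => /andP[y0 _].
    by rewrite ab// negb_and -!leNgt orbC (le_trans (ltW b0) y0).
  have := @prim_split _ psi x b (continuous_integrable 0 x cpsi).
  rewrite b0 (ltW bx) pb subr0 => /(_ isT) h; apply: EFin_inj; rewrite -h.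
  rewrite integral0_eq// => y /=; rewrite in_itv/= => /andP[yb _].
  by rewrite ab// negb_and -!leNgt yb orbT.
have d x : is_derive x 1 (prim psi) (psi x).
  have [xa|ax] := ltP x a.
    rewrite ab; last by rewrite negb_and -!leNgt ltW.
    have d0 : is_derive x 1 (cst (0 : R)) 0 by exact: is_derive_cst.
    apply: near_eq_is_derive d0.
    by near=> y; rewrite pa//; apply: ltW; near: y; exact: lt_nbhsl.
  have x0 : 0 < x by exact: lt_le_trans ax.
  have xx : x < x + 1 by rewrite ltrDl.
  have [h1 h2] := continuous_FTC1_closed xx (continuous_integrable 0 (x + 1) cpsi) x0 (cpsi x).
  by split; [exact: h1|rewrite -derive1E; exact: h2].
have dE : derive1 (prim psi) = psi.
  by apply/funext => x; rewrite derive1E; apply: derive_val.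
split => //; split=> [[|k] x|].
- by have [] := d x.
- by rewrite derive1Sn dE; have [_] := theta_alg_smooth k Apsi.
- exists a, b; split => // x; rewrite negb_and -!ltNge => /orP[/ltW/pa//|/pgb//].
Unshelve. all: by end_near.
Qed.

(** Bumps converge boundedly to indicators, so all integrals of [f] over ]a, b[ vanish and [prim f]
    is constant on the positive half-line; Lebesgue's differentiation theorem concludes. *)
Lemma ae_zero f : (forall N, mu.-integrable `[0, N] (EFin \o f)) ->
  (forall a b n, 0 < a -> a < b -> \int[mu]_(x in `[0, b]) (bump a b n x * f x) = 0) ->
  {ae leb, forall x, f x = 0}.
Proof.
move=> fi h.
have prim0 a b : 0 < a -> a < b -> prim f a = prim f b.
  move=> a0 ab; have b0 : 0 <= b by rewrite ltW// (lt_trans a0).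
  have c := @dominated_factor _ `[0, b]%classic f (bump a b) (\1_(`]a, b[%classic)) _ (fi b).
  have {c} : \int[mu]_(x in `[0, b]) (bump a b n x * f x) @[n --> \oo] -->
      \int[mu]_(x in `[0, b]) (\1_(`]a, b[%classic) x * f x).
    apply: c => //.
    - move=> n; apply: measurable_funTS; apply: continuous_measurable_fun.
      exact: theta_alg_continuous (bump_alg a b n).
    - by move=> n x _; rewrite ger0_norm ?bump_ge0 ?bump_le1.
    - by move=> x _; exact: cvg_bump.
  rewrite (_ : (fun n => _) = cst 0); last by apply/funext => n; exact: h.
  move=> /(cvg_unique (@Rhausdorff R))/(_ (cvg_cst _)) e0.
  apply/esym/eqP; rewrite -subr_eq0; apply/eqP/EFin_inj.
  rewrite -(prim_split (fi b)) ?(ltW a0) ?ltW//.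
  rewrite -[in RHS]e0 Rintegral_indic; last first.
    by apply: subset_itv; rewrite bnd_simp// ltW.
  rewrite /Rintegral fineK; last first.
    apply: integrable_fin_num => //; apply: integrableS (fi b) => //.
    by apply: subset_itv; rewrite bnd_simp// ltW.
  have mf D : measurable D -> D `<=` `[0, b]%classic -> measurable_fun D (EFin \o f).
    by move=> mD Db; apply: measurable_funS Db _ => //; exact: measurable_int (fi b).
  rewrite -integral_itv_obnd_cbnd; last first.
    by apply: mf => //; apply: subset_itvr; rewrite bnd_simp ltW.
  rewrite integral_itv_bndo_bndc//; apply: mf => //.
  by apply: subset_itv; rewrite bnd_simp// ltW.
apply: leb_ae.
suff : forall N : nat, {ae mu, forall x, 0 < x < N%:R -> f x = 0}.
  have FF : Filter (nbhs (almost_everywhere mu)) by exact: ae_filter_ringOfSetsType.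
  move=> /ae_foralln; apply: filterS => x hx x0.
  by apply: (hx (Num.bound x)); rewrite x0/= archi_boundP// ltW.
(* The cut-off provides integrability on the half-lines ]-oo, y], as the differentiation theorem
   requires. *)
move=> N; pose fN := f \_ `[0, N%:R].
have fNi : mu.-integrable setT (EFin \o fN).
  by rewrite /fN -restrict_EFin; apply/(integrable_mkcond (EFin \o _)).
have iy y : mu.-integrable `]-oo, y] (EFin \o fN) by apply: integrableS fNi.
have := FTC1Ny iy (integrable_locally (measurable_itv _) (fi N%:R)).
have FF : Filter (nbhs (almost_everywhere mu)) by exact: ae_filter_ringOfSetsType.
apply: filterS => x [_ hx] /andP[x0 xN].
have <- : fN x = f x by rewrite /fN patchE mem_set//= in_itv/= !ltW.
rewrite -hx derive1E.
suff hd : is_derive x 1 (fun y => \int[mu]_(t in `]-oo, y]) fN t) 0 by apply: derive_val.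
have d0 : is_derive x 1 (cst (prim f x)) 0 by exact: is_derive_cst.
apply: near_eq_is_derive d0; near=> y.
have y0 : 0 < y by near: y; exact: lt_nbhsr.
have yN : y < N%:R by near: y; exact: lt_nbhsl.
have -> : prim f x = prim f y.
  by have [xy|yx|->//] := ltgtP x y; [exact: prim0|exact/esym/prim0].
rewrite /prim /fN /Rintegral; congr fine.
transitivity (\int[mu]_(t in `]-oo, y]) ((EFin \o f) \_ `[0%R, N%:R]) t)%E; last first.
  by rewrite restrict_EFin.
rewrite -integral_mkcondr; congr (integral _ _ _).
apply/seteqP; split => t /=; rewrite !in_itv/=.
  by move=> /andP[t0 ty]; split => //; rewrite t0 (le_trans ty (ltW yN)).
by move=> [ty /andP[t0 tN]]; rewrite t0.
Unshelve. all: by end_near.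
Qed.

Lemma Rintegral_leb_support f b : leb.-integrable setT (EFin \o f) ->
  (forall x, b < x -> f x = 0) -> \int[leb]_x f x = \int[mu]_(x in `[0, b]) f x.
Proof.
move=> fi fb; rewrite Rintegral_leb// -(Rintegral_indic (A := `[0, b]%classic) _ (D := Rplus)); last first.
  by apply: subset_itvl; rewrite bnd_simp.
apply: eq_Rintegral => x; rewrite inE /Defs.Rplus/= in_itv/= andbT => x0.
rewrite indicE mem_setE in_itv/= x0/=.
by have [_|/fb ->] := leP x b; rewrite ?mul1r ?mulr0.
Qed.

(** The constant is the average of w = f - prim g against a fixed bump [rho]. Subtracting from an
    arbitrary bump the multiple of [rho] with the same integral leaves a function of integral 0,
    hence the derivative of a test function; the hypothesis and integration by parts make w
    orthogonal to it. *)
Lemma du_bois_reymond f g : f \in Lfun leb 2%:E -> g \in Lfun leb 2%:E ->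
  (forall phi, test_function phi ->
    \int[leb]_x (f x * derive1 phi x) = - \int[leb]_x (g x * phi x)) ->
  exists z, {ae leb, forall x, f x = z + prim g x}.
Proof.
move=> fL gL H.
have [_ fi] := Lfun2_loc_integrable fL; have [_ gi] := Lfun2_loc_integrable gL.
pose w x := f x - prim g x.
have wi N : mu.-integrable `[0, N] (EFin \o w).
  have [N0|N0] := leP 0 N; last first.
    rewrite (_ : `[0, N]%classic = set0) ?integrable_set0//.
    by apply/seteqP; split => // x /=; rewrite in_itv/= => /andP[x0 /(le_trans x0)]; rewrite leNgt N0.
  apply: integrable_RB => //.
  apply: continuous_compact_integrable; first exact: segment_compact.
  exact: prim_continuous.
pose rho := bump 1 2 0 : R -> R.
have crho : continuous rho := theta_alg_continuous (bump_alg 1 2 0).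
pose I := prim rho 2.
(* If the integral of [rho] vanished, its primitive would be 0 up to 2 by nonnegativity of [rho],
   and differentiating at 3/2 would contradict rho(3/2) > 0. *)
have I0 : I != 0.
  apply/negP => /eqP Ie.
  have rout x : ~~ (1 < x < 2) -> rho x = 0 by exact: bump_out.
  have [_ dr _] := test_prim_theta (bump_alg 1 2 0) ltr01 rout Ie.
  have p0 x : x < 2 -> prim rho x = 0.
    move=> x2; have [x0|x0] := ltP x 0.
      rewrite /prim /Rintegral integral0_eq// => y /=; rewrite in_itv/= => /andP[y0 yx].
      by have := lt_le_trans x0 (le_trans y0 yx); rewrite ltxx.
    apply/eqP; rewrite eq_le; apply/andP; split; last first.
      by apply: Rintegral_ge0 => y _; exact: bump_ge0.
    rewrite -Ie /I /prim -(Rintegral_indic (A := `[0, x]%classic) _ (D := `[0, 2]%classic)); last first.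
      by apply: subset_itvl; rewrite bnd_simp ltW.
    have ri := continuous_integrable 0 2 crho.
    apply: le_Rintegral => //.
      apply: le_integrable ri => //.
        apply/measurable_EFinP; apply: measurable_funM; apply: measurable_funTS.
          exact: measurable_indic.
        exact: continuous_measurable_fun.
      move=> y _; rewrite /= lee_fin normrM ler_piMl// indicE.
      by case: (_ \in _); rewrite ?normr1 ?normr0.
    by move=> y _; rewrite ler_piMl ?bump_ge0// indicE; case: (_ \in _).
  have := congr1 (fun f => f (3 / 2)) dr; rewrite derive1E.
  have d0 : is_derive (3 / 2 : R) 1 (cst (0 : R)) 0 by exact: is_derive_cst.
  have hd : is_derive (3 / 2 : R) 1 (prim rho) 0.
    apply: near_eq_is_derive d0; near=> y; rewrite p0//.
    by near: y; apply: lt_nbhsl; lra.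
  rewrite derive_val /rho /bump /theta !ifT; [|lra|lra].
  by move/eqP; rewrite lt_eqF// !expr0 !mul1r mulr_gt0// expR_gt0.
pose m := (\int[mu]_(x in `[0, 2]) (rho x * w x)) / I.
exists m; suff : {ae leb, forall x, w x - m = 0}.
  have FF : Filter (nbhs (almost_everywhere leb)) by exact: ae_filter_ringOfSetsType.
  by apply: filterS => x /eqP; rewrite subr_eq0 => /eqP <-; rewrite /w subrK.
apply: ae_zero => [N|a b n a0 ab].
  by apply: integrable_RB => //; apply: (@continuous_integrable (cst m)) => x; exact: cvg_cst.
pose psi0 := bump a b n : R -> R.
have cpsi0 : continuous psi0 := theta_alg_continuous (bump_alg a b n).
pose c := prim psi0 b / I; pose psi x := psi0 x + (- c) * rho x.
have Apsi : theta_alg psi.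
  apply: (@theta_algD _ psi0 (fun x => (- c) * rho x)); first exact: bump_alg.
  by apply: (@theta_algZ _ _ rho); exact: bump_alg.
(* An interval of positive reals that contains both ]a, b[ and ]1, 2[. *)
pose a' := Num.min a 1; pose b' := Num.max b 2.
have a'0 : 0 < a' by rewrite lt_min a0 ltr01.
have bb' : b <= b' by rewrite le_max lexx.
have b2' : 2 <= b' by rewrite le_max lexx orbT.
have b'0 : 0 <= b' by apply: le_trans b2'.
have psi_out x : ~~ (a' < x < b') -> psi x = 0.
  move=> h; rewrite /psi /psi0 /rho !bump_out ?mulr0 ?addr0//.
    by apply: contra h => /andP[h1 h2]; rewrite gt_min h1 orbT lt_max h2 orbT.
  by apply: contra h => /andP[h1 h2]; rewrite gt_min h1 lt_max h2.
have supp (h : R -> R) s : s <= b' -> (forall x, s < x -> h x = 0) ->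
    \int[mu]_(x in `[0, b']) h x = \int[mu]_(x in `[0, s]) h x.
  move=> sb hs; rewrite -(Rintegral_indic (A := `[0, s]%classic) _ (D := `[0, b']%classic)); last first.
    by apply: subset_itvl; rewrite bnd_simp.
  apply: eq_Rintegral => x; rewrite inE/= in_itv/= => /andP[x0 _].
  rewrite indicE mem_setE in_itv/= x0/=.
  by have [_|/hs ->] := leP x s; rewrite ?mul1r ?mulr0.
have psi0b x : b < x -> psi0 x = 0.
  by move=> bx; rewrite /psi0 bump_out// negb_and -!leNgt (ltW bx) orbT.
have rho2 x : 2 < x -> rho x = 0.
  by move=> bx; rewrite /rho bump_out// negb_and -!leNgt (ltW bx) orbT.
have cb (h u : R -> R) N : continuous u -> (forall x, 0 <= u x <= 1) ->
    mu.-integrable `[0, N] (EFin \o h) -> mu.-integrable `[0, N] (EFin \o (fun x => u x * h x)).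
  move=> cu u1 hi.
  have mh : measurable_fun `[0, N] h by apply/measurable_EFinP; exact: measurable_int hi.
  apply: le_integrable hi => //.
    apply/measurable_EFinP; apply: measurable_funM => //.
    by apply: measurable_funTS; exact: continuous_measurable_fun.
  move=> y _; rewrite /= lee_fin normrM ler_piMl//.
  by have /andP[y0 y1] := u1 y; rewrite ger0_norm.
have b01 p q k x : 0 <= (bump p q k x : R) <= 1 by rewrite bump_ge0 bump_le1.
have Ppsi : prim psi b' = 0.
  rewrite /prim RintegralD//; [|exact: continuous_integrable|]; last first.
    by apply: integrable_RZ => //; exact: continuous_integrable.
  rewrite RintegralZl//; last exact: continuous_integrable.
  by rewrite (supp psi0 b)// (supp rho 2)// -!/(prim _ _) -/I /c mulNr divfK ?subrr.
have [tp dp pout] := test_prim_theta Apsi a'0 psi_out Ppsi.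
have cpsi := theta_alg_continuous Apsi.
have := H _ tp; rewrite dp.
rewrite (@Rintegral_leb_support (fun x => f x * psi x) b'); first last.
- by move=> x bx; rewrite psi_out ?mulr0// negb_and -!leNgt (ltW bx) orbT.
- apply: Lfun2_mul_integrable => //.
  apply: (@compact_Lfun2 _ a' b') => // x h; apply: psi_out; apply: contra h.
  by move=> /andP[h1 h2]; rewrite !ltW.
rewrite (@Rintegral_leb_support (fun x => g x * prim psi x) b'); first last.
- by move=> x bx; rewrite pout ?mulr0.
- by apply: Lfun2_mul_integrable => //; exact: test_Lfun2.
have := integration_by_parts_prim b'0 (gi b') (continuous_integrable 0 b' cpsi).
rewrite Ppsi mulr0 => /eqP; rewrite addr_eq0 => /eqP -> ; rewrite opprK => hf.
have psiI (h : R -> R) : mu.-integrable `[0, b'] (EFin \o h) ->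
    mu.-integrable `[0, b'] (EFin \o (fun x => psi x * h x)).
  move=> hi; rewrite (_ : (fun x => _) = (fun x => psi0 x * h x + (- c) * (rho x * h x))).
    apply: integrable_RD => //; first exact: (cb _ psi0 _ cpsi0 (b01 a b n)).
    by apply: integrable_RZ => //; exact: (cb _ rho _ crho (b01 1 2 0%N)).
  by apply/funext => x; rewrite /psi; ring.
have h0 : \int[mu]_(x in `[0, b']) (psi x * w x) = 0.
  rewrite (_ : (fun x => _) = (fun x => psi x * f x - psi x * prim g x)); last first.
    by apply/funext => x; rewrite /w mulrBr.
  rewrite RintegralB//; [|exact: psiI|]; last first.
    by apply: integrable_prim_mul => //; exact: continuous_integrable.
  apply/eqP; rewrite subr_eq0; apply/eqP; rewrite -hf.
  by apply: eq_Rintegral => x _; rewrite mulrC.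
have iw k p q N : mu.-integrable `[0, N] (EFin \o (fun x => (bump p q k x : R) * w x)).
  by apply: cb => //; exact: theta_alg_continuous (bump_alg p q k).
rewrite (_ : (fun x => _) = (fun x => psi0 x * w x - m * psi0 x)); last first.
  by apply/funext => x; rewrite mulrBr [m * _]mulrC.
have ib := continuous_integrable 0 b cpsi0.
rewrite RintegralB//; [|exact: iw|exact: integrable_RZ].
rewrite RintegralZl// -/(prim psi0 b).
move: h0; rewrite (_ : (fun x => psi x * w x) = (fun x => psi0 x * w x + (- c) * (rho x * w x))); last first.
  by apply/funext => x; rewrite /psi; ring.
rewrite RintegralD//; [|exact: iw|apply: integrable_RZ => //; exact: iw].
rewrite RintegralZl//; last exact: iw.
rewrite (supp (fun x => psi0 x * w x) b)//; last by move=> x /psi0b ->; rewrite mul0r.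
rewrite (supp (fun x => rho x * w x) 2)//; last by move=> x /rho2 ->; rewrite mul0r.
move=> h0; rewrite -[RHS]h0 mulNr; congr (_ - _); rewrite /c /m; ring.
Unshelve. all: by end_near.
Qed.

End test_functions.

(** * Square integrable functions *)

Section square_integrable_functions.
Variable R : realType.
Notation mu := (@lebesgue_measure R).
Notation leb := (@leb R).
Notation Rplus := (@Rplus R).
Implicit Types (f g h : R -> R) (x y z : R) (n k : nat).

Definition expN x : R := expR (- x).

Lemma is_derive_expN x : is_derive x 1 expN (- expN x).
Proof.
have dN : is_derive x 1 (fun y : R => - y) (- 1) by exact: is_deriveN.
have := @is_derive1_comp _ expR (fun y => - y) x _ _ (is_derive_expR _) dN.
by move=> d; apply: (is_derive_eq d); rewrite mulrN1.
Qed.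

Lemma expN_continuous : continuous expN.
Proof.
move=> x; have [/derivable1_diffP/differentiable_continuous//] := is_derive_expN x.
Qed.

Lemma expN_prim x : 0 <= x -> expN x = 1 + prim (fun y => - expN y) x.
Proof.
move=> x0; have cN : continuous (fun y => - expN y).
  by move=> y; apply: cvgN; exact: expN_continuous.
by rewrite (ftc_prim is_derive_expN cN x0) {1}/expN oppr0 expR0.
Qed.

Lemma expN_Lfun2 : expN \in Lfun leb 2%:E.
Proof.
have mE : measurable_fun setT expN by apply: continuous_measurable_fun; exact: expN_continuous.
apply: Lfun2P => //; apply: integrable_leb_restrict.
  by apply/measurable_EFinP; exact: measurable_funX.
have /(integrableS measurableT (@measurable_Rplus R) (@subsetT _ _)) :=
  @integrable_exponential_pdf R 2 (ltr0Sn R 1).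
move=> /(integrable_RZ (@measurable_Rplus R) 2^-1); apply: eq_integrable.
  exact: measurable_Rplus.
move=> x; rewrite inE /Defs.Rplus/= in_itv/= andbT => x0.
rewrite exponential_pdfE// mulrA mulVf// mul1r /expN expr2 -expRD.
by congr (expR _)%:E; ring.
Qed.

Lemma Lfun2_cst z : cst z \in Lfun leb 2%:E -> z = 0.
Proof.
move=> /Lfun2_integrable_sqr/integrableP[_ /=].
rewrite integral_cst//.
rewrite [X in (_ * X)%E](_ : _ = +oo%E); last first.
  rewrite -[LHS]/(mu (setT `&` Rplus)) setTI /Defs.Rplus lebesgue_measure_itv/=.
  by rewrite ltry.
have [->//|z0] := eqVneq z 0; rewrite muleC gt0_mulye ?ltxx//.
by rewrite lte_fin normr_gt0 sqrf_eq0.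
Qed.

(** Otherwise f would have no zero on some [0, d[, a set of positive measure. *)
Lemma continuous_ae_zero f : {within `[0, +oo[, continuous f} ->
  {ae leb, forall x, f x = 0} -> f 0 = 0.
Proof.
move=> cf f0; apply: contrapT => /eqP N0.
have [d d0 hd] : exists2 d : R, 0 < d & forall x, 0 <= x < d -> f x != 0.
  have z0 : `[0, +oo[%classic (0 : R) by rewrite /= in_itv/= lexx.
  have /continuous_within_itvcyP[_ c0] := cf.
  have : \forall x \near 0^'+, f x != 0.
    have := @cvgr_neq0 _ _ _ _ _ _ _ c0 N0.
    exact.
  case=> d /= d0 hd; exists d => // x /andP[x0 xd].
  move: x0; rewrite le_eqVlt => /predU1P[<-//|x0].
  by apply: hd => //=; rewrite sub0r normrN gtr0_norm.
have [A [mA A0 hA]] := f0.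
have : (mu (`[0%R, d[%classic : set R) <= leb A)%E.
  rewrite -[leRHS]/(mu (A `&` Rplus)); apply: le_measure; rewrite ?inE//.
    by apply: measurableI => //; exact: measurable_Rplus.
  move=> x /=; rewrite in_itv/= => xd; split; first by apply: hA => /= fx; move: (hd _ xd); rewrite fx eqxx.
  by move: xd => /andP[x0 _]; rewrite /Defs.Rplus/= in_itv/= x0.
by rewrite A0 lebesgue_measure_itv/= lte_fin d0 leNgt oppr0 adde0 lte_fin d0.
Qed.

(** With e_k = 2r/2^k the gap e_k - e_(k+1) is exactly r/2^k, so a_k - e_k is nondecreasing and a_k
    + e_k nonincreasing; the limit is caught between them. *)
Lemma geometric_cvg (a : nat -> R) r : (forall k, `|a k.+1 - a k| <= r / 2 ^+ k) ->
  exists2 l, a n @[n --> \oo] --> l & forall k, `|l - a k| <= 2 * r / 2 ^+ k.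
Proof.
move=> ha; pose e k : R := 2 * r / 2 ^+ k.
have eS k : e k.+1 = r / 2 ^+ k by rewrite /e exprS invfM mulrACA mulfV// mul1r.
have e2 k : e k = 2 * (r / 2 ^+ k) by rewrite /e mulrA.
have e_ge0 k : 0 <= e k by rewrite e2 mulr_ge0// (le_trans _ (ha k)).
have cb : {homo (fun k => a k - e k) : m n / (m <= n)%N >-> m <= n}.
  apply/nondecreasing_seqP => k; have := ha k; rewrite ler_norml => /andP[h _].
  have := eS k; have := e2 k; lra.
have cc : {homo (fun k => a k + e k) : m n / (m <= n)%N >-> n <= m}.
  apply/nonincreasing_seqP => k; have := ha k; rewrite ler_norml => /andP[_ h].
  have := eS k; have := e2 k; lra.
have bc i j : a i - e i <= a j + e j.
  have h1 := cb _ _ (leq_maxl i j); have h2 := cc _ _ (leq_maxr i j).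
  have := e_ge0 (maxn i j); lra.
have cvb : cvgn (fun k => a k - e k).
  apply: nondecreasing_is_cvgn => //.
  by exists (a 0%N + e 0%N) => _ [k _ <-]; exact: bc.
set l := limn (fun k => a k - e k) in cvb *.
have e0 : e k @[k --> \oo] --> (0 : R).
  rewrite (_ : e = (fun k => (2 * r) * (2^-1) ^+ k)); last first.
    by apply/funext => k; rewrite /e exprVn.
  rewrite -[X in _ --> X](mulr0 (2 * r)); apply: cvgMr; apply: cvg_expr.
  by rewrite ger0_norm ?invr_ge0// invf_lt1// ltr1n.
exists l.
  rewrite (_ : (fun n => a n) = (fun n => (a n - e n) + e n)); last first.
    by apply/funext => k; rewrite subrK.
  by rewrite -[X in _ --> X]addr0; apply: cvgD.
move=> k; rewrite ler_distl -/(e k); apply/andP; split.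
  by apply: nondecreasing_cvgn_le.
by apply: limr_le => //; near=> n; exact: bc.
Unshelve. all: by end_near.
Qed.

(** The weighted sum S of the squared increments has integral at most 2, and (g - G_k)^2 <= 4 * 4^-k
    * S wherever S is finite; this is the origin of the constant 8. *)
Lemma riesz_fischer (G : nat -> R -> R) : (forall k, G k \in Lfun leb 2%:E) ->
  (forall k, \int[leb]_x (G k.+1 x - G k x) ^+ 2 <= 8^-1 ^+ k) ->
  exists2 g, g \in Lfun leb 2%:E &
    forall k, \int[leb]_x (g x - G k x) ^+ 2 <= 8 * 4^-1 ^+ k.
Proof.
move=> GL hG.
have mG k : measurable_fun setT (G k) := Lfun2_measurable (GL k).
have dL k l : (fun x => G k x - G l x) \in Lfun leb 2%:E.
  have [_ Llin] := Lfun2_submod R.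
  rewrite (_ : (fun x => _) = (-1) *: (G l : R -> R) + G k); first exact: Llin.
  by apply/funext => x; rewrite -[RHS]/(-1 * G l x + G k x) mulN1r addrC.
(* The weights 4^k turn the rate 8^-k into the summable 2^-k, while finiteness of S at x still
   bounds the increments there by sqrt(S x)/2^k. *)
pose u k x : \bar R := (4 ^+ k * (G k.+1 x - G k x) ^+ 2)%:E.
have u0 k x : (0 <= u k x)%E by rewrite lee_fin mulr_ge0 ?sqr_ge0// exprn_ge0.
have mu_ k : measurable_fun setT (u k).
  apply/measurable_EFinP; apply: measurable_funM => //; apply: measurable_funX.
  exact: measurable_funB.
pose S x := (\sum_(k <oo) u k x)%E.
have S0 x : (0 <= S x)%E by exact: nneseries_ge0.
have mS : measurable_fun setT S.
  exact: (@ge0_emeasurable_sum _ _ _ setT u xpredT).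
have iS : (\int[leb]_x S x <= 2%:E)%E.
  rewrite /S integral_nneseries//.
  apply: le_trans (epsilon_trick0 xpredT (_ : 0 <= 2)) => //.
  apply: lee_nneseries => [k _ _|k _]; first exact: integral_ge0.
  rewrite /u; under eq_integral do rewrite EFinM.
  have iG : leb.-integrable setT (fun x => ((G k.+1 x - G k x) ^+ 2)%:E).
    exact: (Lfun2_integrable_sqr (dL _ _)).
  rewrite integralZl//.
  have -> : (\int[leb]_x ((G k.+1 x - G k x) ^+ 2)%:E =
      (\int[leb]_x (G k.+1 x - G k x) ^+ 2)%:E)%E.
    by rewrite /Rintegral fineK//; exact: integrable_fin_num.
  rewrite -EFinM lee_fin natrX exprS invfM mulrA mulfV// mul1r.
  apply: (@le_trans _ _ (4 ^+ k * 8^-1 ^+ k)); first by rewrite ler_wpM2l ?exprn_ge0.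
  rewrite -exprMn -exprVn le_eqVlt; apply/orP; left; apply/eqP; congr (_ ^+ _); lra.
have Sfin : leb.-integrable setT S.
  apply/integrableP; split => //; under eq_integral do rewrite gee0_abs//.
  by apply: le_lt_trans iS _; rewrite ltry.
have [g mg hg] : exists2 g : R -> R, measurable_fun setT g & forall x, S x \is a fin_num ->
    forall k, (g x - G k x) ^+ 2 <= 4 * 4^-1 ^+ k * fine (S x).
  pose A := [set x | S x \is a fin_num].
  have mA : measurable (A : set (measurableTypeR R)).
    by rewrite -[A]setTI; exact: emeasurable_fin_num.
  (* Multiplying by the indicator of the set where S is finite makes the sequences converge at every
     point, so that the limit is measurable. *)
  have /choice[g hg] x : exists l, (\1_A x * G k x @[k --> \oo] --> l) /\
      (A x -> forall k, (l - G k x) ^+ 2 <= 4 * 4^-1 ^+ k * fine (S x)).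
    have [xA|xA] := pselect (A x); last first.
      exists 0; split => //; rewrite indicE memNset//.
      by under eq_fun do rewrite mul0r; exact: cvg_cst.
    pose s := fine (S x); have s0 : 0 <= s by rewrite fine_ge0.
    have hs k : `|G k.+1 x - G k x| <= Num.sqrt s / 2 ^+ k.
      rewrite -(ler_pXn2r (ltn0Sn 1)) ?nnegrE ?divr_ge0 ?sqrtr_ge0 ?exprn_ge0//.
      rewrite real_normK ?num_real// expr_div_n sqr_sqrtr// -exprM mulnC exprM.
      rewrite ler_pdivlMr ?exprn_gt0// ?exprn_gt0// mulrC.
      have -> : (2 ^+ 2 : R) = 4 by rewrite expr2; lra.
      rewrite -lee_fin /s fineK//.
      apply: le_trans (nneseries_lim_ge k.+1 _) => //.
      rewrite big_mkord big_ord_recr/= leeDr// sume_ge0// => i _; exact: u0.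
    have [l cl hl] := geometric_cvg hs; exists l; split.
      by rewrite indicE mem_set//; under eq_fun do rewrite mul1r.
    move=> _ k; rewrite -(real_normK (num_real _)).
    apply: (@le_trans _ _ ((2 * Num.sqrt s / 2 ^+ k) ^+ 2)).
      by rewrite ler_pXn2r// ?nnegrE ?divr_ge0 ?mulr_ge0 ?sqrtr_ge0 ?exprn_ge0.
    rewrite expr_div_n exprMn sqr_sqrtr// -exprM mulnC exprM -exprVn.
    have -> : (2 ^+ 2 : R) = 4 by rewrite expr2; lra.
    by rewrite le_eqVlt; apply/orP; left; apply/eqP; rewrite /s exprVn; ring.
  exists g; last by move=> x xA; have [_] := hg x; apply.
  apply: (@measurable_fun_cvg _ _ _ _ (fun k x => \1_A x * G k x)).
    by move=> k; apply: measurable_funM.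
  by move=> x _; have [] := hg x.
have hI k : (\int[leb]_x ((g x - G k x) ^+ 2)%:E <= (8 * 4^-1 ^+ k)%:E)%E.
  apply: (@le_trans _ _ (\int[leb]_x ((4 * 4^-1 ^+ k)%:E * S x))%E).
    apply: ae_ge0_le_integral => //.
    - by move=> x _; rewrite lee_fin sqr_ge0.
    - apply/measurable_EFinP; apply: (@measurable_funX _ _ _ _ (fun x => g x - G k x)).
      exact: measurable_funB.
    - by move=> x _; rewrite mule_ge0// lee_fin mulr_ge0// exprn_ge0// invr_ge0.
    - exact: measurable_funeM.
    have FF : Filter (nbhs (almost_everywhere leb)) by exact: ae_filter_ringOfSetsType.
    apply: filterS (integrable_ae measurableT Sfin) => x /(_ I) xA _.
    by rewrite -(fineK xA) -EFinM lee_fin hg.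
  rewrite integralZl//; apply: le_trans (lee_wpmul2l _ iS) _.
    by rewrite lee_fin mulr_ge0// exprn_ge0// invr_ge0.
  rewrite -EFinM lee_fin; lra.
have gGL k : (fun x => g x - G k x) \in Lfun leb 2%:E.
  apply: Lfun2P; first exact: measurable_funB.
  apply/integrableP; split.
    apply/measurable_EFinP; apply: (@measurable_funX _ _ _ _ (fun x => g x - G k x)).
    exact: measurable_funB.
  under eq_integral do rewrite gee0_abs ?lee_fin ?sqr_ge0//.
  by apply: le_lt_trans (hI k) _; rewrite ltry.
exists g => [|k].
  have [_ Llin] := Lfun2_submod R.
  rewrite (_ : g = 1 *: ((fun x => g x - G 0%N x) : R -> R) + G 0%N); first exact: Llin.
  by apply/funext => x; rewrite -[RHS]/(1 * (g x - G 0%N x) + G 0%N x) mul1r subrK.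
rewrite /Rintegral -lee_fin fineK; first exact: hI.
by apply: integrable_fin_num => //; exact: (Lfun2_integrable_sqr (gGL k)).
Unshelve. all: by end_near.
Qed.

End square_integrable_functions.

(** * Weak derivatives in L_2 *)

Section weak_derivatives.
Variable R : realType.
Notation mu := (@lebesgue_measure R).
Notation leb := (@leb R).
Notation Rplus := (@Rplus R).
Notation dot := (@L2_dot R : {dot (L2 R) for Num.conj}).
Implicit Types (f g u v : L2 R) (phi a b : R -> R) (z w : R[i]) (p r : L2 R * L2 R).

#[local] Instance ae_leb_filter : Filter (nbhs (almost_everywhere leb)).
Proof. exact: ae_filter_ringOfSetsType. Qed.

Definition reL2 f x : R := Re (L2_fun f x).
Definition imL2 f x : R := Im (L2_fun f x).

Lemma reL2_Lfun f : reL2 f \in Lfun leb 2%:E.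
Proof. by have := preL2P (repr f); rewrite inE => /andP[]. Qed.

Lemma imL2_Lfun f : imL2 f \in Lfun leb 2%:E.
Proof. by have := preL2P (repr f); rewrite inE => /andP[]. Qed.

Lemma mkL2_proof a b : a \in Lfun leb 2%:E -> b \in Lfun leb 2%:E ->
  (fun x => a x +i* b x) \in @square_integrable R.
Proof. by move=> ha hb; rewrite inE; apply/andP. Qed.

Definition mkL2 a b (ha : a \in Lfun leb 2%:E) (hb : b \in Lfun leb 2%:E) : L2 R :=
  (\pi_(L2 R) (PreL2 (mkL2_proof ha hb)))%qT.

Lemma L2_fun_pi (q : preL2 R) : {ae leb, forall x, L2_fun (\pi_(L2 R) q)%qT x = q x}.
Proof.
have : \pi_(L2 R)%qT (repr (\pi_(L2 R) q)%qT) == (\pi_(L2 R) q)%qT by rewrite reprK.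
rewrite L2_pi_eq => /asboolP; apply: filterS => x /(_ I).
rewrite -[LHS]/(L2_fun (\pi_(L2 R) q)%qT x - q x) => /eqP.
by rewrite subr_eq0 => /eqP.
Qed.

Lemma reL2_mk a b (ha : a \in Lfun leb 2%:E) (hb : b \in Lfun leb 2%:E) :
  {ae leb, forall x, reL2 (mkL2 ha hb) x = a x}.
Proof. by apply: filterS (L2_fun_pi (PreL2 (mkL2_proof ha hb))) => x; rewrite /reL2 => ->. Qed.

Lemma imL2_mk a b (ha : a \in Lfun leb 2%:E) (hb : b \in Lfun leb 2%:E) :
  {ae leb, forall x, imL2 (mkL2 ha hb) x = b x}.
Proof. by apply: filterS (L2_fun_pi (PreL2 (mkL2_proof ha hb))) => x; rewrite /imL2 => ->. Qed.

Lemma L2_pi0 : (\pi_(L2 R) 0)%qT = 0 :> L2 R.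
Proof. by apply: (@addrI _ (\pi_(L2 R) 0)%qT); rewrite -L2_piD !addr0. Qed.

Lemma L2_fun0 : {ae leb, forall x, L2_fun (0 : L2 R) x = 0}.
Proof. by rewrite -L2_pi0; exact: L2_fun_pi. Qed.

Lemma L2_eq0 f : {ae leb, forall x, reL2 f x = 0} -> {ae leb, forall x, imL2 f x = 0} -> f = 0.
Proof.
move=> r0 i0; rewrite -[f]reprK.
rewrite -L2_pi0; apply/eqP; rewrite L2_pi_eq subr0; apply/asboolP.
by apply: filterS2 r0 i0 => x rx ix _; exact: complexP.
Qed.

Let intM a b : a \in Lfun leb 2%:E -> b \in Lfun leb 2%:E ->
  leb.-integrable setT (EFin \o (fun x => a x * b x)).
Proof. exact: Lfun2_mul_integrable. Qed.

Lemma Re_L2_dot f g : Re (dot f g) =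
  \int[leb]_x (reL2 f x * reL2 g x) + \int[leb]_x (imL2 f x * imL2 g x).
Proof.
have [hrf hif] := (reL2_Lfun f, imL2_Lfun f); have [hrg hig] := (reL2_Lfun g, imL2_Lfun g).
rewrite -RintegralD//; [|exact: intM..].
apply: eq_Rintegral => x _; rewrite /reL2 /imL2 /L2_fun.
by case: (repr f x) (repr g x) => [a b] [c d] /=; rewrite mulrN opprK.
Qed.

Lemma Im_L2_dot f g : Im (dot f g) =
  \int[leb]_x (imL2 f x * reL2 g x) - \int[leb]_x (reL2 f x * imL2 g x).
Proof.
have [hrf hif] := (reL2_Lfun f, imL2_Lfun f); have [hrg hig] := (reL2_Lfun g, imL2_Lfun g).
rewrite -RintegralB//; [|exact: intM..].
apply: eq_Rintegral => x _; rewrite /reL2 /imL2 /L2_fun.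
by case: (repr f x) (repr g x) => [a b] [c d] /=; rewrite mulrN addrC.
Qed.

Lemma ae_Rintegral_mul a b phi : a \in Lfun leb 2%:E -> b \in Lfun leb 2%:E ->
  phi \in Lfun leb 2%:E -> {ae leb, forall x, a x = b x} ->
  \int[leb]_x (a x * phi x) = \int[leb]_x (b x * phi x).
Proof.
move=> ha hb hp ab; rewrite /Rintegral; congr fine; apply: ae_eq_integral => //.
- by apply: measurable_int (intM ha hp).
- by apply: measurable_int (intM hb hp).
- by apply: filterS ab => x -> .
Qed.

Lemma cintegral_real f phi : cintegral (fun x => L2_fun f x * (phi x)%:C) =
  \int[leb]_x (reL2 f x * phi x) +i* \int[leb]_x (imL2 f x * phi x).
Proof.
rewrite /cintegral; congr (_ +i* _); apply: eq_Rintegral => x _; rewrite /reL2 /imL2.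
  by case: (L2_fun f x) => a b /=; rewrite mulr0 subr0.
by case: (L2_fun f x) => a b /=; rewrite mulr0 add0r.
Qed.

Lemma zero_Lfun : (fun=> 0) \in Lfun leb 2%:E.
Proof. by have [] := Lfun2_submod R. Qed.

Lemma L2_dot_mk_real f a (ha : a \in Lfun leb 2%:E) :
  dot f (mkL2 ha zero_Lfun) = cintegral (fun x => L2_fun f x * (a x)%:C).
Proof.
have [hrf hif] := (reL2_Lfun f, imL2_Lfun f).
have [h1 h2] := (reL2_mk ha zero_Lfun, imL2_mk ha zero_Lfun).
have E b : b \in Lfun leb 2%:E ->
    \int[leb]_x (b x * reL2 (mkL2 ha zero_Lfun) x) = \int[leb]_x (b x * a x).
  move=> hb; under eq_Rintegral do rewrite mulrC.
  rewrite (ae_Rintegral_mul (reL2_Lfun _) ha hb h1).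
  by apply: eq_Rintegral => x _; rewrite mulrC.
have E0 b : b \in Lfun leb 2%:E ->
    \int[leb]_x (b x * imL2 (mkL2 ha zero_Lfun) x) = 0.
  move=> hb; under eq_Rintegral do rewrite mulrC.
  rewrite (ae_Rintegral_mul (imL2_Lfun _) zero_Lfun hb h2).
  by under eq_Rintegral do rewrite mul0r; rewrite Rintegral_cst// mul0r.
by rewrite cintegral_real; apply: complexP; rewrite ?Re_L2_dot ?Im_L2_dot /= E// E0// ?addr0 ?subr0.
Qed.

(* [f] is absolutely continuous with derivative [g] and value [z] at 0. *)
Definition half_line_primitive f g z : Prop :=
  {ae leb, forall x, reL2 f x = Re z + prim (reL2 g) x} /\
  {ae leb, forall x, imL2 f x = Im z + prim (imL2 g) x}.

Lemma green f g z u v w : half_line_primitive f g z -> half_line_primitive u v w ->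
  dot g u + dot f v = - (z * conjc w).
Proof.
move=> [fr fi] [ur ui].
have G1 := green_half_line (reL2_Lfun f) (reL2_Lfun g) (reL2_Lfun u) (reL2_Lfun v) fr ur.
have G2 := green_half_line (imL2_Lfun f) (imL2_Lfun g) (imL2_Lfun u) (imL2_Lfun v) fi ui.
have G3 := green_half_line (reL2_Lfun f) (reL2_Lfun g) (imL2_Lfun u) (imL2_Lfun v) fr ui.
have G4 := green_half_line (imL2_Lfun f) (imL2_Lfun g) (reL2_Lfun u) (reL2_Lfun v) fi ur.
apply: complexP; rewrite !ReImE ?Re_L2_dot ?Im_L2_dot.
  by rewrite addrACA G1 G2; ring.
by rewrite addrACA -opprD G3 G4; ring.
Qed.

(** One direction is du Bois-Reymond's lemma for real and imaginary parts; the other is the Green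
    identity against a test function, whose value at 0 is 0. *)
Lemma weak_derivative1P f g : weak_derivative 1 f g <-> exists z, half_line_primitive f g z.
Proof.
have [hrf hif] := (reL2_Lfun f, imL2_Lfun f); have [hrg hig] := (reL2_Lfun g, imL2_Lfun g).
split=> [H|[z [hr hi]] phi tphi].
  have {}H phi : test_function phi ->
      \int[leb]_x (reL2 f x * derive1 phi x) = - (\int[leb]_x (reL2 g x * phi x)) /\
      \int[leb]_x (imL2 f x * derive1 phi x) = - (\int[leb]_x (imL2 g x * phi x)).
    move=> /H; rewrite !cintegral_real expr1 mulN1r => e.
    by split; [have := congr1 (fun z => Re z) e|have := congr1 (fun z => Im z) e].
  have [zr hr] := du_bois_reymond hrf hrg (fun phi t => (H phi t).1).
  have [zi hi] := du_bois_reymond hif hig (fun phi t => (H phi t).2).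
  by exists (zr +i* zi).
have pL := test_Lfun2 tphi; have pL' := test_Lfun2 (test_derive tphi).
have pp : {ae leb, forall x, phi x = 0 + prim (derive1 phi) x}.
  by apply: leb_ae_ge0 => x; exact: test_prim.
have G1 := green_half_line hrf hrg pL pL' hr pp.
have G2 := green_half_line hif hig pL pL' hi pp.
rewrite !mulr0 oppr0 in G1 G2.
rewrite !cintegral_real expr1 mulN1r; apply: complexP => /=; apply/eqP.
  by rewrite -addr_eq0 addrC; apply/eqP.
by rewrite -addr_eq0 addrC; apply/eqP.
Qed.

Definition weak_graph : set (L2 R * L2 R) := [set p | weak_derivative 1 p.1 p.2].

Definition expL2 : L2 R := mkL2 (@expN_Lfun2 R) zero_Lfun.

Lemma prim_ae a b x : a \in Lfun leb 2%:E -> b \in Lfun leb 2%:E ->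
  {ae leb, forall x, a x = b x} -> prim a x = prim b x.
Proof.
move=> ha hb ab; apply: ae_eq_Rintegral => //.
- by apply: subset_itvl; rewrite bnd_simp.
- by apply: measurable_funTS; exact: Lfun2_measurable.
- by apply: measurable_funTS; exact: Lfun2_measurable.
Qed.

Lemma half_line_primitive_exp : half_line_primitive expL2 (- expL2) 1.
Proof.
have eN f : {ae leb, forall x, L2_fun (- f) x = - L2_fun f x}.
  have := L2_fun_pi (- repr f); rewrite (_ : (\pi_(L2 R) (- repr f))%qT = - f)//.
  by rewrite Quotient.pi_opp reprK.
have reN f a : {ae leb, forall x, reL2 f x = a x} -> {ae leb, forall x, reL2 (- f) x = - a x}.
  by apply: filterS2 (eN f) => x h1 h2; rewrite -h2 /reL2 h1 ReN.
have imN f a : {ae leb, forall x, imL2 f x = a x} -> {ae leb, forall x, imL2 (- f) x = - a x}.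
  by apply: filterS2 (eN f) => x h1 h2; rewrite -h2 /imL2 h1 ImN.
have [h1 h2] := (reL2_mk (@expN_Lfun2 R) zero_Lfun, imL2_mk (@expN_Lfun2 R) zero_Lfun).
have LN a : a \in Lfun leb 2%:E -> (fun x => - a x) \in Lfun leb 2%:E.
  move=> ha; have [L0 Llin] := Lfun2_submod R.
  rewrite (_ : (fun x => _) = (-1) *: (a : R -> R) + 0); first exact: Llin.
  by apply/funext => x; rewrite -[RHS]/(-1 * a x + 0) mulN1r addr0.
split.
  have hx := @leb_ae_ge0 R _ (@expN_prim R).
  apply: (filterS2 _ _ h1 hx) => x -> ->; congr (_ + _); apply/esym.
  apply: prim_ae (reL2_Lfun _) (LN _ (@expN_Lfun2 R)) (reN _ _ h1).
apply: (filterS _ h2) => x ->; rewrite (prim_ae _ (imL2_Lfun _) (LN _ zero_Lfun) (imN _ _ h2)).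
by rewrite /prim Rintegral_cst// oppr0 mul0r addr0.
Qed.

Lemma half_line_primitive_test phi (tphi : test_function phi) :
  half_line_primitive (mkL2 (test_Lfun2 tphi) zero_Lfun)
    (mkL2 (test_Lfun2 (test_derive tphi)) zero_Lfun) 0.
Proof.
split.
  have hx : {ae leb, forall x, phi x = 0 + prim (derive1 phi) x}.
    by apply: leb_ae_ge0 => x; exact: test_prim.
  apply: filterS2 (reL2_mk (test_Lfun2 tphi) zero_Lfun) hx => x -> ->; congr (_ + _).
  apply/esym; apply: prim_ae (reL2_Lfun _) (test_Lfun2 (test_derive tphi)) (reL2_mk _ _).
apply: filterS (imL2_mk (test_Lfun2 tphi) zero_Lfun) => x ->.
rewrite (prim_ae _ (imL2_Lfun _) zero_Lfun (imL2_mk _ _)).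
by rewrite /prim Rintegral_cst// mul0r addr0.
Qed.

Lemma boundary_half_line f g z : half_line_primitive f g z -> boundary dot expL2 (f, g) = z.
Proof.
move=> h; have := green h half_line_primitive_exp.
rewrite (sipNr (sip_dot dot)) conjc1 mulr1 addrC => e.
by rewrite /boundary /= (sipBl (sip_dot dot)) -[z]opprK -e opprD opprK.
Qed.

Lemma weak_boundary f g : weak_derivative 1 f g ->
  half_line_primitive f g (boundary dot expL2 (f, g)).
Proof. by move=> /weak_derivative1P[z h]; rewrite (boundary_half_line h). Qed.

(** Such an f is constant, and nonzero constants are not square integrable on a half-line. *)
Lemma weak_derivative_ker0 f : weak_derivative 1 f 0 -> f = 0.
Proof.
move=> /weak_derivative1P[z [hr hi]].
have re0 : {ae leb, forall x, reL2 0 x = 0} by apply: filterS L2_fun0 => x; rewrite /reL2 => ->.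
have im0 : {ae leb, forall x, imL2 0 x = 0} by apply: filterS L2_fun0 => x; rewrite /imL2 => ->.
have c0 (c : R) a b : a \in Lfun leb 2%:E -> b \in Lfun leb 2%:E ->
    {ae leb, forall x, b x = 0} ->
    {ae leb, forall x, a x = c + prim b x} -> {ae leb, forall x, a x = 0}.
  move=> ha hb b0 hab.
  have ac : {ae leb, forall x, a x = c}.
    apply: filterS hab => x ->; rewrite (prim_ae _ hb zero_Lfun b0).
    by rewrite /prim Rintegral_cst// mul0r addr0.
  suff c0 : c = 0 by apply: filterS ac => x; rewrite c0.
  apply: Lfun2_cst; apply: Lfun2P => //.
  have /integrableP[ma ia] := Lfun2_integrable_sqr ha.
  apply/integrableP; split.
    exact: (measurable_cst (c ^+ 2)%:E).
  apply: le_lt_trans ia; rewrite le_eqVlt; apply/orP; left; apply/eqP.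
  apply: ae_eq_integral => //.
  - by apply: measurableT_comp => //; exact: (measurable_cst (c ^+ 2)%:E).
  - exact: measurableT_comp.
  - by apply: filterS ac => x /= ->.
by apply: L2_eq0; [exact: (c0 _ _ _ (reL2_Lfun _) (reL2_Lfun 0) re0 hr)
  |exact: (c0 _ _ _ (imL2_Lfun _) (imL2_Lfun 0) im0 hi)].
Qed.

Lemma test_orthogonal_ae0 a : a \in Lfun leb 2%:E ->
  (forall phi, test_function phi -> \int[leb]_x (a x * phi x) = 0) ->
  {ae leb, forall x, a x = 0}.
Proof.
move=> ha h; have [_ ai] := Lfun2_loc_integrable ha.
apply: ae_zero => // p q n p0 pq.
have t := test_bump q n p0.
rewrite -[RHS](h _ t) (@Rintegral_leb_support _ (fun x => a x * bump p q n x) q).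
- by apply: eq_Rintegral => x _; rewrite mulrC.
- by apply: intM => //; exact: test_Lfun2.
- by move=> x qx; rewrite bump_out ?mulr0// negb_and -!leNgt (ltW qx) orbT.
Qed.

Lemma weak_derivative_of0 g : weak_derivative 1 0 g -> g = 0.
Proof.
move=> hg.
have H phi : test_function phi -> cintegral (fun x => L2_fun g x * (phi x)%:C) = 0.
  move=> t; have := hg _ t; rewrite expr1 mulN1r.
  rewrite -(L2_dot_mk_real 0 (test_Lfun2 (test_derive t))) (sip0l (sip_dot dot)).
  by move/eqP; rewrite eq_sym oppr_eq0 => /eqP.
apply: L2_eq0; apply: test_orthogonal_ae0; rewrite ?reL2_Lfun ?imL2_Lfun// => phi /H.
  by rewrite cintegral_real => /(congr1 (fun z => Re z)).
by rewrite cintegral_real => /(congr1 (fun z => Im z)).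
Qed.

(** The graph is the adjoint of the set of pairs (phi, -phi') with phi a test function, hence
    closed. Test functions have boundary value 0, so the hypothesis of the maximality clause applies
    to them and gives the weak derivative. *)
Lemma boundary_system_weak_graph : boundary_system dot weak_graph expL2.
Proof.
have hs := sip_dot dot.
have Dexp : weak_graph (expL2, - expL2).
  by apply/weak_derivative1P; exists 1; exact: half_line_primitive_exp.
have lD : linear_relation dot weak_graph.
  pose B : set (L2 R * L2 R) := [set q | exists phi (t : test_function phi),
    q.1 = mkL2 (test_Lfun2 t) zero_Lfun /\
    q.2 = - mkL2 (test_Lfun2 (test_derive t)) zero_Lfun].
  apply: (@adjoint_linear_relation _ _ dot B); apply/seteqP; split=> [p hp q|p hp phi t].
    case=> phi [t [-> ->]]; have := hp _ t.
    rewrite (sipNr hs) !L2_dot_mk_real expr1 mulN1r => e.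
    by rewrite -[LHS]opprK -e.
  have := hp (mkL2 (test_Lfun2 t) zero_Lfun, - mkL2 (test_Lfun2 (test_derive t)) zero_Lfun).
  rewrite /= (sipNr hs) !L2_dot_mk_real expr1 mulN1r => ->; first by rewrite opprK.
  by exists phi, t.
have gr p r : weak_graph p -> weak_graph r ->
    dot p.2 r.1 + dot p.1 r.2 = - (boundary dot expL2 p * conjc (boundary dot expL2 r)).
  by case: p r => [f g] [u v] /weak_boundary h1 /weak_boundary h2; exact: green.
split => //.
  move=> [f g] hfg phi t.
  pose r := (mkL2 (test_Lfun2 t) zero_Lfun, mkL2 (test_Lfun2 (test_derive t)) zero_Lfun).
  have hr := half_line_primitive_test t.
  have := hfg r; rewrite (boundary_half_line hr) /= => /(_ _ erefl) e.
  have {}e : dot f r.2 + dot g r.1 = 0.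
    transitivity (conjc (dot r.2 f + dot r.1 g)).
      by rewrite rmorphD/=; congr (_ + _); exact: (sipC hs).
    by rewrite e ?rmorph0//; apply/weak_derivative1P; exists 0.
  move: e; rewrite !L2_dot_mk_real expr1 mulN1r => /eqP.
  by rewrite addr_eq0 => /eqP.
split.
- apply/eqP => e0; have := boundary_half_line half_line_primitive_exp.
  rewrite e0 /boundary (sip0r hs) => /eqP.
  by rewrite eq_sym oner_eq0.
- exact: weak_derivative_of0.
- exact: weak_derivative_ker0.
Qed.

(** The derivative of a test function is again one; inserting it into the definition of the first
    derivative turns one condition into the other. *)
Lemma weak_derivative2 f f1 g : weak_derivative 1 f f1 ->
  weak_derivative 2 f (- g) <-> weak_derivative 1 f1 (- g).
Proof.
move=> h; have d2 phi : derive1n 2 phi = derive1n 1 (derive1 phi) by [].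
split=> h2 phi t; have := h2 _ t; have := h _ (test_derive t); rewrite d2 expr1 mulN1r.
  by rewrite sqrrN expr1n mul1r => -> <-; rewrite mulN1r opprK.
by rewrite mulN1r sqrrN expr1n mul1r => -> ->; rewrite opprK.
Qed.

Lemma prim_continuous_itv0y a : a \in Lfun leb 2%:E -> {within `[0, +oo[, continuous (prim a)}.
Proof.
move=> ha; have [_ ai] := Lfun2_loc_integrable ha.
have h x : 0 <= x -> {within `[0, x + 1], continuous (prim a)}.
  by move=> x0; apply: prim_continuous => //; rewrite addr_ge0.
apply/continuous_within_itvcyP; split=> [x x0|].
  have x0' : 0 < x by move: x0; rewrite in_itv/= andbT.
  have /continuous_within_itvP[|+ _ _] := h _ (ltW x0'); first by rewrite addr_gt0.
  by apply; rewrite in_itv/= x0' ltrDl ltr01.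
have /continuous_within_itvP[|_ + _] := h 0 (lexx 0); first by rewrite add0r ltr01.
exact.
Qed.

(** The primitive is a continuous representative, and two continuous functions that agree almost
    everywhere on the half-line agree at 0. *)
Lemma boundary_valueP f g z : weak_derivative 1 f g ->
  boundary_value f z <-> z = boundary dot expL2 (f, g).
Proof.
move=> /weak_boundary; set w := boundary _ _ _ => -[hr hi].
have cr := prim_continuous_itv0y (reL2_Lfun g); have ci := prim_continuous_itv0y (imL2_Lfun g).
have cD (c : R) (a : R -> R) : {within `[0, +oo[, continuous a} ->
    {within `[0, +oo[, continuous (fun x => c + a x)}.
  by move=> ca x; apply: cvgD; [exact: cvg_cst|exact: ca].
have p0 (a : R -> R) : prim a 0 = 0 by rewrite /prim set_itv1 Rintegral_set1.
split=> [[u [ur ui ue u0]]|->]; last first.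
  exists (fun x => (Re w + prim (reL2 g) x) +i* (Im w + prim (imL2 g) x)); split.
  - exact: cD.
  - exact: cD.
  - by apply: filterS2 hr hi => x h1 h2 _; apply: complexP; rewrite /= -?h1 -?h2.
  - by rewrite !p0 !addr0; case: w {hr hi}.
have B (a b : R -> R) : {within `[0, +oo[, continuous a} -> {within `[0, +oo[, continuous b} ->
    {ae leb, forall x, a x = b x} -> a 0 = b 0.
  move=> ca cb ab; apply/eqP; rewrite -subr_eq0; apply/eqP.
  apply: (@continuous_ae_zero _ (fun x => a x - b x)).
    by move=> x; apply: cvgB; [exact: ca|exact: cb].
  by apply: filterS ab => x ->; rewrite subrr.
rewrite -u0; apply: complexP.
  have := B _ _ ur (cD (Re w) _ cr); rewrite p0 addr0; apply.
  by apply: filterS2 ue hr => x /(_ I) -> <-.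
have := B _ _ ui (cD (Im w) _ ci); rewrite p0 addr0; apply.
by apply: filterS2 ue hi => x /(_ I) -> <-.
Qed.

Lemma L_op_laplacian (c : \bar R) : (0 <= c)%E -> L_op c = laplacian dot weak_graph expL2 c.
Proof.
move=> c0; have uniq1 f g h : weak_derivative 1 f g -> weak_derivative 1 f h -> g = h.
  have [[_ Dl _] _ _ _ _] := boundary_system_weak_graph.
  move=> hg hh; apply/eqP; rewrite -subr_eq0; apply/eqP/weak_derivative_of0.
  have := Dl (-1) (f, h) (f, g) hh hg.
  by rewrite /weak_graph/= !scaleN1r addNr addrC.
apply/seteqP; split => -[f g] /=.
  case=> /= -[f1 [f2 [h1 _]]] hbc h2; exists f1.
  have h3 : weak_derivative 1 f1 (- g) by exact: (@weak_derivative2 f f1 g h1).1.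
  split; [exact: h1|exact: h3|].
  case: c c0 hbc => [r||//] _ hbc; last exact/esym/((boundary_valueP _ h1).1 hbc).
  case: hbc => f1' [z [z1 [h1' hz hz1 zz1]]].
  (* The derivative in [robin] is quantified separately from the one in [W22]; uniqueness of weak
     derivatives identifies the two. *)
  rewrite (uniq1 _ _ _ h1' h1) in hz1.
  by rewrite /boundary_cond -((boundary_valueP _ h3).1 hz1) -((boundary_valueP _ h1).1 hz).
case=> f1 [h1 h2 hbc].
have h3 : weak_derivative 2 f (- g) by exact: (@weak_derivative2 f f1 g h1).2.
split; [by exists f1, (- g)| |exact: h3].
case: c c0 hbc => [r||//] _ hbc; last by apply/(boundary_valueP _ h1); rewrite [RHS]hbc.
exists f1, (boundary dot expL2 (f, f1)), (boundary dot expL2 (f1, - g)); split => //.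
  exact/(boundary_valueP _ h1).
exact/(boundary_valueP _ h2).
Qed.

End weak_derivatives.

(** * Completeness of L_2 *)

Section fast_cauchy.
Variables (R : realType) (E : lmodType R[i]) (b : E -> E -> R[i]).
Hypothesis hb : sip b.

(** A Cauchy sequence with a convergent subsequence converges; the rate 8^-k is the one that
    [riesz_fischer] asks for. *)
Lemma complete_sip_fast :
  (forall u : nat -> E, (forall k, sqn b (u k.+1 - u k) <= 8^-1 ^+ k) ->
    exists l, cvg_sip b u l) -> complete_sip b setT.
Proof.
move=> H u _ cu.
have /choice[N hN] (k : nat) : exists N, forall m n, (N <= m)%N -> (N <= n)%N ->
    sqn b (u m - u n) < 8^-1 ^+ k.
  by apply: cu; rewrite exprn_gt0// invr_gt0.
(* The sum makes s nondecreasing with s k >= N k, and the summand k makes it unbounded. *)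
pose s k := (k + \sum_(i < k.+1) N i)%N.
have sN k : (N k <= s k)%N by rewrite /s big_ord_recr/= addnA leq_addl.
have sS k : (s k <= s k.+1)%N by rewrite /s [in leqRHS]big_ord_recr/= addSn addnA leqW// leq_addr.
have [l hl] : exists l, cvg_sip b (fun k => u (s k)) l.
  by apply: H => k; apply/ltW/hN => //; exact: leq_trans (sN k) (sS k).
exists l => //; apply/cvgr0Pnorm_lt => e e0.
have e4 : 0 < e / 4 by rewrite divr_gt0.
have [M hM] := cu _ e4.
move/cvgr0Pnorm_lt : hl => /(_ _ e4)[K _ hK].
exists M => // n /= Mn; rewrite ger0_norm ?(sqn_ge0 hb)//.
have := hK (maxn K M) (leq_maxl _ _); rewrite ger0_norm ?(sqn_ge0 hb)// => h1.
have h2 := hM n (s (maxn K M)) Mn (leq_trans (leq_maxr K M) (leq_addr _ _)).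
have := sqnD_le hb (u n - u (s (maxn K M))) (u (s (maxn K M)) - l).
rewrite addrA subrK => h3; apply: le_lt_trans h3 _; lra.
Qed.

End fast_cauchy.

Section L2_complete.
Variable R : realType.
Notation leb := (@leb R).
Notation dot := (@L2_dot R : {dot (L2 R) for Num.conj}).
Implicit Types (f g : L2 R) (a b : R -> R).

#[local] Existing Instance ae_leb_filter.

Lemma L2_funB f g : {ae leb, forall x, L2_fun (f - g) x = L2_fun f x - L2_fun g x}.
Proof.
have := L2_fun_pi (repr f - repr g).
by rewrite Quotient.pi_add Quotient.pi_opp !reprK.
Qed.

Lemma sqn_L2B f g a b : a \in Lfun leb 2%:E -> b \in Lfun leb 2%:E ->
  {ae leb, forall x, reL2 g x = a x} -> {ae leb, forall x, imL2 g x = b x} ->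
  sqn dot (f - g) = \int[leb]_x (reL2 f x - a x) ^+ 2 + \int[leb]_x (imL2 f x - b x) ^+ 2.
Proof.
move=> ha hb ga gb; rewrite /sqn Re_L2_dot.
have E (p q r : R -> R) : p \in Lfun leb 2%:E -> q \in Lfun leb 2%:E -> r \in Lfun leb 2%:E ->
    {ae leb, forall x, r x = p x - q x} ->
    \int[leb]_x (r x * r x) = \int[leb]_x (p x - q x) ^+ 2.
  move=> hp hq hr e; rewrite /Rintegral; congr fine; apply: ae_eq_integral => //.
  - by apply: measurable_int (Lfun2_mul_integrable hr hr).
  - apply/measurable_EFinP; apply: (@measurable_funX _ _ _ _ (fun x => p x - q x)).
    by apply: measurable_funB; exact: Lfun2_measurable.
  - by apply: filterS e => x -> _; rewrite expr2.
congr (_ + _); apply: E => //; do ?[exact: reL2_Lfun|exact: imL2_Lfun].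
  by apply: filterS2 (L2_funB f g) ga => x h1 h2; rewrite /reL2 h1 ReD ReN -h2.
by apply: filterS2 (L2_funB f g) gb => x h1 h2; rewrite /imL2 h1 ImD ImN -h2.
Qed.

Lemma L2_complete : complete_sip dot setT.
Proof.
apply: complete_sip_fast => [|u hu]; first exact: sip_dot.
have hu' k : \int[leb]_x (reL2 (u k.+1) x - reL2 (u k) x) ^+ 2 <= 8^-1 ^+ k /\
    \int[leb]_x (imL2 (u k.+1) x - imL2 (u k) x) ^+ 2 <= 8^-1 ^+ k.
  have := hu k; rewrite (@sqn_L2B _ _ (reL2 (u k)) (imL2 (u k))); first last.
  - exact: aeW.
  - exact: aeW.
  - exact: imL2_Lfun.
  - exact: reL2_Lfun.
  have I0 (v : R -> R) : 0 <= \int[leb]_x v x ^+ 2 by apply: Rintegral_ge0 => x _; exact: sqr_ge0.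
  by move=> h; split; apply: le_trans h; rewrite ?lerDl ?lerDr; exact: I0.
have [g gL hg] := riesz_fischer (fun k => reL2_Lfun (u k)) (fun k => (hu' k).1).
have [h hL hh] := riesz_fischer (fun k => imL2_Lfun (u k)) (fun k => (hu' k).2).
exists (mkL2 gL hL).
(* The constant is 8 for the real part plus 8 for the imaginary part. *)
apply: (cvg_sip_squeeze (sip_dot dot) (y := fun k => 16 * 4^-1 ^+ k)) => [k|].
  rewrite (@sqn_L2B _ _ g h)//; [|exact: reL2_mk|exact: imL2_mk].
  have S (p q : R -> R) : \int[leb]_x (p x - q x) ^+ 2 = \int[leb]_x (q x - p x) ^+ 2.
    by apply: eq_Rintegral => x _; rewrite -sqrrN opprB.
  rewrite S [X in _ + X]S; have := hg k; have := hh k; lra.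
rewrite -[X in _ --> X](mulr0 16); apply: cvgMr; apply: cvg_expr.
by rewrite ger0_norm ?invr_ge0// invf_lt1// ltr1n.
Qed.

End L2_complete.

(** * Means of the parameters *)

Section numeric_means.
Variable R : realType.
Implicit Types (c d x y : \bar R) (r s : R) (n : nat).

Lemma amean_ge0 c d : (0 <= c)%E -> (0 <= d)%E -> (0 <= amean c d)%E.
Proof. by case: c d => [r||] [s||] //=; rewrite !lee_fin => r0 s0; rewrite divr_ge0// addr_ge0. Qed.

Lemma cinv_ge0 c : (0 <= c)%E -> (0 <= cinv c)%E.
Proof.
case: c => [r||//] //= h; case: eqP => // _.
by rewrite lee_fin invr_ge0.
Qed.

Lemma hmean_ge0 c d : (0 <= c)%E -> (0 <= d)%E -> (0 <= hmean c d)%E.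
Proof. by move=> c0 d0; apply: cinv_ge0; apply: amean_ge0; exact: cinv_ge0. Qed.

Fixpoint ah_num c d n : \bar R * \bar R :=
  if n is m.+1 then let: (a, b) := ah_num c d m in (amean a b, hmean a b) else (c, d).

Lemma ah_numS c d n : ah_num c d n.+1 =
  (amean (ah_num c d n).1 (ah_num c d n).2, hmean (ah_num c d n).1 (ah_num c d n).2).
Proof. by rewrite /=; case: (ah_num c d n). Qed.

Lemma ah_num_ge0 c d n : (0 <= c)%E -> (0 <= d)%E ->
  (0 <= (ah_num c d n).1)%E /\ (0 <= (ah_num c d n).2)%E.
Proof.
move=> c0 d0; elim: n => //= n; case: (ah_num c d n) => a b /= [a0 b0].
by split; [exact: amean_ge0|exact: hmean_ge0].
Qed.

Lemma hmean_fin r s : 0 < r -> 0 < s -> hmean r%:E s%:E = (2 * r * s / (r + s))%:E.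
Proof.
move=> r0 s0; rewrite /hmean /= !gt_eqF//= gt_eqF ?divr_gt0 ?addr_gt0 ?invr_gt0//.
by congr (_%:E); field; rewrite !gt_eqF ?addr_gt0 //.
Qed.

Lemma hmean_y r : 0 < r -> hmean r%:E +oo = (2 * r)%:E.
Proof.
move=> r0; rewrite /hmean /= gt_eqF//= addr0 gt_eqF ?divr_gt0 ?invr_gt0//.
by congr (_%:E); field; rewrite gt_eqF.
Qed.

Lemma hmean0 c : (0 <= c)%E -> hmean c 0%:E = 0%:E.
Proof.
by rewrite /hmean /= eqxx; case: c => [r||//] //= _; case: eqP.
Qed.

Lemma kappa_dist r s : 0 <= r -> 0 <= s -> `|kappa r%:E - kappa s%:E| <= `|r - s|.
Proof.
move=> r0 s0 /=.
have -> : r / (1 + r) - s / (1 + s) = (r - s) * ((1 + r) * (1 + s))^-1.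
  by field; rewrite !gt_eqF ?ltr_wpDr.
rewrite normrM ler_piMr// ger0_norm ?invr_ge0 ?mulr_ge0 ?addr_ge0//.
rewrite invf_le1 ?mulr_gt0 ?ltr_wpDr//.
rewrite mulrDr mulr1 mulrDl mul1r; have := mulr_ge0 r0 s0; lra.
Qed.

Lemma cvg_geometric0 (K : R) : K / 2 ^+ n @[n --> \oo] --> (0 : R).
Proof.
rewrite (_ : (fun n => _) = (fun n => K * 2^-1 ^+ n)); last first.
  by apply/funext => n; rewrite exprVn.
rewrite -[X in _ --> X](mulr0 K); apply: cvgMr; apply: cvg_expr.
by rewrite ger0_norm ?invr_ge0// invf_lt1// ltr1n.
Qed.

Lemma kappa_squeeze (u : nat -> \bar R) x (K : R) :
  (forall n, `|kappa (u n) - kappa x| <= K / 2 ^+ n) -> kappa (u n) @[n --> \oo] --> kappa x.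
Proof.
move=> h; apply/subr_cvg0/norm_cvg0P.
apply: (@squeeze_cvgr _ _ _ _ (fun=> 0) (fun n => K / 2 ^+ n)).
- by apply: nearW => n; rewrite normr_ge0 h.
- exact: cvg_cst.
- exact: cvg_geometric0.
Qed.

(** One step preserves the product and replaces the difference a - b by (a - b)^2 / (2(a + b)), at
    most half of it in absolute value. *)
Lemma ah_num_fin r s n : 0 < r -> 0 < s -> exists a b, [/\ ah_num r%:E s%:E n = (a%:E, b%:E),
  0 < a, 0 < b, a * b = r * s & `|a - b| <= `|r - s| / 2 ^+ n].
Proof.
move=> r0 s0; elim: n => [|n [a [b [/= -> a0 b0 ab hn]]]].
  by exists r, s; rewrite divr1.
have ab0 : 0 < a + b by rewrite addr_gt0.
exists ((a + b) / 2), (2 * a * b / (a + b)); split.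
- by rewrite hmean_fin.
- by rewrite divr_gt0.
- by rewrite divr_gt0// !mulr_gt0.
- by rewrite -ab; field; rewrite gt_eqF.
have -> : (a + b) / 2 - 2 * a * b / (a + b) = (a - b) * ((a - b) / (a + b)) / 2.
  by field; rewrite gt_eqF.
rewrite exprS invfM [leRHS]mulrCA [leRHS]mulrC normrM (@ger0_norm _ 2^-1)//.
rewrite ler_wpM2r//; apply: le_trans hn; rewrite normrM ler_piMr//.
rewrite normrM normfV (gtr0_norm ab0) ler_pdivrMr// mul1r.
by rewrite ler_norml; apply/andP; split; lra.
Qed.

(** The geometric mean m lies between a and b. *)
Lemma dist_geometric_mean (a b m : R) : 0 < a -> 0 < b -> 0 < m -> a * b = m * m ->
  `|a - m| <= `|a - b|.
Proof.
move=> a0 b0 m0 ab; have [h|h] := leP a m.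
  have mb : m <= b by rewrite leNgt; apply/negP => bm; have : a * b < m * m by [nra]; lra.
  rewrite ler0_norm ?subr_le0// ler0_norm; lra.
have mb : b <= m by rewrite leNgt; apply/negP => bm; have : m * m < a * b by [nra]; lra.
have [h1 h2] : 0 <= a - m /\ 0 <= a - b by split; lra.
rewrite !ger0_norm//; lra.
Qed.

Lemma cvg_ah_fin r s : 0 < r -> 0 < s ->
  kappa (ah_num r%:E s%:E n).1 @[n --> \oo] --> kappa (Num.sqrt (r * s))%:E /\
  kappa (ah_num r%:E s%:E n).2 @[n --> \oo] --> kappa (Num.sqrt (r * s))%:E.
Proof.
move=> r0 s0; set m := Num.sqrt _.
have m0 : 0 < m by rewrite sqrtr_gt0 mulr_gt0.
have mm : m * m = r * s by rewrite -expr2 sqr_sqrtr// ltW// mulr_gt0.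
split; apply: (@kappa_squeeze _ _ `|r - s|) => n;
  have [a [b [-> a0 b0 ab h]]] := ah_num_fin n r0 s0; apply: le_trans h.
  apply: le_trans (kappa_dist (ltW a0) (ltW m0)) _.
  by apply: dist_geometric_mean => //; rewrite mm.
apply: le_trans (kappa_dist (ltW b0) (ltW m0)) _; rewrite [leRHS]distrC.
by apply: dist_geometric_mean => //; rewrite mm mulrC.
Qed.

Lemma cvg_ah_y r : 0 < r ->
  kappa (ah_num r%:E +oo n).1 @[n --> \oo] --> kappa (+oo%E : \bar R) /\
  kappa (ah_num r%:E +oo n).2 @[n --> \oo] --> kappa (+oo%E : \bar R).
Proof.
move=> r0.
(* From index 1 on the first parameter stays +oo and the second doubles; at index 0 the infinite
   parameter is the second one, hence the shift. *)
have E n : ah_num r%:E +oo n.+1 = (+oo%E, (2 ^+ n.+1 * r)%:E).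
  elim: n => [|n]; first by rewrite /= hmean_y// expr1.
  rewrite (ah_numS _ _ n.+1) => -> /=.
  have -> : hmean +oo (2 ^+ n.+1 * r)%:E = hmean (2 ^+ n.+1 * r)%:E +oo.
    by rewrite /hmean /= ; case: eqP => //= _; rewrite addrC.
  by rewrite hmean_y ?mulr_gt0 ?exprn_gt0// mulrA -exprS.
split; [rewrite -(cvg_shiftS (fun n => kappa (ah_num r%:E +oo n).1))
  |rewrite -(cvg_shiftS (fun n => kappa (ah_num r%:E +oo n).2))].
  by rewrite (_ : (fun n => _) = cst 1); [exact: cvg_cst|apply/funext => n; rewrite E].
apply: (@kappa_squeeze (fun n => (ah_num r%:E +oo n.+1).2) _ r^-1) => n; rewrite E /=.
have p0 : 0 < 2 ^+ n.+1 * r by rewrite mulr_gt0// exprn_gt0.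
have -> : 2 ^+ n.+1 * r / (1 + 2 ^+ n.+1 * r) - 1 = - (1 + 2 ^+ n.+1 * r)^-1.
  by field; rewrite gt_eqF// addr_gt0.
rewrite normrN ger0_norm ?invr_ge0 ?addr_ge0 ?(ltW p0)//.
rewrite -invfM lef_pV2 ?posrE ?mulr_gt0 ?exprn_gt0 ?addr_gt0// exprS.
have : 0 < r * 2 ^+ n by rewrite mulr_gt0// exprn_gt0.
lra.
Qed.

Lemma cvg_ah0 r : 0 < r ->
  kappa (ah_num r%:E 0%:E n).1 @[n --> \oo] --> kappa (0%:E : \bar R) /\
  kappa (ah_num r%:E 0%:E n).2 @[n --> \oo] --> kappa (0%:E : \bar R).
Proof.
move=> r0.
have E n : ah_num r%:E 0%:E n = ((r / 2 ^+ n)%:E, 0%:E).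
  elim: n => [|n]; first by rewrite /= divr1.
  rewrite ah_numS => -> /=; rewrite hmean0 ?lee_fin ?divr_ge0 ?exprn_ge0 ?(ltW r0)//=.
  by rewrite addr0 exprSr invfM mulrA.
split; last first.
  by rewrite (_ : (fun n => _) = cst (kappa (0%:E : \bar R))); [exact: cvg_cst|apply/funext => n; rewrite E].
apply: (@kappa_squeeze _ _ r) => n; rewrite E.
have p0 : 0 <= r / 2 ^+ n by rewrite divr_ge0 ?exprn_ge0 ?ltW.
by apply: le_trans (kappa_dist p0 (lexx 0)) _; rewrite subr0 ger0_norm.
Qed.

Lemma ah_num_y0 n : ah_num +oo 0%:E n = (+oo%E, 0%:E).
Proof. by elim: n => //= n ->; rewrite hmean0. Qed.

End numeric_means.

(** * Arithmetic-harmonic iteration of the operators *)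

Section laplacian_ah.
Variables (R : realType) (H : lmodType R[i]) (dot : {dot H for Num.conj}).
Hypothesis H_complete : complete_sip dot setT.
Variables (D : set (H * H)) (e : H).
Hypothesis De : boundary_system dot D e.

Lemma laplacian_ah (c d x y : \bar R) : (0 <= c)%E -> (0 <= d)%E -> (0 <= x)%E -> (0 <= y)%E ->
  kappa (ah_num c d n).1 @[n --> \oo] --> kappa x ->
  kappa (ah_num c d n).2 @[n --> \oo] --> kappa y ->
  ah_mean dot (laplacian dot D e c) (laplacian dot D e d) = (laplacian dot D e x, laplacian dot D e y).
Proof.
move=> c0 d0 x0 y0 hx hy.
have E n : ah_seq dot (laplacian dot D e c) (laplacian dot D e d) n =
    (laplacian dot D e (ah_num c d n).1, laplacian dot D e (ah_num c d n).2).
  elim: n => //= n ->; have [] := ah_num_ge0 n c0 d0.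
  by case: (ah_num c d n) => a b /= a0 b0; rewrite laplacian_arith// laplacian_harm.
rewrite /ah_mean; under eq_fun do rewrite E; under [X in (_, sr_lim _ X)]eq_fun do rewrite E.
by congr (_, _); apply: laplacian_sr => // n; have [] := ah_num_ge0 n c0 d0.
Qed.

End laplacian_ah.

Theorem proposition7p3 (R : realType) (c d : R) (hc : 0 < c) (hd : 0 < d) :
  [/\ lr_scale 2^-1 (form_sum (@L2_dot R) (L_op c%:E) (L_op d%:E))
        = L_op ((c + d) / 2)%:E,
      c0_mean (L_op c%:E) (L_op d%:E) = L_op (c0_num c d)%:E,
      harm_mean (@L2_dot R) (L_op c%:E) (L_op d%:E)
        = L_op (2 * c * d / (c + d))%:E
    & ah_mean (@L2_dot R) (L_op c%:E) (L_op d%:E)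
        = (L_op (Num.sqrt (c * d))%:E, L_op (Num.sqrt (c * d))%:E)] /\
  [/\ lr_scale 2^-1 (form_sum (@L2_dot R) (L_op c%:E) (L_op +oo%E))
        = L_op +oo%E,
      c0_mean (L_op c%:E) (L_op +oo%E) = L_op (2 * c + 1)%:E,
      harm_mean (@L2_dot R) (L_op c%:E) (L_op +oo%E) = L_op (2 * c)%:E
    & ah_mean (@L2_dot R) (L_op c%:E) (L_op +oo%E)
        = (L_op +oo%E, L_op +oo%E)] /\
  [/\ lr_scale 2^-1 (form_sum (@L2_dot R) (L_op c%:E) (L_op 0%:E))
        = L_op (c / 2)%:E,
      c0_mean (L_op c%:E) (L_op 0%:E) = L_op (c / (2 + c))%:E,
      harm_mean (@L2_dot R) (L_op c%:E) (L_op 0%:E) = L_op 0%:E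
    & ah_mean (@L2_dot R) (L_op c%:E) (L_op 0%:E) = (L_op 0%:E, L_op 0%:E)] /\
  [/\ lr_scale 2^-1 (form_sum (@L2_dot R) (L_op 0%:E) (L_op +oo%E))
        = L_op +oo%E,
      c0_mean (L_op 0%:E) (L_op +oo%E) = L_op 1%:E :> set (L2 R * L2 R),
      harm_mean (@L2_dot R) (L_op 0%:E) (L_op +oo%E) = L_op 0%:E
    & ah_mean (@L2_dot R) (L_op +oo%E) (L_op 0%:E)
        = (L_op +oo%E, L_op 0%:E)].
Proof.
have De := boundary_system_weak_graph R; have Hc := @L2_complete R.
pose L := @L_op_laplacian R.
have c0 : (0 <= c%:E)%E by rewrite lee_fin ltW.
have d0 : (0 <= d%:E)%E by rewrite lee_fin ltW.
have y0 : (0 <= +oo :> \bar R)%E by [].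
have z0 : (0 <= 0%:E :> \bar R)%E by [].
have A x y : (0 <= x)%E -> (0 <= y)%E ->
    lr_scale 2^-1 (form_sum (@L2_dot R) (L_op x) (L_op y)) = L_op (amean x y).
  by move=> x0 x1; rewrite !L ?amean_ge0//; exact: laplacian_arith.
have B x y : (0 <= x)%E -> (0 <= y)%E ->
    harm_mean (@L2_dot R) (L_op x) (L_op y) = L_op (hmean x y).
  by move=> x0 x1; rewrite !L ?hmean_ge0//; exact: laplacian_harm.
have C x y (r : R) : (0 <= x)%E -> (0 <= y)%E -> 0 <= r ->
    2 * kappa r%:E = kappa x + kappa y -> c0_mean (L_op x) (L_op y) = L_op r%:E.
  by move=> x0 x1 r0 h; rewrite !L//; exact: (laplacian_c0 Hc De).
have AH x y p q := @laplacian_ah _ _ _ Hc _ _ De x y p q.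
do ![split].
- by rewrite A.
(* The number c_0(c, d) is the one whose [kappa] is the average of those of c and d: both sides
   equal (c + d + 2cd)/((1 + c)(1 + d)). *)
- have p1 : 0 < 2 + c + d by rewrite !addr_gt0.
  apply: C => //; rewrite /c0_num.
    by rewrite divr_ge0 ?addr_ge0 ?mulr_ge0 ?ltW.
  rewrite /kappa; field; rewrite !gt_eqF ?addr_gt0//=.
  have := mulr_gt0 hc hd; lra.
- by rewrite B// hmean_fin.
- by have [h1 h2] := cvg_ah_fin hc hd; rewrite !L ?lee_fin ?sqrtr_ge0//; apply: AH => //; rewrite lee_fin sqrtr_ge0.
- by rewrite A.
- apply: C => //; first by rewrite addr_ge0 ?mulr_ge0 ?ltW.
  by rewrite /kappa; field; rewrite !gt_eqF ?addr_gt0 ?mulr_gt0.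
- by rewrite B// hmean_y.
- by have [h1 h2] := cvg_ah_y hc; rewrite !L//; apply: AH.
- by rewrite A//= addr0.
- apply: C => //; first by rewrite divr_ge0 ?addr_ge0 ?ltW.
  by rewrite /kappa; field; rewrite !gt_eqF ?addr_gt0.
- by rewrite B// hmean0.
- by have [h1 h2] := cvg_ah0 hc; rewrite !L//; apply: AH.
- by rewrite A.
- by apply: C => //; rewrite /kappa; field.
- rewrite B//; congr L_op.
  by rewrite /hmean /= eqxx.
(* The pair of parameters (+oo, 0) is fixed by the iteration, so the two limits remain distinct. *)
- rewrite !L//; apply: AH => //.
    by rewrite (_ : (fun n => _) = cst (kappa (+oo%E : \bar R))); [exact: cvg_cst|apply/funext => n; rewrite ah_num_y0].
  by rewrite (_ : (fun n => _) = cst (kappa (0%:E : \bar R))); [exact: cvg_cst|apply/funext => n; rewrite ah_num_y0].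
Qed.
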